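(* Let $\sigma\ge1$ and $\mu\ge1/2$. A function $f\in C^\infty(\mathbb{T}^m\times\mathbb{R}^n)\cap L^1(\mathbb{T}^m\times\mathbb{R}^n)$ belongs to $\mathcal{S}_{\sigma,\mu}(\mathbb{T}^m\times\mathbb{R}^n)$ if and only if there exist $C_0,C_1,\varepsilon>0$ such that, for all $\alpha,\beta\in\mathbb{N}_0^n$, $$\sup_{(k,\xi)\in\mathbb{Z}^m\times\mathbb{R}^n}e^{\varepsilon|k|^{1/\sigma}}|\xi^\alpha\partial_\xi^\beta\widehat{\widehat{f}}(k,\xi)|\leq C_0C_1^{|\alpha+\beta|}(\alpha!\beta!)^\mu.$$
   Context: $\mathbb{T}^m=(\mathbb{R}/2\pi\mathbb{Z})^m$. Here $\widehat{\widehat f}(k,\xi)=\frac1{(2\pi)^m}\int_{[0,2\pi]^m}\int_{\mathbb{R}^n}f(t,x)e^{-i(k\cdot t+\xi\cdot x)}\,dx\,dt$ is the mixed partial Fourier transform; the displayed inequality is understood to include the existence of the $\xi$-derivatives involved. For $C>0$, $\mathcal{S}_{\sigma,\mu,C}(\mathbb{T}^m\times\mathbb{R}^n)$ is the space of $\varphi\in C^\infty(\mathbb{T}^m\times\mathbb{R}^n)$ with $$\sup_{\alpha,\beta\in\mathbb{N}_0^n}\sup_{\gamma\in\mathbb{N}_0^m}C^{-|\alpha+\beta|-|\gamma|}\gamma!^{-\sigma}(\alpha!\beta!)^{-\mu}\sup_{(t,x)}|x^\alpha\partial_x^\beta\partial_t^\gamma\varphi(t,x)|<\infty,$$ and $\mathcal{S}_{\sigma,\mu}(\mathbb{T}^m\times\mathbb{R}^n)=\bigcup_{C>0}\mathcal{S}_{\sigma,\mu,C}(\mathbb{T}^m\times\mathbb{R}^n)$.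 *)

(* Defs.v *)
From HB Require Import structures.
From mathcomp Require Import all_boot all_order all_algebra.
From mathcomp Require Import all_classical all_reals all_analysis.
From mathcomp Require Import complex.

Set Implicit Arguments.
Unset Strict Implicit.
Unset Printing Implicit Defensive.
Import Order.TTheory GRing.Theory Num.Theory.
Import numFieldNormedType.Exports.
Import ComplexField.Normc.

Local Open Scope classical_set_scope.
Local Open Scope complex_scope.
Local Open Scope ring_scope.

(* The library proves this inside a section, but its canonical instance on
   m1 \x m2 is shadowed by the one for subprobability measures. *)
Lemma product_sigma_finite d1 d2 (T1 : measurableType d1)
    (T2 : measurableType d2) (R : realType)
    (m1 : {sigma_finite_measure set T1 -> \bar R})
    (m2 : {sigma_finite_measure set T2 -> \bar R}) :
  sigma_finite setT (m1 \x m2)%E.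
Proof.
have /sigma_finiteP[F [TF ndF Foo]] := sigma_finiteT m1.
have /sigma_finiteP[G [TG ndG Goo]] := sigma_finiteT m2.
exists (fun n => F n `*` G n).
  rewrite -setXTT TF TG predeqE => -[x y]; split.
    move=> [/= [n _ Fnx] [k _ Gky]]; exists (maxn n k) => //; split.
    - by move: x Fnx; exact/subsetPset/ndF/leq_maxl.
    - by move: y Gky; exact/subsetPset/ndG/leq_maxr.
  by move=> [n _ []/= ? ?]; split; exists n.
move=> k; have [? ?] := Foo k; have [? ?] := Goo k.
split; first exact: measurableX.
by rewrite product_measure1E// lte_mul_pinfty// ge0_fin_numE.
Qed.

Section LebesgueTuple.
Variable R : realType.
Let RB := measurableTypeR R.

Section Cons.
Variables (n : nat) (mu : {sigma_finite_measure set (n.-tuple RB) -> \bar R}).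

Definition cons_pair (p : RB * n.-tuple RB) : n.+1.-tuple RB :=
  [tuple of p.1 :: p.2].

Lemma measurable_cons_pair : measurable_fun setT cons_pair.
Proof.
exact: (measurable_cons (f := fst) (g := snd) measurable_fst measurable_snd).
Qed.

Definition cons_measure : set (n.+1.-tuple RB) -> \bar R :=
  pushforward (@lebesgue_measure R \x mu)%E cons_pair.

Let cons_measure0 : cons_measure set0 = 0%E.
Proof. by rewrite /cons_measure /pushforward preimage_set0 measure0. Qed.

Let cons_measure_ge0 A : (0 <= cons_measure A)%E.
Proof. by rewrite /cons_measure /pushforward; apply: measure_ge0. Qed.

Let cons_measure_semi_sigma_additive : semi_sigma_additive cons_measure.
Proof.
move=> F mF tF mUF.
have mf := measurable_cons_pair.
rewrite /cons_measure /pushforward preimage_bigcup.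
apply: measure_semi_sigma_additive.
- by move=> i; rewrite -[X in measurable X]setTI; exact: mf.
- apply/trivIsetP => /= i j _ _ ij; rewrite -preimage_setI.
  by move/trivIsetP : tF => /(_ _ _ _ _ ij) ->//; rewrite preimage_set0.
- by rewrite -preimage_bigcup -[X in measurable X]setTI; exact: mf.
Qed.

HB.instance Definition _ := isMeasure.Build _ _ _ cons_measure
  cons_measure0 cons_measure_ge0 cons_measure_semi_sigma_additive.

Let cons_measure_sigma_finite : sigma_finite setT cons_measure.
Proof.
have [F FT Fm] := product_sigma_finite (@lebesgue_measure R) mu.
pose g (t : n.+1.-tuple RB) : RB * n.-tuple RB := (thead t, [tuple of behead t]).
have mg : measurable_fun setT g.
  apply/measurable_fun_pairP; split.
    exact: measurable_tnth.
  exact: measurable_behead.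
have gK p : g (cons_pair p) = p.
  by case: p => a t; congr pair; apply/val_inj.
exists (fun i => g @^-1` F i).
  by rewrite -preimage_bigcup -FT preimage_setT.
move=> i; have [mFi Fioo] := Fm i; split.
  by rewrite -[X in measurable X]setTI; exact: mg.
rewrite /cons_measure /pushforward.
suff -> : cons_pair @^-1` (g @^-1` F i) = F i by [].
by apply/seteqP; split => p /=; rewrite gK.
Qed.

HB.instance Definition _ := Measure_isSigmaFinite.Build _ _ _ cons_measure
  cons_measure_sigma_finite.

End Cons.

Fixpoint lebesgue_tuple n :
    {sigma_finite_measure set (n.-tuple RB) -> \bar R} :=
  match n with
  | 0 => \d_([tuple of [::]] : 0.-tuple RB)
  | n'.+1 => cons_measure (lebesgue_tuple n')
  end.

End LebesgueTuple.

(* Calculus of R[i]-valued functions. R[i] is not a normed module over R in the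
   library, so derivability, continuity and integration are componentwise. *)

Section ComplexCalculus.
Variables (R : realType) (V : normedModType R).
Implicit Types (f : V -> R[i]) (x v : V).

Definition cderivable f x v : Prop :=
  derivable (fun y => complex.Re (f y)) x v /\ derivable (fun y => complex.Im (f y)) x v.

Definition cderive f x v : R[i] :=
  ('D_v (fun y => complex.Re (f y)) x +i* 'D_v (fun y => complex.Im (f y)) x)%C.

Definition ccontinuous f : Prop :=
  continuous (fun y => complex.Re (f y)) /\ continuous (fun y => complex.Im (f y)).

Variables (I : Type) (b : I -> V).

(* partials [:: i_1; ...; i_r] f = d_(i_1) (... (d_(i_r) f)), where d_i is the
   derivative in the direction b i; it is meaningful under has_partials. *)
Fixpoint partials (s : seq I) f : V -> R[i] :=
  if s is i :: s' then fun x => cderive (partials s' f) x (b i) else f.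

Definition has_partials f : Prop :=
  forall (s : seq I) (i : I) (x : V), cderivable (partials s f) x (b i).

Definition cinfty f : Prop :=
  has_partials f /\ forall s : seq I, ccontinuous (partials s f).

End ComplexCalculus.

Definition expi (R : realType) (theta : R) : R[i] := (cos theta +i* sin theta)%C.

Section ComplexIntegral.
Context d (T : measurableType d) (R : realType).
Variables (mu : {measure set T -> \bar R}) (D : set T) (g : T -> R[i]).

Definition cintegrable : Prop :=
  mu.-integrable D (fun p => (complex.Re (g p))%:E) /\
  mu.-integrable D (fun p => (complex.Im (g p))%:E).

Definition cintegral : R[i] :=
  (\int[mu]_(p in D) complex.Re (g p) +i* \int[mu]_(p in D) complex.Im (g p))%C.

End ComplexIntegral.

Section MultiIndex.
Variable n : nat.

Definition multi_index := {ffun 'I_n -> nat}.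

Implicit Types alpha beta : multi_index.

Definition mi_add alpha beta : multi_index := [ffun i => (alpha i + beta i)%N].

Definition mi_size alpha : nat := (\sum_i alpha i)%N.

Definition mi_fact alpha : nat := (\prod_i (alpha i)`!)%N.

Definition mi_word alpha : seq 'I_n :=
  flatten [seq nseq (alpha i) i | i <- enum 'I_n].

Definition monomial (R : realType) (x : 'rV[R]_n) alpha : R :=
  \prod_i x 0 i ^+ alpha i.

End MultiIndex.

Section TorusTimesEuclidean.
Variables (R : realType) (m n : nat).

(* A function on T^m x R^n is a function on R^m x R^n that is 2pi-periodic in
   each of the first m variables. *)
Notation space := ('rV[R]_m * 'rV[R]_n)%type.

Implicit Types f : space -> R[i].

Definition torus_periodic f : Prop :=
  forall (i : 'I_m) (t : 'rV[R]_m) (x : 'rV[R]_n),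
    f (t + (2 * pi) *: delta_mx 0 i, x) = f (t, x).

Definition direction (i : 'I_m + 'I_n) : space :=
  match i with
  | inl j => (delta_mx 0 j, 0)
  | inr j => (0, delta_mx 0 j)
  end.

Definition smooth_TR f : Prop := torus_periodic f /\ cinfty direction f.

(* d_x^beta d_t^gamma f *)
Definition partial_TR (beta : multi_index n) (gamma : multi_index m) f :
    space -> R[i] :=
  partials direction
    (map inr (mi_word beta) ++ map inl (mi_word gamma)) f.

Definition in_S_C (sigma mu C : R) f : Prop :=
  smooth_TR f /\
  exists M : R, forall (alpha beta : multi_index n) (gamma : multi_index m)
      (t : 'rV[R]_m) (x : 'rV[R]_n),
    C ^- (mi_size (mi_add alpha beta) + mi_size gamma)
    * (mi_fact gamma)%:R `^ (- sigma)
    * (mi_fact alpha * mi_fact beta)%:R `^ (- mu)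
    * normc ((monomial x alpha)%:C%C * partial_TR beta gamma f (t, x)) <= M.

Definition in_S (sigma mu : R) f : Prop :=
  exists2 C : R, 0 < C & in_S_C sigma mu C f.

Definition row_of_tuple k (u : k.-tuple R) : 'rV[R]_k := \row_i tnth u i.

Let RB := measurableTypeR R.

Definition lebesgue_TR := (lebesgue_tuple R m \x lebesgue_tuple R n)%E.

Definition fundamental_cell : set (m.-tuple RB * n.-tuple RB) :=
  [set p | forall i, 0 <= tnth p.1 i <= 2 * pi].

Definition on_tuples f (p : m.-tuple RB * n.-tuple RB) : R[i] :=
  f (row_of_tuple p.1, row_of_tuple p.2).

Definition L1_TR f : Prop :=
  cintegrable lebesgue_TR fundamental_cell (on_tuples f).

Definition mixed_fourier f (k : 'rV[int]_m) (xi : 'rV[R]_n) : R[i] :=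
  (((2 * pi) ^- m)%:C)%C *
  cintegral lebesgue_TR fundamental_cell (fun p =>
    on_tuples f p *
    expi (- (\sum_i (k 0 i)%:~R * tnth p.1 i + \sum_j xi 0 j * tnth p.2 j))).

End TorusTimesEuclidean.

Definition xi_direction (R : realType) n (j : 'I_n) : 'rV[R]_n := delta_mx 0 j.

Definition freq_norm (R : realType) m (k : 'rV[int]_m) : R :=
  Num.sqrt (\sum_i (k 0 i)%:~R ^+ 2).

(* Main.v *)
Require Import Defs.
From mathcomp Require Import all_boot all_order all_algebra.
From mathcomp Require Import all_classical all_reals all_analysis.
From mathcomp Require Import complex measurable_realfun.
From mathcomp Require Import ring lra zify.
Import Order.TTheory GRing.Theory Num.Theory.
Import numFieldNormedType.Exports.
Import ComplexField.Normc.
Local Open Scope ring_scope.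
Set Implicit Arguments.
Unset Strict Implicit.
Unset Printing Implicit Defensive.

(** Write f_k (x) for the Fourier coefficient of t |-> f (t, x) at the integer
    frequency k. By Fubini the mixed transform at (k, xi) is the Euclidean
    transform of f_k at xi, and the theorem combines one fact about Euclidean
    transforms with two facts about Fourier series.

    The Euclidean fact is that the class of functions g with
    |x^alpha d^beta g| <= K C^|alpha + beta| (alpha! beta!)^mu is stable under
    the direct and the inverse transform: multiplication by monomials and
    differentiation are exchanged, and integration by parts moves the former
    onto g (rapid_fourier). The Leibniz rule produces binomial coefficients and
    factors beta_j, and it is in absorbing the latter that mu >= 1/2 is used
    (binomial_absorb). The constant K comes out multiplied by a factor that
    depends only on n, mu and C, so the result applies to all the f_k at once.

    If f lies in the space, then integration by parts over the period cell
    turns d_t^gamma into a power of k; bounds with gamma!^sigma on all powers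
    amount to a factor exp (- eps |k|^(1/sigma)) in the size K of f_k
    (gevrey_exp_decay), and this factor passes to the Euclidean transform
    (gevrey_mixed_fourier).

    Conversely, the transform of f_k being rapidly decreasing, Fourier
    inversion (fourier_inversion, by Gaussian regularization) expresses f_k as
    an inverse transform, so f_k again satisfies the Euclidean bounds, with the
    exponential factor. The coefficients of x^alpha d_x^beta d_t^gamma f are
    those of x^alpha d_x^beta f_k times monomials in k, and the exponential
    factor makes them summable at the price of C^|gamma| gamma!^sigma
    (frequency_growth). That a continuous periodic function is bounded by the
    sum of its coefficients is torus_estimate; it is obtained by averaging
    against the trigonometric polynomials prod_i ((1 + cos theta_i) / 2)^N.

    The transform is only known to have iterated partial derivatives, so
    derivatives, integrals and measurability are handled along coordinate
    lines, and the order of differentiation is respected throughout. *)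

(** * Integration over tuples of real numbers *)

Section TupleIntegral.
Local Open Scope classical_set_scope.
Variable R : realType.
Local Notation RB := (measurableTypeR R).
Local Notation leb n := (lebesgue_tuple R n).
Local Notation lam := (@lebesgue_measure R).

Lemma ge0_integral_tuple0 (f : 0.-tuple RB -> \bar R) :
  measurable_fun setT f -> (\int[leb 0]_u f u = f [tuple])%E.
Proof.
move=> mf; rewrite /= integral_dirac// diracT mul1e; congr f; exact/val_inj.
Qed.

Lemma ge0_integral_tupleS n (f : n.+1.-tuple RB -> \bar R) :
  measurable_fun setT f -> (forall u, 0 <= f u)%E ->
  (\int[leb n.+1]_u f u = \int[lam \x leb n]_p f (cons_pair p))%E.
Proof.
move=> mf f0.
rewrite [LHS](ge0_integral_pushforward (@measurable_cons_pair R n))//.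
Qed.

Lemma integral_tupleS n (f : n.+1.-tuple RB -> \bar R) :
  (lam \x leb n)%E.-integrable setT (f \o @cons_pair R n) ->
  measurable_fun setT f ->
  (\int[leb n.+1]_u f u = \int[lam \x leb n]_p f (cons_pair p))%E.
Proof.
move=> fi mf.
rewrite [LHS](integral_pushforward (@measurable_cons_pair R n))//.
Qed.

Lemma measurable_coord n (i : 'I_n) :
  measurable_fun setT (fun u : n.-tuple RB => tnth u i : R).
Proof. exact: (@measurable_tnth _ RB n i). Qed.

Lemma measurable_normE d (T : measurableType d) (f : T -> R) :
  measurable_fun setT f -> measurable_fun setT (fun x => `|f x|%:E).
Proof.
move=> mf; apply/measurable_EFinP.
exact: (measurableT_comp (@normr_measurable _ setT) mf).
Qed.

Definition tprod n (w : 'I_n -> R -> R) (u : n.-tuple RB) : R :=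
  \prod_i w i (tnth u i).

Lemma measurable_tprod n (w : 'I_n -> R -> R) :
  (forall i, measurable_fun setT (w i)) -> measurable_fun setT (tprod w).
Proof.
move=> mw; apply: measurable_prod => i _.
exact: (measurableT_comp (mw i) (measurable_coord i)).
Qed.

Lemma tprod_cons n (w : 'I_n.+1 -> R -> R) a (v : n.-tuple RB) :
  tprod w (cons_pair (a, v)) = w ord0 a * tprod (fun i => w (lift ord0 i)) v.
Proof.
rewrite /tprod big_ord_recl; congr (_ * _).
by apply: eq_bigr => i _; rewrite tnthS.
Qed.

Lemma integral_tprod n (w : 'I_n -> R -> R) (W : 'I_n -> R) :
  (forall i, measurable_fun setT (w i)) -> (forall i x, 0 <= w i x) ->
  (forall i, \int[lam]_x (w i x)%:E = (W i)%:E)%E ->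
  (\int[leb n]_u (tprod w u)%:E = (\prod_i W i)%:E)%E.
Proof.
elim: n w W => [|n IH] w W mw w0 wW.
  rewrite ge0_integral_tuple0 /tprod ?big_ord0//.
  apply/measurable_EFinP; exact: measurable_tprod.
rewrite ge0_integral_tupleS; last 2 first.
- apply/measurable_EFinP; exact: measurable_tprod.
- by move=> u; rewrite lee_fin prodr_ge0.
rewrite fubini_tonelli1; last 2 first.
- apply/measurable_EFinP; apply: (measurableT_comp (measurable_tprod mw)).
  exact: measurable_cons_pair.
- by move=> p; rewrite lee_fin prodr_ge0.
rewrite /fubini_F/=.
under eq_integral => x _.
  under eq_integral => v _ do rewrite tprod_cons EFinM.
  rewrite ge0_integralZl_EFin//; last 2 first.
  - by move=> v _; rewrite lee_fin prodr_ge0.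
  - apply/measurable_EFinP; exact: measurable_tprod.
  rewrite (IH _ (fun i => W (lift ord0 i)))//.
  over.
rewrite ge0_integralZr//; last 3 first.
- by apply/measurable_EFinP; exact: mw.
- by move=> x _; rewrite lee_fin.
- rewrite lee_fin prodr_ge0// => i _.
  by rewrite -lee_fin -wW; apply: integral_ge0 => x _; rewrite lee_fin.
by rewrite wW -EFinM big_ord_recl.
Qed.

Lemma integrable_tprod n (w : 'I_n -> R -> R) :
  (forall i, measurable_fun setT (w i)) -> (forall i x, 0 <= w i x) ->
  (forall i, lam.-integrable setT (EFin \o w i)) ->
  (leb n).-integrable setT (EFin \o tprod w).
Proof.
move=> mw w0 iw; apply/integrableP; split.
  apply/measurable_EFinP; exact: measurable_tprod.
under eq_integral => u _ do rewrite gee0_abs ?lee_fin ?prodr_ge0//.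
rewrite (integral_tprod (W := fun i => (\int[lam]_x w i x)%R)) ?ltry// => i.
rewrite fineK//.
exact: (integrable_fin_num measurableT (iw i)).
Qed.

Lemma integrable_le d (T : measurableType d) (mu : {measure set T -> \bar R})
    (D : set T) (f g : T -> R) :
  measurable D -> measurable_fun D f -> mu.-integrable D (EFin \o g) ->
  (forall x, D x -> `|f x| <= g x) -> mu.-integrable D (EFin \o f).
Proof.
move=> mD mf ig fg; apply: le_integrable ig => //.
  exact/measurable_EFinP.
by move=> x Dx /=; rewrite lee_fin (le_trans (fg _ Dx)) ?ler_norm.
Qed.

Definition updt n (u : n.-tuple RB) (j : 'I_n) (s : R) : n.-tuple RB :=
  [tuple if i == j then s else tnth u i | i < n].

(** Fubini isolates the variables one at a time. The product weight makes
    all the intermediate integrals absolutely convergent; it is 1 / (1 + x^2)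
    in each variable on Euclidean space and an indicator on the period cell. *)
Lemma integral_zero_line n (w : R -> R) (h : n.-tuple RB -> R) j K :
  measurable_fun setT w -> (forall x, 0 <= w x) ->
  lam.-integrable setT (EFin \o w) ->
  measurable_fun setT h ->
  (forall u, `|h u| <= K * tprod (fun=> w) u) ->
  (forall u, (\int[lam]_s (h (updt u j s))%:E = 0)%E) ->
  (\int[leb n]_u (h u)%:E = 0)%E.
Proof.
move=> mw w0 iw.
elim: n h j K => [|n IH] h j K mh hK h0; first by have := ltn_ord j.
have mhc : measurable_fun setT (h \o @cons_pair R n).
  by apply: measurableT_comp => //; exact: measurable_cons_pair.
have itp : (leb n.+1).-integrable setT (EFin \o (fun u => K * tprod (fun=> w) u)).
  rewrite /comp; under eq_fun do rewrite EFinM.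
  by apply: integrableZl => //; apply: integrable_tprod.
have ih : (lam \x leb n)%E.-integrable setT (EFin \o (h \o @cons_pair R n)).
  apply/integrableP; split; first exact/measurable_EFinP.
  have /integrableP[mt] := itp.
  rewrite ge0_integral_tupleS//; last exact: measurableT_comp.
  apply: le_lt_trans; apply: ge0_le_integral => //=.
  - exact: measurable_normE mhc.
  - apply: (measurableT_comp (measurableT_comp (@abse_measurable _ setT) mt)).
    exact: measurable_cons_pair.
  - by move=> p _; rewrite lee_fin (le_trans (hK _))// ler_norm.
rewrite integral_tupleS//; last exact/measurable_EFinP.
case: (unliftP ord0 j) => [j'|] jE.
- rewrite -integral12_prod_meas1//; apply: integral0_eq => x _.
  rewrite /fubini_F.
  apply: (IH (fun v => h (cons_pair (x, v))) j' (K * w x)).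
  + apply: (measurableT_comp mhc); exact: measurable_pair1.
  + by move=> v; rewrite (le_trans (hK _))// tprod_cons mulrA.
  + move=> v; rewrite -[RHS](h0 (cons_pair (x, v))).
    apply: eq_integral => s _; congr (h _)%:E.
    apply/eq_from_tnth => i; rewrite [RHS]tnth_mktuple jE.
    case: (unliftP ord0 i) => [i' ->|->].
      by rewrite !tnthS (inj_eq lift_inj) tnth_mktuple.
    by rewrite !tnth0.
- rewrite -integral21_prod_meas1//; apply: integral0_eq => v _.
  rewrite /fubini_G -[RHS](h0 (cons_pair (0, v))).
  apply: eq_integral => s _; congr (h _)%:E.
  apply/eq_from_tnth => i; rewrite [RHS]tnth_mktuple jE.
  case: (unliftP ord0 i) => [i' ->|->].
    by rewrite !tnthS.
  by rewrite eqxx tnth0.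
Qed.

End TupleIntegral.

(** * Measurability of functions of a row vector *)

Section RowMeasurability.
Local Open Scope classical_set_scope.
Variable R : realType.
Local Notation RB := (measurableTypeR R).

Lemma row_norm_le n (x : 'rV[R]_n) e :
  0 <= e -> (forall i, `|x 0 i| <= e) -> `|x| <= e.
Proof.
move=> e0 xe; rewrite [`|x|]mx_normrE; apply/bigmax_leP; split=> //.
by move=> [i j] _ /=; rewrite ord1.
Qed.

Definition grid (N : nat) n (u : n.-tuple RB) : n.-tuple int :=
  [tuple Num.floor (N.+1%:R * tnth u i : R) | i < n].

Definition grid_point (N : nat) n (z : n.-tuple int) : 'rV[R]_n :=
  \row_i ((tnth z i)%:~R / N.+1%:R).

Lemma cvg_grid n (u : n.-tuple RB) :
  grid_point N (grid N u) @[N --> \oo] --> row_of_tuple u.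
Proof.
apply/cvgrPdist_le => /= e e0.
near=> N.
apply: row_norm_le => [|i]; first exact: ltW.
rewrite !mxE tnth_mktuple.
set x := tnth u i : R.
have N0 : 0 < N.+1%:R :> R by [].
have /andP[f1 f2] := floor_itv (N.+1%:R * x : R).
set z := (Num.floor (N.+1%:R * x))%:~R in f1 f2 *.
have q0 : 0 <= x - z / N.+1%:R by rewrite subr_ge0 ler_pdivrMr// mulrC.
rewrite (ger0_norm q0).
apply: (@le_trans _ _ (N.+1%:R^-1)); last first.
  by apply: ltW; near: N; exact: (near_infty_natSinv_lt (PosNum e0)).
rewrite intrD -/z in f2.
have N1 : N.+1%:R != 0 :> R by rewrite gt_eqF.
have -> : x - z / N.+1%:R = (N.+1%:R * x - z) / N.+1%:R.
  by rewrite mulrBl mulrAC mulfV// mul1r.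
by rewrite ler_pdivrMr// mulVf// lerBlDl ltW.
Unshelve. all: by end_near. Qed.

Lemma measurable_grid N n (z : n.-tuple int) :
  measurable [set u : n.-tuple RB | grid N u = z].
Proof.
have -> : [set u : n.-tuple RB | grid N u = z] =
    \bigcap_(i in [set: 'I_n])
      [set u : n.-tuple RB | Num.floor (N.+1%:R * tnth u i : R) = tnth z i].
  apply/seteqP; split => [u /= <- i _|u /= h].
    by rewrite /= tnth_mktuple.
  by apply/eq_from_tnth => i; rewrite tnth_mktuple h.
apply: fin_bigcap_measurable => // i _.
have -> : [set u : n.-tuple RB | Num.floor (N.+1%:R * tnth u i : R) = tnth z i] =
   (fun u : n.-tuple RB => N.+1%:R * tnth u i : R) @^-1`
     `[(tnth z i)%:~R, (tnth z i + 1)%:~R[.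
  apply/seteqP; split => u /=; rewrite in_itv/=.
    by move=> <-; exact: floor_itv.
  by move=> h; exact/floor_def.
rewrite -[X in measurable X]setTI.
apply: (measurable_funM (measurable_cst _) (measurable_coord i)) => //.
Qed.

(** Functions that are continuous along sequences are limits of functions
    constant on the cells of a finer and finer grid. *)
Lemma measurable_row n (H : 'rV[R]_n -> R) :
  (forall (x_ : nat -> 'rV[R]_n) x, x_ k @[k --> \oo] --> x ->
     H (x_ k) @[k --> \oo] --> H x) ->
  measurable_fun setT (fun u : n.-tuple RB => H (row_of_tuple u)).
Proof.
move=> cH.
apply: (measurable_fun_cvg (h := fun N (u : n.-tuple RB) => H (grid_point N (grid N u)))).
  move=> N _ Y mY; rewrite setTI.
  have -> : (fun u : n.-tuple RB => H (grid_point N (grid N u))) @^-1` Y =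
    \bigcup_(z : n.-tuple int)
      (if H (grid_point N z) \in Y then [set u | grid N u = z] else set0).
    apply/seteqP; split => [u /= HY|u [z _]].
      by exists (grid N u) => //; rewrite mem_set.
    by case: ifPn => // /set_mem + /= gz; rewrite -gz.
  apply: countable_bigcupT_measurable => // z; case: ifPn => // _.
  exact: measurable_grid.
by move=> u _; apply: cH; exact: cvg_grid.
Qed.

Lemma measurable_continuous_row n (H : 'rV[R]_n -> R) : continuous H ->
  measurable_fun setT (fun u : n.-tuple RB => H (row_of_tuple u)).
Proof.
move=> cH; apply: measurable_row => x_ x xx.
by apply: continuous_cvg => //; exact: cH.
Qed.

End RowMeasurability.

(** * Complex numbers and complex-valued integrals *)

Section ComplexNumbers.
Local Open Scope complex_scope.
Variable R : realType.
Implicit Types (x y : R[i]) (a b : R).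

Lemma Re_mul x y :
  complex.Re (x * y) = complex.Re x * complex.Re y - complex.Im x * complex.Im y.
Proof. by case: x y => [a b] [c d]. Qed.

Lemma Im_mul x y :
  complex.Im (x * y) = complex.Re x * complex.Im y + complex.Im x * complex.Re y.
Proof. by case: x y => [a b] [c d]. Qed.

Lemma Re_add x y : complex.Re (x + y) = complex.Re x + complex.Re y.
Proof. by case: x y => [a b] [c d]. Qed.

Lemma Im_add x y : complex.Im (x + y) = complex.Im x + complex.Im y.
Proof. by case: x y => [a b] [c d]. Qed.

Lemma Re_opp x : complex.Re (- x) = - complex.Re x. Proof. by case: x. Qed.
Lemma Im_opp x : complex.Im (- x) = - complex.Im x. Proof. by case: x. Qed.

Lemma complex_ext x y :
  complex.Re x = complex.Re y -> complex.Im x = complex.Im y -> x = y.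
Proof. by case: x y => [a b] [c d] /= -> ->. Qed.

Lemma Re_le_normc x : `|complex.Re x| <= normc x.
Proof.
by case: x => a b /=; rewrite -sqrtr_sqr ler_wsqrtr// lerDl sqr_ge0.
Qed.

Lemma Im_le_normc x : `|complex.Im x| <= normc x.
Proof.
by case: x => a b /=; rewrite -sqrtr_sqr ler_wsqrtr// lerDr sqr_ge0.
Qed.

Lemma normc_ge0 x : 0 <= normc x.
Proof. by case: x => a b; exact: sqrtr_ge0. Qed.

Lemma normc_real a : normc a%:C = `|a|.
Proof. by rewrite /= expr0n addr0 sqrtr_sqr. Qed.

Lemma normc_i : normc ('i : R[i]) = 1.
Proof. by rewrite /= expr0n add0r expr1n sqrtr1. Qed.

Lemma normc_le_ReIm x : normc x <= `|complex.Re x| + `|complex.Im x|.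
Proof.
case: x => a b /=; rewrite -[leRHS]ger0_norm ?addr_ge0// -sqrtr_sqr ler_wsqrtr//.
rewrite sqrrD !real_normK ?num_real// addrAC lerDl mulrn_wge0//.
Qed.

Lemma normc_expi a : normc (expi a) = 1.
Proof. by rewrite /= cos2Dsin2 sqrtr1. Qed.

Lemma normc_prod I (s : seq I) (P : pred I) (F : I -> R[i]) :
  normc (\prod_(i <- s | P i) F i) = \prod_(i <- s | P i) normc (F i).
Proof. by apply: big_morph; [exact: normcM|exact: normc1]. Qed.

Lemma normc_sum I (s : seq I) (P : pred I) (F : I -> R[i]) :
  normc (\sum_(i <- s | P i) F i) <= \sum_(i <- s | P i) normc (F i).
Proof.
elim/big_ind2 : _ => //; first by rewrite normc0.
by move=> x a y b xa yb; rewrite (le_trans (le_normcD _ _))// lerD.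
Qed.

Lemma normcX x k : normc (x ^+ k) = normc x ^+ k.
Proof. by elim: k => [|k IH]; rewrite ?expr0 ?normc1// !exprS normcM IH. Qed.

Lemma expiD a b : expi (a + b) = expi a * expi b.
Proof. by apply: complex_ext; rewrite /= ?cosD ?sinD // addrC. Qed.

Lemma expi0 : expi (0 : R) = 1.
Proof. by rewrite /expi cos0 sin0. Qed.

Lemma expi_sum I (s : seq I) (P : pred I) (F : I -> R) :
  expi (\sum_(i <- s | P i) F i) = \prod_(i <- s | P i) expi (F i).
Proof. by apply: big_morph; [exact: expiD|exact: expi0]. Qed.

End ComplexNumbers.

Section ComplexIntegralTheory.
Local Open Scope classical_set_scope.
Local Open Scope complex_scope.
Context d (T : measurableType d) (R : realType).
Variables (mu : {measure set T -> \bar R}) (D : set T).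
Hypothesis mD : measurable D.
Implicit Types g h : T -> R[i].

Definition cmeasurable g :=
  measurable_fun D (fun p => complex.Re (g p)) /\
  measurable_fun D (fun p => complex.Im (g p)).

Lemma cintegrable_cmeasurable g : cintegrable mu D g -> cmeasurable g.
Proof.
by move=> [/measurable_int/measurable_EFinP ? /measurable_int/measurable_EFinP].
Qed.

Lemma cmeasurableM g h : cmeasurable g -> cmeasurable h ->
  cmeasurable (fun p => g p * h p).
Proof.
move=> [g1 g2] [h1 h2]; split.
- under eq_fun do rewrite Re_mul.
  by apply: measurable_funB; apply: measurable_funM.
- under eq_fun do rewrite Im_mul.
  by apply: measurable_funD; apply: measurable_funM.
Qed.

Lemma cmeasurableD g h : cmeasurable g -> cmeasurable h ->
  cmeasurable (fun p => g p + h p).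
Proof.
move=> [g1 g2] [h1 h2]; split.
- by under eq_fun do rewrite Re_add; exact: measurable_funD.
- by under eq_fun do rewrite Im_add; exact: measurable_funD.
Qed.

Lemma cmeasurable_cst (c : R[i]) : cmeasurable (fun=> c).
Proof. by split; exact: measurable_cst. Qed.

Lemma cmeasurable_real (f : T -> R) : measurable_fun D f ->
  cmeasurable (fun p => (f p)%:C).
Proof. by move=> mf; split => //=; exact: measurable_cst. Qed.

Lemma cmeasurable_expi (f : T -> R) : measurable_fun D f ->
  cmeasurable (fun p => expi (f p)).
Proof.
by move=> mf; split => /=; apply: measurableT_comp mf;
  apply: continuous_measurable_fun; [exact: continuous_cos|exact: continuous_sin].
Qed.

Lemma cintegrable_le g (B : T -> R) : cmeasurable g ->
  mu.-integrable D (EFin \o B) -> (forall p, D p -> normc (g p) <= B p) ->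
  cintegrable mu D g.
Proof.
move=> [mg1 mg2] iB gB; split; apply: (integrable_le mD _ iB) => // p Dp.
- exact: le_trans (Re_le_normc _) (gB _ Dp).
- exact: le_trans (Im_le_normc _) (gB _ Dp).
Qed.

Lemma cintegrable_normc g : cintegrable mu D g ->
  mu.-integrable D (fun p => (`|complex.Re (g p)| + `|complex.Im (g p)|)%:E).
Proof.
move=> [i1 i2]; under eq_fun do rewrite EFinD.
by apply: integrableD => //; apply: integrable_norm.
Qed.

Lemma Rintegral_le_bound (f B : T -> R) : measurable_fun D f ->
  mu.-integrable D (EFin \o B) -> (forall p, D p -> `|f p| <= B p) ->
  `|\int[mu]_(p in D) f p| <= \int[mu]_(p in D) B p.
Proof.
move=> mf iB fB.
have fi : mu.-integrable D (EFin \o f) by exact: integrable_le fB.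
apply: (le_trans (le_normr_Rintegral mD fi)).
apply: le_Rintegral => //.
exact: integrable_norm.
Qed.

(** The factor 2 comes from estimating real and imaginary parts separately;
    losses of this kind are harmless in all that follows. *)
Lemma normc_cintegral_le g (B : T -> R) : cmeasurable g ->
  mu.-integrable D (EFin \o B) -> (forall p, D p -> normc (g p) <= B p) ->
  normc (cintegral mu D g) <= 2 * \int[mu]_(p in D) B p.
Proof.
move=> [mg1 mg2] iB gB; rewrite mulr2n mulrDl mul1r.
apply: (le_trans (normc_le_ReIm _)); apply: lerD; apply: Rintegral_le_bound => // p Dp.
- exact: le_trans (Re_le_normc _) (gB _ Dp).
- exact: le_trans (Im_le_normc _) (gB _ Dp).
Qed.

Lemma integrableZlR (c : R) (f : T -> R) : mu.-integrable D (EFin \o f) ->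
  mu.-integrable D (EFin \o (fun p => c * f p)).
Proof.
move=> fi; rewrite (_ : _ \o _ = fun p => (c%:E * (EFin \o f) p)%E)//.
exact: integrableZl.
Qed.

Lemma eq_cintegral g h : {in D, g =1 h} -> cintegral mu D g = cintegral mu D h.
Proof.
by move=> gh; congr (_ +i* _); apply: eq_Rintegral => p pD; rewrite gh.
Qed.

Lemma cintegralD g h : cintegrable mu D g -> cintegrable mu D h ->
  cintegral mu D (fun p => g p + h p) = cintegral mu D g + cintegral mu D h.
Proof.
move=> [g1 g2] [h1 h2]; rewrite /cintegral; apply: complex_ext => /=.
- by rewrite -RintegralD//; apply: eq_Rintegral => p _; rewrite Re_add.
- by rewrite -RintegralD//; apply: eq_Rintegral => p _; rewrite Im_add.
Qed.

Lemma cintegrableD g h : cintegrable mu D g -> cintegrable mu D h ->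
  cintegrable mu D (fun p => g p + h p).
Proof.
move=> [g1 g2] [h1 h2]; split.
- under eq_fun do rewrite Re_add EFinD.
  exact: integrableD.
- under eq_fun do rewrite Im_add EFinD.
  exact: integrableD.
Qed.

Lemma cintegrableZ (c : R[i]) g : cintegrable mu D g ->
  cintegrable mu D (fun p => c * g p).
Proof.
move=> [g1 g2]; split.
- under eq_fun do rewrite Re_mul EFinB !EFinM.
  by apply: integrableB => //; exact: integrableZl.
- under eq_fun do rewrite Im_mul EFinD !EFinM.
  by apply: integrableD => //; exact: integrableZl.
Qed.

Lemma cintegralZ (c : R[i]) g : cintegrable mu D g ->
  cintegral mu D (fun p => c * g p) = c * cintegral mu D g.
Proof.
move=> [g1 g2]; rewrite /cintegral; apply: complex_ext; rewrite ?Re_mul ?Im_mul /=.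
- rewrite -!RintegralZl// -RintegralB//; last 2 first.
  + exact: integrableZlR.
  + exact: integrableZlR.
  by apply: eq_Rintegral => p _; rewrite Re_mul.
- rewrite -!RintegralZl// -RintegralD//; last 2 first.
  + exact: integrableZlR.
  + exact: integrableZlR.
  by apply: eq_Rintegral => p _; rewrite Im_mul.
Qed.

Lemma cintegrable0 : cintegrable mu D (fun=> 0).
Proof. by split; exact: integrable0. Qed.

Lemma cintegral0 : cintegral mu D (fun=> 0) = 0.
Proof.
by apply: complex_ext; rewrite /= -[RHS](mul0r (fine (mu D))) Rintegral_cst.
Qed.

Lemma cintegrable_sum I (s : seq I) (F : I -> T -> R[i]) :
  (forall i, cintegrable mu D (F i)) ->
  cintegrable mu D (fun p => \sum_(i <- s) F i p).
Proof.
move=> iF; elim: s => [|i s IH].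
  by under eq_fun do rewrite big_nil; exact: cintegrable0.
by under eq_fun do rewrite big_cons; exact: cintegrableD.
Qed.

Lemma cintegral_sum I (s : seq I) (F : I -> T -> R[i]) :
  (forall i, cintegrable mu D (F i)) ->
  cintegral mu D (fun p => \sum_(i <- s) F i p) =
  \sum_(i <- s) cintegral mu D (F i).
Proof.
move=> iF; elim: s => [|i s IH].
  rewrite [RHS]big_nil -[RHS]cintegral0.
  by apply: eq_cintegral => p _; rewrite big_nil.
rewrite [RHS]big_cons -IH -cintegralD//; last exact: cintegrable_sum.
by apply: eq_cintegral => p _; rewrite big_cons.
Qed.

End ComplexIntegralTheory.

(** * Directional derivatives of complex-valued functions *)

Section LineDerivatives.
Local Open Scope classical_set_scope.
Local Open Scope complex_scope.
Variable R : realType.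

(** Gives access to one-variable calculus on each line. *)
Lemma is_derive_line (V : normedModType R) (f : V -> R) (x v : V) (h0 l : R) :
  is_derive (x + h0 *: v) v f l <-> is_derive h0 1 (fun h => f (x + h *: v)) l.
Proof.
have E : (fun h : R => h^-1 *: ((f \o shift (x + h0 *: v)) (h *: v) - f (x + h0 *: v)))
  = (fun h : R => h^-1 *: (((fun h => f (x + h *: v)) \o shift h0) (h *: 1) -
       f (x + h0 *: v))).
  apply/funext => h /=; congr (_ *: (f _ - _)).
  by rewrite [h *: 1]mulr1 scalerDl addrCA addrA.
split=> -[fd fE]; split.
- by rewrite /derivable -E.
- by rewrite -fE /derive E.
- by rewrite /derivable E.
- by rewrite -fE /derive E.
Qed.

(** A relation, so that the existence of the derivative and its value are
    proved together. *)
Definition is_cderive (V : normedModType R) (f : V -> R[i]) (x v : V) (l : R[i]) :=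
  is_derive x v (fun y => complex.Re (f y)) (complex.Re l) /\
  is_derive x v (fun y => complex.Im (f y)) (complex.Im l).

Section Theory.
Variable V : normedModType R.
Implicit Types (f g : V -> R[i]) (x v : V).

Lemma is_cderiveP f x v l :
  is_cderive f x v l <-> cderivable f x v /\ cderive f x v = l.
Proof.
split=> [[[f1 e1] [f2 e2]]|[[f1 f2] <-]].
  by split=> //; rewrite /cderive; apply: complex_ext.
by split; split.
Qed.

Lemma cderivable_is_cderive f x v : cderivable f x v ->
  is_cderive f x v (cderive f x v).
Proof. by move=> fx; apply/is_cderiveP. Qed.

Lemma is_cderive_line f x v (h0 : R) l :
  is_cderive f (x + h0 *: v) v l <-> is_cderive (fun h : R => f (x + h *: v)) h0 1 l.
Proof.
split=> -[f1 f2]; split.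
- exact: (is_derive_line (fun y => complex.Re (f y)) x v h0 _).1.
- exact: (is_derive_line (fun y => complex.Im (f y)) x v h0 _).1.
- exact: (is_derive_line (fun y => complex.Re (f y)) x v h0 _).2.
- exact: (is_derive_line (fun y => complex.Im (f y)) x v h0 _).2.
Qed.

Lemma is_cderive_line0 f x v l :
  is_cderive f x v l <-> is_cderive (fun h : R => f (x + h *: v)) 0 1 l.
Proof. by rewrite -is_cderive_line scale0r addr0. Qed.

Lemma is_cderiveM f g x v a b : is_cderive f x v a -> is_cderive g x v b ->
  is_cderive (fun y => f y * g y) x v (a * g x + f x * b).
Proof.
move=> [f1 f2] [g1 g2]; split.
- rewrite (_ : (fun y => _) = (fun y => complex.Re (f y)) * (fun y => complex.Re (g y))
    - (fun y => complex.Im (f y)) * (fun y => complex.Im (g y))); last first.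
    by apply/funext => y; rewrite Re_mul.
  apply: (is_derive_eq (is_deriveB (is_deriveM f1 g1) (is_deriveM f2 g2))).
  rewrite !Re_add !Re_mul /GRing.scale /=; ring.
- rewrite (_ : (fun y => _) = (fun y => complex.Re (f y)) * (fun y => complex.Im (g y))
    + (fun y => complex.Im (f y)) * (fun y => complex.Re (g y))); last first.
    by apply/funext => y; rewrite Im_mul.
  apply: (is_derive_eq (is_deriveD (is_deriveM f1 g2) (is_deriveM f2 g1))).
  rewrite !Im_add !Im_mul /GRing.scale /=; ring.
Qed.

Lemma is_cderive_cst (c : R[i]) x v : is_cderive (fun=> c) x v 0.
Proof. by split; exact: is_derive_cst. Qed.

Lemma is_cderiveZ (c : R[i]) f x v a : is_cderive f x v a ->
  is_cderive (fun y => c * f y) x v (c * a).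
Proof.
move=> fa; rewrite -[c * a]add0r -(mul0r (f x)).
by apply: is_cderiveM => //; exact: is_cderive_cst.
Qed.

Lemma is_cderive_real (f : V -> R) x v (l : R) : is_derive x v f l ->
  is_cderive (fun y => (f y)%:C) x v l%:C.
Proof. by move=> fl; split => //=; exact: is_derive_cst. Qed.

Lemma is_cderive_expi (theta : V -> R) x v (c : R) : is_derive x v theta c ->
  is_cderive (fun y => expi (theta y)) x v ('i * c%:C * expi (theta x)).
Proof.
move=> tc; apply/is_cderive_line0.
have tl : is_derive (0 : R) (1 : R) (fun h : R => theta (x + h *: v)) c.
  by apply: (is_derive_line theta x v 0 c).1; rewrite scale0r addr0.
split => /=.
- have := @is_derive1_comp _ cos (fun h : R => theta (x + h *: v)) 0 _ _ _ tl.
  move=> /(_ _ (is_derive_cos _)) /(@is_derive_eq _ _ _ _ _ _ _ _); apply.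
  rewrite scale0r addr0 /=; ring.
- have := @is_derive1_comp _ sin (fun h : R => theta (x + h *: v)) 0 _ _ _ tl.
  move=> /(_ _ (is_derive_sin _)) /(@is_derive_eq _ _ _ _ _ _ _ _); apply.
  rewrite scale0r addr0 /=; ring.
Qed.

End Theory.

Lemma is_derive_under_integral d (Y : measurableType d)
    (mu : {measure set Y -> \bar R}) (D : set Y) (phi dphi : R -> Y -> R)
    (G : Y -> R) : measurable D ->
  (forall h, `|h| < 1 -> mu.-integrable D (EFin \o phi h)) ->
  (forall (h : R) y, `|h| < 1 -> D y -> is_derive h 1 (phi^~ y) (dphi h y)) ->
  mu.-integrable D (EFin \o G) -> (forall y, 0 <= G y) ->
  (forall h y, `|h| < 1 -> D y -> `|dphi h y| <= G y) ->
  is_derive (0 : R) 1 (fun h => \int[mu]_(y in D) phi h y)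
    (\int[mu]_(y in D) dphi 0 y).
Proof.
move=> mD iphi dp iG G0 dG.
have I0 : `](-1), 1[%classic (0 : R) by rewrite /= in_itv/= ltrN10 ltr01.
have In (h : R) : `](-1), 1[%classic h -> `|h| < 1.
  by rewrite /= in_itv/= ltr_norml.
have H2 x y : `](-1), 1[%classic x -> D y -> derivable (phi^~ y) x 1.
  by move=> /In x1 Dy; have [] := dp _ _ x1 Dy.
have H3 x y : `](-1), 1[%classic x -> D y -> partial1of2 phi x y = dphi x y.
  by move=> /In x1 Dy; rewrite partial1of2E; have [] := dp _ _ x1 Dy.
have H4 x y : `](-1), 1[%classic x -> D y -> `|partial1of2 phi x y| <= G y.
  by move=> x1 Dy; rewrite H3// dG//; exact: In.
have H5 x : `](-1), 1[%classic x -> mu.-integrable D (EFin \o phi x).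
  by move=> /In/iphi.
split; first exact: (derivable_under_integral mD I0 H5 H2 G0 iG H4).
rewrite -derive1E (differentiation_under_integral mD I0 H5 H2 G0 iG H4).
by apply: eq_Rintegral => y /set_mem Dy; rewrite H3.
Qed.

(** Stated at the parameter 0 because it is applied on the lines through a
    point; restricting h to (-1, 1) makes local domination sufficient. *)
Lemma is_cderive_under_integral d (Y : measurableType d)
    (mu : {measure set Y -> \bar R}) (D : set Y) (phi dphi : R -> Y -> R[i])
    (G : Y -> R) : measurable D ->
  (forall h, `|h| < 1 -> cintegrable mu D (phi h)) ->
  (forall h y, `|h| < 1 -> D y -> is_cderive (phi^~ y) h 1 (dphi h y)) ->
  mu.-integrable D (EFin \o G) -> (forall y, 0 <= G y) ->
  (forall h y, `|h| < 1 -> D y -> normc (dphi h y) <= G y) ->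
  is_cderive (fun h => cintegral mu D (phi h)) 0 1 (cintegral mu D (dphi 0)).
Proof.
move=> mD iphi dp iG G0 dG.
split.
- apply: (is_derive_under_integral (phi := fun h y => complex.Re (phi h y))
    (dphi := fun h y => complex.Re (dphi h y)) mD _ _ iG G0).
  + by move=> h /iphi[].
  + by move=> h y h1 Dy; have [] := dp h y h1 Dy.
  + by move=> h y h1 Dy; rewrite (le_trans (Re_le_normc _))// dG.
- apply: (is_derive_under_integral (phi := fun h y => complex.Im (phi h y))
    (dphi := fun h y => complex.Im (dphi h y)) mD _ _ iG G0).
  + by move=> h /iphi[].
  + by move=> h y h1 Dy; have [] := dp h y h1 Dy.
  + by move=> h y h1 Dy; rewrite (le_trans (Im_le_normc _))// dG.
Qed.

End LineDerivatives.

(** * Derivatives integrated over a segment or a line *)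

Section LineIntegrals.
Local Open Scope classical_set_scope.
Variable R : realType.
Local Notation lam := (@lebesgue_measure R).

Lemma measurable_patch d (T : measurableType d) (A : set T) (f : T -> R) :
  measurable A -> measurable_fun setT f -> measurable_fun setT (f \_ A).
Proof.
by move=> mA mf; apply: (measurable_restrictT f mA).1; exact: measurable_funTS.
Qed.

(** The total mass pi of this weight is what makes pi^n appear below. *)
Definition cauchy_weight (x : R) : R := (oneDsqr x)^-1.

Lemma cauchy_weight_gt0 x : 0 < cauchy_weight x.
Proof. by rewrite invr_gt0 (lt_le_trans ltr01)// oneDsqr_ge1. Qed.

Lemma measurable_cauchy_weight : measurable_fun setT cauchy_weight.
Proof. by apply: continuous_measurable_fun; exact: continuous_oneDsqrV. Qed.

Lemma integral_cauchy_weight :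
  (\int[lam]_x (cauchy_weight x)%:E = (pi : R)%:E)%E.
Proof.
rewrite ge0_symfun_integralT.
- rewrite (_ : [set x | _] = `[0, +oo[%classic); last first.
    by apply/seteqP; split => x/=; rewrite in_itv/= andbT.
  by rewrite integral0y_oneDsqr -EFinM mulrCA divff ?mulr1// pnatr_eq0.
- by move=> x; rewrite ltW// cauchy_weight_gt0.
- exact: continuous_oneDsqrV.
- by move=> x/=; rewrite /cauchy_weight /oneDsqr sqrrN.
Qed.

Lemma integrable_cauchy_weight : lam.-integrable setT (EFin \o cauchy_weight).
Proof.
apply/integrableP; split.
  by apply/measurable_EFinP; exact: measurable_cauchy_weight.
under eq_integral => x _ do rewrite /= ger0_norm ?(ltW (cauchy_weight_gt0 x))//.
by rewrite integral_cauchy_weight ltry.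
Qed.

Lemma integral_derive_segment (F f : R -> R) (a b : R) : a < b ->
  continuous f -> (forall x : R, is_derive x 1 F (f x)) ->
  (\int[lam]_(x in `[a, b]) (f x)%:E = (F b - F a)%:E)%E.
Proof.
move=> ab cf dF.
have cF : continuous F.
  move=> x; apply: differentiable_continuous; apply/derivable1_diffP.
  by have [] := dF x.
rewrite (@continuous_FTC2 _ f F a b)//.
- exact: continuous_subspaceT.
- split.
  + by move=> x _; have [] := dF x.
  + by apply: cvg_at_right_filter; exact: cF.
  + by apply: cvg_at_left_filter; exact: cF.
- by move=> x _; rewrite derive1E; have [] := dF x.
Qed.

(** The total mass of a derivative vanishes when the primitive vanishes at
    both ends of the line. *)
Lemma integral_derive_line (F f : R -> R) (K : R) :
  continuous f -> (forall x : R, is_derive x 1 F (f x)) ->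
  (forall x, `|F x| <= K * cauchy_weight x) ->
  (forall x, `|f x| <= K * cauchy_weight x) ->
  (\int[lam]_x (f x)%:E = 0)%E.
Proof.
move=> cf dF bF bf.
have mf : measurable_fun setT f by exact: continuous_measurable_fun.
pose I (N : nat) : set R := `[(- N.+1%:R), N.+1%:R].
have K0 : 0 <= K.
  by rewrite -(pmulr_lge0 _ (cauchy_weight_gt0 0)) (le_trans _ (bf 0)).
have lim0 : (\int[lam]_x (f \_ (I N) x)%:E @[N --> \oo] --> (0 : \bar R))%E.
  have -> : (fun N => \int[lam]_x (f \_ (I N) x)%:E)%E =
      (fun N => (F N.+1%:R - F (- N.+1%:R))%:E).
    apply/funext => N; rewrite -(integral_derive_segment _ cf dF); last first.
      by rewrite gtrN.
    rewrite [RHS]integral_mkcond; apply: eq_integral => x _.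
    by rewrite /= /patch; case: ifP.
  apply: cvg_EFin; first exact: nearW.
  apply: norm_cvg0.
  have h0 : 2 * K * harmonic N @[N --> \oo] --> (0 : R).
    by rewrite -[X in _ --> X](mulr0 (2 * K)); apply: cvgMl_tmp; exact: cvg_harmonic.
  apply: (squeeze_cvgr _ (cvg_cst 0) h0); apply: nearW => N.
  rewrite normr_ge0 /= (le_trans (ler_normB _ _))//.
  rewrite (le_trans (lerD (bF _) (bF _)))//.
  have wN x : `|x| = N.+1%:R -> cauchy_weight x <= harmonic N.
    move=> xN; rewrite lef_pV2 ?posrE ?ltr0Sn ?(lt_le_trans ltr01)// ?oneDsqr_ge1//.
    rewrite /oneDsqr -real_normK ?num_real// xN.
    by rewrite (@le_trans _ _ (N.+1%:R ^+ 2)) ?lerDr// ler_eXnr// ler1n.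
  rewrite -mulrDr [2 * K]mulrC -mulrA ler_wpM2l// mulr2n mulrDl mul1r.
  by rewrite lerD// wN ?normrN// ger0_norm.
have := @dominated_cvg _ _ _ lam setT measurableT
  (fun N x => (f \_ (I N) x)%:E) (EFin \o f) (fun x => (K * cauchy_weight x)%:E).
move=> /(_ _ _ _ _ _) lim1.
apply: (cvg_unique _ (lim1 _ _ _ _ _) lim0) => //.
- move=> N; apply/measurable_EFinP.
  have mI : measurable (I N : set (measurableTypeR R)) by exact: measurable_itv.
  have := @measurable_patch _ (measurableTypeR R) (I N) f mI mf.
  exact.
- move=> x _; apply: cvg_near_cst; near=> N.
  rewrite /patch ifT// mem_set// /I /= in_itv /= -ler_norml.
  apply/ltW; near: N.
  have := @nbhs_infty_gtr R `|x|.
  move=> [M _ hM]; exists M => // N NM; apply: hM => /=.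
  exact: leq_trans NM _.
- under eq_fun do rewrite EFinM.
  by apply: integrableZl => //; exact: integrable_cauchy_weight.
- move=> N x _; rewrite lee_fin /patch; case: ifP => // _.
  by rewrite normr0 mulr_ge0// ltW// cauchy_weight_gt0.
Unshelve. all: by end_near. Qed.

End LineIntegrals.

(** * The Euclidean Fourier integral *)

Section FourierIntegral.
Local Open Scope classical_set_scope.
Local Open Scope complex_scope.
Variable R : realType.
Local Notation RB := (measurableTypeR R).
Local Notation leb n := (lebesgue_tuple R n).
Local Notation lam := (@lebesgue_measure R).
Local Notation wt := (@cauchy_weight R).

Section Continuity.
Variable V : normedModType R.
Implicit Types (f g : V -> R[i]).

Lemma ccontinuousM f g : ccontinuous f -> ccontinuous g ->
  ccontinuous (fun x => f x * g x).
Proof.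
move=> [f1 f2] [g1 g2]; split=> x.
- under eq_fun do rewrite Re_mul.
  by apply: cvgB; apply: cvgM; [exact: f1|exact: g1|exact: f2|exact: g2].
- under eq_fun do rewrite Im_mul.
  by apply: cvgD; apply: cvgM; [exact: f1|exact: g2|exact: f2|exact: g1].
Qed.

Lemma ccontinuousD f g : ccontinuous f -> ccontinuous g ->
  ccontinuous (fun x => f x + g x).
Proof.
move=> [f1 f2] [g1 g2]; split=> x.
- by under eq_fun do rewrite Re_add; apply: cvgD; [exact: f1|exact: g1].
- by under eq_fun do rewrite Im_add; apply: cvgD; [exact: f2|exact: g2].
Qed.

Lemma ccontinuous_cst (c : R[i]) : ccontinuous (fun _ : V => c).
Proof. by split=> x; exact: cvg_cst. Qed.

Lemma ccontinuous_expi (theta : V -> R) : continuous theta ->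
  ccontinuous (fun x => expi (theta x)).
Proof.
move=> ct; split=> x /=.
- by apply: continuous_comp; [exact: ct|exact: continuous_cos].
- by apply: continuous_comp; [exact: ct|exact: continuous_sin].
Qed.

End Continuity.

Lemma continuous_derivable (F : R -> R) :
  (forall x : R, derivable F x 1) -> continuous F.
Proof.
by move=> dF x; apply: differentiable_continuous; apply/derivable1_diffP; exact: dF.
Qed.

Lemma ccontinuous_derivable (f df : R -> R[i]) :
  (forall x, is_cderive f x 1 (df x)) -> ccontinuous f.
Proof.
move=> fd; split; apply: continuous_derivable => x; have [[d1 _] [d2 _]] := fd x.
- exact: d1.
- exact: d2.
Qed.

Lemma is_derive_affine (a b x : R) : is_derive x 1 (fun h : R => a + b * h) b.
Proof.
have := is_deriveD (is_derive_cst a x 1) (is_deriveZ b (is_derive_id x (1 : R))).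
by rewrite /GRing.scale /= add0r mulr1.
Qed.

Definition rmeasurable n (g : 'rV[R]_n -> R[i]) :=
  cmeasurable setT (fun u : n.-tuple RB => g (row_of_tuple u)).

(** The signs s = 1 and s = -1 give the inverse and the direct transform,
    both without normalizing constant, so that one theory serves for both. *)
Definition fourier_int n (s : R) (g : 'rV[R]_n -> R[i]) (xi : 'rV[R]_n) : R[i] :=
  cintegral (leb n) setT (fun u => g (row_of_tuple u) *
    expi (s * \sum_j xi 0 j * tnth u j)).

Definition weight n (x : 'rV[R]_n) : R := \prod_i wt (x 0 i).

(** A pointwise bound by an integrable product is the form of integrability
    that survives restriction to lines and multiplication by bounded
    functions. *)
Definition decays n (K : R) (g : 'rV[R]_n -> R[i]) :=
  forall x, normc (g x) <= K * weight x.

Lemma weight_gt0 n (x : 'rV[R]_n) : 0 < weight x.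
Proof. by apply: prodr_gt0 => i _; exact: cauchy_weight_gt0. Qed.

Lemma cauchy_weight_le1 (x : R) : wt x <= 1.
Proof. exact: oneDsqrV_le1. Qed.

Lemma weight_le n (x : 'rV[R]_n) j : weight x <= wt (x 0 j).
Proof.
rewrite /weight (bigD1 j)//= ler_piMr ?(ltW (cauchy_weight_gt0 _))//.
apply: prodr_ile1 => i _; rewrite cauchy_weight_le1 andbT.
exact/ltW/cauchy_weight_gt0.
Qed.

Lemma weight_row n (u : n.-tuple RB) :
  weight (row_of_tuple u) = tprod (fun=> wt) u.
Proof. by apply: eq_bigr => i _; rewrite mxE. Qed.

Lemma integrable_weight n (K : R) :
  (leb n).-integrable setT (EFin \o (fun u => K * tprod (fun=> wt) u)).
Proof.
apply: integrableZlR => //; apply: integrable_tprod => i.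
- exact: measurable_cauchy_weight.
- by move=> x; exact/ltW/cauchy_weight_gt0.
- exact: integrable_cauchy_weight.
Qed.

Lemma Rintegral_weight n (K : R) :
  \int[leb n]_u (K * tprod (fun=> wt) u) = K * pi ^+ n.
Proof.
rewrite RintegralZl//; last first.
  by have := integrable_weight n 1; under eq_fun do rewrite mul1r.
congr (_ * _); rewrite /Rintegral (integral_tprod (W := fun=> pi)) /=.
- by rewrite prodr_const card_ord.
- by move=> i; exact: measurable_cauchy_weight.
- by move=> i x; exact/ltW/cauchy_weight_gt0.
- by move=> i; exact: integral_cauchy_weight.
Qed.

Lemma measurable_dot n (xi : 'rV[R]_n) (s : R) :
  measurable_fun setT (fun u : n.-tuple RB => s * \sum_j xi 0 j * tnth u j).
Proof.
apply: measurable_funM; first exact: measurable_cst.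
apply: measurable_sum => j; apply: measurable_funM; first exact: measurable_cst.
exact: measurable_coord.
Qed.

Lemma measurable_fourier n s (g : 'rV[R]_n -> R[i]) (xi : 'rV[R]_n) : rmeasurable g ->
  cmeasurable setT (fun u : n.-tuple RB => g (row_of_tuple u) *
    expi (s * \sum_j xi 0 j * tnth u j)).
Proof.
move=> mg; apply: cmeasurableM => //; apply: cmeasurable_expi.
exact: measurable_dot.
Qed.

Lemma integrable_fourier_L1 n s (g : 'rV[R]_n -> R[i]) (xi : 'rV[R]_n) :
  cintegrable (leb n) setT (fun u => g (row_of_tuple u)) ->
  cintegrable (leb n) setT (fun u => g (row_of_tuple u) *
    expi (s * \sum_j xi 0 j * tnth u j)).
Proof.
move=> ig; apply: cintegrable_le (cintegrable_normc _ ig) _ => //.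
  by apply: measurable_fourier; exact: cintegrable_cmeasurable ig.
by move=> u _; rewrite normcM normc_expi mulr1 normc_le_ReIm.
Qed.

Lemma integrable_decays n K (g : 'rV[R]_n -> R[i]) :
  rmeasurable g -> decays K g ->
  cintegrable (leb n) setT (fun u => g (row_of_tuple u)).
Proof.
move=> mg gK; apply: (cintegrable_le _ _ (integrable_weight n K)) => // u _.
by rewrite -weight_row.
Qed.

Lemma integrable_fourier n s K (g : 'rV[R]_n -> R[i]) (xi : 'rV[R]_n) :
  rmeasurable g -> decays K g ->
  cintegrable (leb n) setT (fun u => g (row_of_tuple u) *
    expi (s * \sum_j xi 0 j * tnth u j)).
Proof. by move=> mg gK; apply: integrable_fourier_L1; exact: integrable_decays gK. Qed.

Lemma normc_fourier_le n s K (g : 'rV[R]_n -> R[i]) (xi : 'rV[R]_n) :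
  rmeasurable g -> decays K g ->
  normc (fourier_int s g xi) <= 2 * (K * pi ^+ n).
Proof.
move=> mg gK; rewrite -Rintegral_weight; apply: normc_cintegral_le => //.
- exact: measurable_fourier.
- exact: integrable_weight.
- by move=> u _; rewrite normcM normc_expi mulr1 -weight_row.
Qed.

Lemma fourierD n s K L (f g : 'rV[R]_n -> R[i]) xi :
  rmeasurable f -> decays K f -> rmeasurable g -> decays L g ->
  fourier_int s (fun x => f x + g x) xi = fourier_int s f xi + fourier_int s g xi.
Proof.
move=> mf fK mg gK; rewrite -cintegralD//.
- by apply: eq_cintegral => u _; rewrite mulrDl.
- exact: integrable_fourier fK.
- exact: integrable_fourier gK.
Qed.

Lemma fourierZ n s K (c : R[i]) (g : 'rV[R]_n -> R[i]) (xi : 'rV[R]_n) :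
  rmeasurable g -> decays K g ->
  fourier_int s (fun x => c * g x) xi = c * fourier_int s g xi.
Proof.
move=> mg gK; rewrite -cintegralZ//; last exact: integrable_fourier gK.
by apply: eq_cintegral => u _; rewrite mulrA.
Qed.

Lemma dot_line n (xi : 'rV[R]_n) j (h : R) (v : 'I_n -> R) :
  \sum_i (xi + h *: delta_mx 0 j) 0 i * v i = (\sum_i xi 0 i * v i) + h * v j.
Proof.
under eq_bigr do rewrite !mxE mulrDl.
rewrite big_split /=; congr (_ + _).
rewrite (bigD1 j)//= !eqxx mulr1 big1 ?addr0// => i /negbTE ij.
by rewrite ij mulr0 mul0r.
Qed.

(** Differentiating the exponential brings down a coordinate. *)
Lemma is_cderive_fourier n s K (g : 'rV[R]_n -> R[i]) (xi : 'rV[R]_n) j :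
  rmeasurable g -> decays K g -> decays K (fun x => (x 0 j)%:C * g x) ->
  is_cderive (fourier_int s g) xi (delta_mx 0 j)
    (fourier_int s (fun x => 'i * s%:C * (x 0 j)%:C * g x) xi).
Proof.
move=> mg gK gjK; apply/is_cderive_line0.
pose phi (h : R) (u : n.-tuple RB) := g (row_of_tuple u) *
    expi (s * \sum_i (xi + h *: delta_mx 0 j) 0 i * tnth u i).
pose dphi (h : R) (u : n.-tuple RB) :=
    'i * s%:C * (row_of_tuple u 0 j)%:C * g (row_of_tuple u) *
    expi (s * \sum_i (xi + h *: delta_mx 0 j) 0 i * tnth u i).
have -> : fourier_int s (fun x => 'i * s%:C * (x 0 j)%:C * g x) xi =
    cintegral (leb n) setT (dphi 0).
  by apply: eq_cintegral => u _; rewrite /dphi scale0r addr0.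
apply: (@is_cderive_under_integral _ _ _ (leb n) setT phi dphi
   (fun u => `|s| * K * tprod (fun=> wt) u)) => //.
- by move=> h _; exact: integrable_fourier gK.
- move=> h u _ _; rewrite /phi /dphi.
  have -> : 'i * s%:C * (row_of_tuple u 0 j)%:C * g (row_of_tuple u) *
    expi (s * \sum_i (xi + h *: delta_mx 0 j) 0 i * tnth u i) =
    g (row_of_tuple u) * ('i * (s * tnth u j)%:C *
    expi (s * \sum_i (xi + h *: delta_mx 0 j) 0 i * tnth u i)).
    rewrite mxE rmorphM /=; ring.
  apply: is_cderiveZ; apply: is_cderive_expi.
  have -> : (fun h0 : R => s * \sum_i (xi + h0 *: delta_mx 0 j) 0 i * tnth u i) =
    (fun h0 : R => s * (\sum_i xi 0 i * tnth u i) + s * tnth u j * h0).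
    by apply/funext => t; rewrite dot_line//; ring.
  exact: is_derive_affine.
- exact: integrable_weight.
- move=> u; rewrite -weight_row mulr_ge0 ?(ltW (weight_gt0 _))// mulr_ge0//.
  by rewrite -(pmulr_lge0 _ (weight_gt0 (row_of_tuple u))) (le_trans (normc_ge0 _) (gK _)).
- move=> h u _ _; rewrite /dphi normcM normc_expi mulr1 -!mulrA !normcM normc_i mul1r.
  rewrite normc_real -normcM -weight_row ler_wpM2l//.
Qed.

End FourierIntegral.

(** * Integration by parts in Euclidean space *)

Section ByParts.
Local Open Scope classical_set_scope.
Local Open Scope complex_scope.
Variable R : realType.
Local Notation RB := (measurableTypeR R).
Local Notation leb n := (lebesgue_tuple R n).
Local Notation lam := (@lebesgue_measure R).
Local Notation wt := (@cauchy_weight R).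

Lemma row_updt n (u : n.-tuple RB) j (t : R) :
  row_of_tuple (updt u j t) =
  (row_of_tuple u - (tnth u j : R) *: delta_mx 0 j) + t *: delta_mx 0 j.
Proof.
apply/rowP => i; rewrite !mxE tnth_mktuple eqxx /=.
by case: eqVneq => [->|_]; rewrite ?mulr1 ?mulr0 ?subrr ?add0r ?oppr0 ?addr0 //.
Qed.

Lemma decaysM n K (g : 'rV[R]_n -> R[i]) (a : 'rV[R]_n -> R[i]) c :
  0 <= c -> decays K g -> (forall x, normc (a x) <= c) ->
  decays (c * K) (fun x => a x * g x).
Proof.
move=> c0 gK ac x; rewrite normcM -mulrA ler_pM ?normc_ge0//.
Qed.

Lemma decaysD n K L (g h : 'rV[R]_n -> R[i]) :
  decays K g -> decays L h -> decays (K + L) (fun x => g x + h x).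
Proof.
by move=> gK hL x; rewrite (le_trans (le_normcD _ _))// mulrDl lerD.
Qed.

Lemma decays_ge0 n K (g : 'rV[R]_n -> R[i]) : decays K g -> 0 <= K.
Proof.
move=> /(_ 0) g0; rewrite -(pmulr_lge0 _ (weight_gt0 (0 : 'rV[R]_n))).
exact: le_trans (normc_ge0 _) g0.
Qed.

(** Each line integral vanishes by the fundamental theorem of calculus, P
    being zero at infinity, and integral_zero_line concludes. *)
Lemma integral_partial_derivative n K L (P dP : 'rV[R]_n -> R[i]) j :
  (forall x, is_cderive P x (delta_mx 0 j) (dP x)) ->
  (forall x, ccontinuous (fun h : R => dP (x + h *: delta_mx 0 j))) ->
  rmeasurable dP -> decays K P -> decays L dP ->
  cintegral (leb n) setT (fun u => dP (row_of_tuple u)) = 0.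
Proof.
move=> Pd cdP [m1 m2] PK dPL.
have K0 := decays_ge0 PK; have L0 := decays_ge0 dPL.
have bnd (f : 'rV[R]_n -> R[i]) M x : 0 <= M -> M <= K + L -> decays M f ->
    normc (f x) <= (K + L) * wt (x 0 j).
  move=> M0 MKL fM; rewrite (le_trans (fM x))//.
  by rewrite ler_pM ?(ltW (weight_gt0 _))// weight_le.
have KKL : K <= K + L by rewrite lerDl.
have LKL : L <= K + L by rewrite lerDr.
have xj (x : 'rV[R]_n) (t : R) :
    (x - x 0 j *: delta_mx 0 j + t *: delta_mx 0 j) 0 j = t.
  by rewrite !mxE !eqxx /= !mulr1 subrr add0r.
have line (u : n.-tuple RB) (p : R[i] -> R) :
    (forall f : R -> R[i], ccontinuous f -> continuous (fun h => p (f h))) ->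
    (forall (f : R -> R[i]) (x : R) l, is_cderive f x 1 l ->
        is_derive x 1 (fun h => p (f h)) (p l)) ->
    (forall z, `|p z| <= normc z) ->
    (\int[lam]_t (p (dP (row_of_tuple (updt u j t))))%:E = 0)%E.
  move=> pc pd pb.
  pose x0 := row_of_tuple u - (tnth u j : R) *: delta_mx 0 j.
  have x0E : x0 = row_of_tuple u - row_of_tuple u 0 j *: delta_mx 0 j.
    by rewrite /x0 mxE.
  under eq_integral => t _ do rewrite row_updt -/x0.
  apply: (integral_derive_line (F := fun t => p (P (x0 + t *: delta_mx 0 j)))
    (K := K + L)).
  - exact/pc/cdP.
  - by move=> t; apply: pd; apply: (is_cderive_line P x0 (delta_mx 0 j) t _).1.
  - move=> t; rewrite (le_trans (pb _))// (le_trans (bnd P K _ K0 KKL PK))//.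
    by rewrite x0E xj.
  - move=> t; rewrite (le_trans (pb _))// (le_trans (bnd dP L _ L0 LKL dPL))//.
    by rewrite x0E xj.
have zero (p : R[i] -> R) :
    (forall f : R -> R[i], ccontinuous f -> continuous (fun h => p (f h))) ->
    (forall (f : R -> R[i]) (x : R) l, is_cderive f x 1 l ->
        is_derive x 1 (fun h => p (f h)) (p l)) ->
    (forall z, `|p z| <= normc z) ->
    measurable_fun setT (fun u : n.-tuple RB => p (dP (row_of_tuple u))) ->
    \int[leb n]_u p (dP (row_of_tuple u)) = 0.
  move=> pc pd pb mp; rewrite /Rintegral.
  rewrite (@integral_zero_line R n wt
    (fun u => p (dP (row_of_tuple u))) j L)//.
  - exact: measurable_cauchy_weight.
  - by move=> x; exact/ltW/cauchy_weight_gt0.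
  - exact: integrable_cauchy_weight.
  - by move=> u; rewrite (le_trans (pb _))// -weight_row.
  - by move=> u; exact: line.
apply: complex_ext => /=.
- apply: zero => //; first by move=> f [].
    by move=> f x l [].
  exact: Re_le_normc.
- apply: zero => //; first by move=> f [].
    by move=> f x l [].
  exact: Im_le_normc.
Qed.

(** The product of g with the exponential has a derivative of integral zero. *)
Lemma fourier_partial n s K L (g dg : 'rV[R]_n -> R[i]) (xi : 'rV[R]_n) j :
  (forall x, is_cderive g x (delta_mx 0 j) (dg x)) ->
  (forall x, ccontinuous (fun h : R => dg (x + h *: delta_mx 0 j))) ->
  rmeasurable g -> rmeasurable dg -> decays K g -> decays L dg ->
  fourier_int s dg xi = - ('i * (s * xi 0 j)%:C) * fourier_int s g xi.
Proof.
move=> gd cdg mg mdg gK dgL.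
pose e (x : 'rV[R]_n) : R[i] := expi (s * \sum_i xi 0 i * x 0 i).
have eE (u : n.-tuple RB) :
    expi (s * \sum_i xi 0 i * tnth u i) = e (row_of_tuple u).
  by rewrite /e; congr (expi (s * _)); apply: eq_bigr => i _; rewrite mxE.
have eline (x : 'rV[R]_n) (h : R) : e (x + h *: delta_mx 0 j) =
    expi (s * (\sum_i xi 0 i * x 0 i) + s * xi 0 j * h).
  rewrite /e; congr expi.
  under eq_bigr => i _ do rewrite mulrC.
  rewrite (dot_line x j h (xi 0)) mulrDr; congr (_ + _); last by ring.
  by congr (_ * _); apply: eq_bigr => i _; rewrite mulrC.
have ed x : is_cderive e x (delta_mx 0 j) ('i * (s * xi 0 j)%:C * e x).
  apply/is_cderive_line0.
  have -> : (fun h : R => e (x + h *: delta_mx 0 j)) = (fun h : R =>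
    expi (s * (\sum_i xi 0 i * x 0 i) + s * xi 0 j * h)).
    exact/funext/eline.
  have -> : e x = expi (s * (\sum_i xi 0 i * x 0 i) + s * xi 0 j * 0).
    by rewrite mulr0 addr0.
  by apply: is_cderive_expi; exact: is_derive_affine.
have n1 (u : n.-tuple RB) : normc (e (row_of_tuple u)) = 1 by rewrite normc_expi.
have me : rmeasurable e.
  rewrite /rmeasurable; under [X in cmeasurable _ X]eq_fun do rewrite -eE.
  by apply: cmeasurable_expi; exact: measurable_dot.
pose dP x := dg x * e x + g x * ('i * (s * xi 0 j)%:C * e x).
have : cintegral (leb n) setT (fun u => dP (row_of_tuple u)) = 0.
  apply: (@integral_partial_derivative n K (L + `|s * xi 0 j| * K)
    (fun x => g x * e x)).
  - move=> x; exact: is_cderiveM.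
  - move=> x; apply: ccontinuousD; apply: ccontinuousM.
    + exact: cdg.
    + under eq_fun do rewrite eline.
      by apply: ccontinuous_expi; apply: continuous_derivable => t;
        have [] := is_derive_affine (s * (\sum_i xi 0 i * x 0 i)) (s * xi 0 j) t.
    + apply: ccontinuous_derivable => t.
      by apply/is_cderive_line; exact: gd.
    + apply: ccontinuousM; first exact: ccontinuous_cst.
      under eq_fun do rewrite eline.
      by apply: ccontinuous_expi; apply: continuous_derivable => t;
        have [] := is_derive_affine (s * (\sum_i xi 0 i * x 0 i)) (s * xi 0 j) t.
  - apply: cmeasurableD; apply: cmeasurableM => //.
    by apply: cmeasurableM => //; exact: cmeasurable_cst.
  - by move=> x; rewrite normcM normc_expi mulr1.
  - apply: decaysD => x; first by rewrite normcM normc_expi mulr1.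
    rewrite !normcM normc_i mul1r normc_expi mulr1 normc_real mulrC -mulrA.
    by rewrite ler_wpM2l.
rewrite /dP cintegralD//; last 2 first.
- by have := integrable_fourier s xi mdg dgL; under eq_fun do rewrite eE.
- have -> : (fun u => g (row_of_tuple u) * ('i * (s * xi 0 j)%:C * e (row_of_tuple u)))
   = (fun u => 'i * (s * xi 0 j)%:C * (g (row_of_tuple u) * e (row_of_tuple u))).
    by apply/funext => u; ring.
  apply: cintegrableZ => //.
  by have := integrable_fourier s xi mg gK; under eq_fun do rewrite eE.
have -> : cintegral (leb n) setT (fun u => dg (row_of_tuple u) * e (row_of_tuple u)) =
    fourier_int s dg xi.
  by apply: eq_cintegral => u _; rewrite eE.
have -> : cintegral (leb n) setT (fun u =>
    g (row_of_tuple u) * ('i * (s * xi 0 j)%:C * e (row_of_tuple u))) =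
    'i * (s * xi 0 j)%:C * fourier_int s g xi.
  rewrite -cintegralZ//; last exact: integrable_fourier gK.
  by apply: eq_cintegral => u _; rewrite eE; ring.
by move=> /eqP; rewrite addr_eq0 mulNr => /eqP.
Qed.

End ByParts.

(** * Multi-indices, sorted words and factorial weights *)

(** The cost of two additional powers of a variable: only geometric. *)
Lemma fact_add2_le b : (b.+2`! <= b`! * (2 * 4 ^ b))%N.
Proof.
rewrite !factS [leqLHS]mulnA mulnC leq_mul2l; apply/orP; right.
elim: b => // b IH; rewrite expnS.
have : (b.+3 * b.+2 <= 4 * (b.+2 * b.+1))%N by nia.
by move=> /leq_trans; apply; rewrite [leqRHS]mulnCA leq_mul2l IH.
Qed.

Section MultiIndices.
Variable n : nat.
Implicit Types (u v w : seq 'I_n) (alpha beta : multi_index n).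

Definition ord_leq (i j : 'I_n) : bool := (i <= j)%N.

(** Iterated derivatives are indexed by words. Only the sorted ones are the
    derivatives of a multi-index, and symmetry of second derivatives is not
    part of the hypotheses on a function having partial derivatives, so the
    arguments below take care never to leave the sorted words. *)
Definition mi_count w : multi_index n := [ffun i => count_mem i w].

Lemma ord_leq_trans : transitive ord_leq.
Proof. by move=> j i k; exact: leq_trans. Qed.

Lemma ord_leq_anti : antisymmetric ord_leq.
Proof. by move=> i j /anti_leq/val_inj. Qed.

Lemma mi_count_word alpha : mi_count (mi_word alpha) = alpha.
Proof.
apply/ffunP => i; rewrite ffunE count_flatten -map_comp sumnE big_map.
under eq_bigr => j _ do rewrite /= count_nseq /=.
rewrite big_enum /= (bigD1 i)//= eqxx mul1n big1 ?addn0// => j ji.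
by rewrite (negbTE ji) mul0n.
Qed.

Lemma sorted_mi_word alpha : sorted ord_leq (mi_word alpha).
Proof.
rewrite (sorted_pairwise ord_leq_trans).
have : pairwise ord_leq (enum 'I_n).
  rewrite -(sorted_pairwise ord_leq_trans).
  have := iota_sorted 0 n; rewrite -val_enum_ord sorted_map; exact: sub_sorted.
rewrite /mi_word; elim: (enum 'I_n) => //= i s IH /andP[ali ps].
rewrite pairwise_cat IH// andbT; apply/andP; split.
  apply/allrelP => x y; rewrite mem_nseq => /andP[_ /eqP ->] /flattenP[t].
  move=> /mapP[k ks ->]; rewrite mem_nseq => /andP[_ /eqP ->].
  by move/allP : ali; apply.
elim: (alpha i) => //= k ->; rewrite andbT.
by apply/allP => x; rewrite mem_nseq => /andP[_ /eqP ->]; exact: leqnn.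
Qed.

Lemma sorted_mi_wordK w : sorted ord_leq w -> mi_word (mi_count w) = w.
Proof.
move=> sw; apply: (sorted_eq ord_leq_trans ord_leq_anti) => //.
  exact: sorted_mi_word.
apply/allP => i _ /=; apply/eqP.
by have /ffunP/(_ i) := mi_count_word (mi_count w); rewrite !ffunE.
Qed.

Lemma mi_size_count w : mi_size (mi_count w) = size w.
Proof.
rewrite /mi_size; under eq_bigr do rewrite ffunE.
elim: w => [|j w IH] /=; first by rewrite big1.
by rewrite big_split /= IH (bigD1 j)//= eqxx big1 ?addn0// => i /negbTE; rewrite eq_sym => ->.
Qed.

Lemma mi_size_add alpha beta : mi_size (mi_add alpha beta) = (mi_size alpha + mi_size beta)%N.
Proof. by rewrite /mi_size -big_split; apply: eq_bigr => i _; rewrite ffunE. Qed.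

Lemma mi_fact_gt0 alpha : (0 < mi_fact alpha)%N.
Proof. by apply: prodn_gt0 => i; exact: fact_gt0. Qed.
Definition mi_pred beta j : multi_index n := [ffun i => (beta i - (i == j))%N].

Lemma mi_size_pred beta j : (0 < beta j)%N ->
  mi_size beta = (mi_size (mi_pred beta j)).+1.
Proof.
move=> bj; rewrite /mi_size (bigD1 j)//= [in RHS](bigD1 j)//= ffunE eqxx subn1.
rewrite -addSn prednK//; congr (_ + _)%N.
by apply: eq_bigr => i /negbTE ij; rewrite ffunE ij subn0.
Qed.

Lemma mi_fact_pred beta j : (0 < beta j)%N ->
  mi_fact beta = (beta j * mi_fact (mi_pred beta j))%N.
Proof.
move=> bj; rewrite /mi_fact (bigD1 j)//= [in RHS](bigD1 j)//= ffunE eqxx subn1 mulnA.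
congr (_ * _)%N; first by rewrite -[in LHS](prednK bj) factS prednK.
by apply: eq_bigr => i /negbTE ij; rewrite ffunE ij subn0.
Qed.

Lemma mi_fact_count_cons j w :
  mi_fact (mi_count (j :: w)) = ((count_mem j w).+1 * mi_fact (mi_count w))%N.
Proof.
rewrite (@mi_fact_pred _ j) ffunE /= eqxx//; congr (_ * _)%N; congr mi_fact.
apply/ffunP => i; rewrite !ffunE /=.
by rewrite (eq_sym j); case: eqP => _; rewrite ?add1n ?subn1 ?subn0.
Qed.

Section Monomials.
Variable R : realType.
Implicit Type x : 'rV[R]_n.

Lemma monomial_count x w : \prod_(j <- w) x 0 j = monomial x (mi_count w).
Proof.
rewrite /monomial; elim: w => [|j w IH].
  by rewrite big_nil big1// => i _; rewrite ffunE.
rewrite big_cons IH (bigD1 j)//= [RHS](bigD1 j)//= mulrA; congr (_ * _).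
  by rewrite !ffunE /= eqxx exprS.
by apply: eq_bigr => i /negbTE ij; rewrite !ffunE /= eq_sym ij.
Qed.

Lemma monomialD x alpha beta :
  monomial x (mi_add alpha beta) = monomial x alpha * monomial x beta.
Proof.
by rewrite /monomial -big_split; apply: eq_bigr => i _; rewrite ffunE exprD.
Qed.

Lemma monomial_line x j (h : R) beta :
  monomial (x + h *: delta_mx 0 j) beta =
  (x 0 j + h) ^+ beta j * \prod_(i | i != j) x 0 i ^+ beta i.
Proof.
rewrite /monomial (bigD1 j)//= !mxE !eqxx mulr1; congr (_ * _).
by apply: eq_bigr => i /negbTE ij; rewrite !mxE ij mulr0 addr0.
Qed.

Lemma is_derive_monomial x j beta :
  is_derive x (delta_mx 0 j) (fun y => monomial y beta)
    ((beta j)%:R * monomial x (mi_pred beta j)).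
Proof.
rewrite -[X in is_derive X]addr0 -(scale0r (delta_mx 0 j)).
apply/(is_derive_line (fun y => monomial y beta)).
rewrite (_ : (fun h => _) = fun h : R => (x 0 j + h) ^+ beta j *
  \prod_(i | i != j) x 0 i ^+ beta i); last first.
  by apply/funext => h; rewrite monomial_line.
set c := \prod_(i | _) _.
have -> : monomial x (mi_pred beta j) = x 0 j ^+ (beta j).-1 * c.
  rewrite /monomial (bigD1 j)//= ffunE eqxx subn1; congr (_ * _).
  by apply: eq_bigr => i /negbTE ij; rewrite ffunE ij subn0.
have d1 : is_derive (0 : R) 1 (fun h : R => x 0 j + h) 1.
  have := is_derive_affine (x 0 j) 1 0.
  by under eq_fun do rewrite mul1r.
have -> : (fun h : R => (x 0 j + h) ^+ beta j * c) =
    (fun h : R => x 0 j + h) ^+ beta j * cst c.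
  by apply/funext => h; rewrite !fctE.
apply: (is_derive_eq (is_deriveM (is_deriveX (beta j) d1) (is_derive_cst c (0 : R) 1))).
by rewrite /GRing.scale /= addr0; ring.
Qed.

End Monomials.

Section Estimates.
Variables (R : realType) (mu : R).
Hypothesis mu_ge : 1 / 2 <= mu.

(** The factorial weights are all of this form, with exponent mu for the
    Euclidean variables and sigma for the torus variables. *)
Definition npow (k : nat) : R := k%:R `^ mu.

Lemma mu_gt0 : 0 < mu.
Proof. by apply: lt_le_trans mu_ge; rewrite divr_gt0. Qed.

Lemma npow_ge0 k : 0 <= npow k. Proof. exact: powR_ge0. Qed.

Lemma npowM a b : npow (a * b) = npow a * npow b.
Proof. by rewrite /npow natrM powRM. Qed.

Lemma npow_le a b : (a <= b)%N -> npow a <= npow b.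
Proof. by move=> ab; apply: ge0_ler_powR; rewrite ?nnegrE ?ler_nat// ltW// mu_gt0. Qed.

Lemma npowX a k : npow (a ^ k) = npow a ^+ k.
Proof.
elim: k => [|k IH]; first by rewrite expn0 expr0 /npow powR1.
by rewrite expnS exprS npowM IH.
Qed.

Lemma npow_ge1 a : (0 < a)%N -> 1 <= npow a.
Proof. move=> a0; have := npow_le a0; by rewrite {1}/npow powR1. Qed.

(** Let X and Y be the two binomial coefficients. Then X <= Y and
    b X <= (a + 1) Y, so that (b X)^2 <= b (a + 1) Y^2, that is,
    b X <= Y (b (a + 1))^(1/2). This is where mu >= 1/2 is needed. *)
Lemma binomial_absorb a b c : (0 < b)%N ->
  b%:R * 'C(a + b.-1, a)%:R <= 'C(a.+1 + b, a.+1)%:R * npow (b * (a.+1 + c)).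
Proof.
move=> b0.
have C1 : ('C(a + b.-1, a) <= 'C(a.+1 + b, a.+1))%N.
  have -> : (a.+1 + b = (a + b).+1)%N by [].
  rewrite binS (leq_trans _ (leq_addl _ _))//.
  by apply: leq_bin2l; lia.
have C2 : (b * 'C(a + b.-1, a) <= a.+1 * 'C(a.+1 + b, a.+1))%N.
  have E : (a.+1 * 'C(a + b, a.+1) = b * 'C(a + b, a))%N.
    by rewrite mul_bin_left addKn.
  apply: (@leq_trans (a.+1 * 'C(a + b, a.+1))%N).
    by rewrite E leq_mul2l leq_bin2l ?orbT//; lia.
  rewrite leq_mul2l addSn binS; apply/orP; right; exact: leq_addr.
have sq : (b%:R * 'C(a + b.-1, a)%:R) ^+ 2 <=
   ('C(a.+1 + b, a.+1)%:R) ^+ 2 * (b * (a.+1 + c))%:R :> R.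
  rewrite -natrM -!natrX -natrM ler_nat.
  rewrite expnMn -mulnn -!mulnA.
  set X := 'C(a + b.-1, a) in C1 C2 *; set Y := 'C(a.+1 + b, a.+1) in C1 C2 *.
  have : (b * X * X <= a.+1 * Y * Y)%N by exact: leq_mul.
  nia.
rewrite -(@ler_pXn2r _ 2)// ?nnegrE ?mulr_ge0 ?npow_ge0//.
rewrite (le_trans sq)// exprMn ler_wpM2l ?sqr_ge0//.
have N1 : 1 <= (b * (a.+1 + c))%:R :> R by rewrite ler1n muln_gt0 b0.
rewrite /npow -powR_mulrn ?powR_ge0// -powRrM -[leLHS]powRr1 ?ler0n//.
apply: ler_powR => //; have := mu_ge; lra.
Qed.

End Estimates.
End MultiIndices.

(** * Functions with symmetric factorial bounds *)

Section RapidFunctions.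
Local Open Scope classical_set_scope.
Local Open Scope complex_scope.
Variables (R : realType) (n : nat).
Local Notation RB := (measurableTypeR R).
Local Notation leb := (lebesgue_tuple R n).
Local Notation dirs := (@xi_direction R n).
Implicit Types (g : 'rV[R]_n -> R[i]) (v w : seq 'I_n) (alpha beta : multi_index n).

Lemma measurable_updt (j : 'I_n) (h : R) :
  measurable_fun setT (fun u : n.-tuple RB => updt u j ((tnth u j : R) + h) : n.-tuple RB).
Proof.
apply: (measurable_fun_tnthP _).2 => i.
rewrite (_ : _ \o _ = fun u : n.-tuple RB => (tnth u i : R) + (if i == j then h else 0)).
  exact: (measurable_funD (measurable_coord i) (measurable_cst _)).
apply/funext => u /=; rewrite tnth_mktuple.
by case: eqVneq => [->|_]; rewrite ?addr0.
Qed.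

(** A partial derivative is the limit of difference quotients. *)
Lemma rmeasurable_partial g (dg : 'rV[R]_n -> R[i]) j :
  (forall x, is_cderive g x (delta_mx 0 j) (dg x)) ->
  rmeasurable g -> rmeasurable dg.
Proof.
move=> gd [m1 m2].
have key (p dp : 'rV[R]_n -> R) :
    (forall x, is_derive x (delta_mx 0 j) p (dp x)) ->
    measurable_fun setT (fun u : n.-tuple RB => p (row_of_tuple u)) ->
    measurable_fun setT (fun u : n.-tuple RB => dp (row_of_tuple u)).
  move=> pd mp.
  pose q (N : nat) (u : n.-tuple RB) : R := (harmonic N : R)^-1 *
    (p (row_of_tuple (updt u j ((tnth u j : R) + harmonic N))) - p (row_of_tuple u)).
  apply: (measurable_fun_cvg (h := q)).
    move=> N; apply: measurable_funM; first exact: measurable_cst.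
    apply: measurable_funB => //.
    exact: (measurableT_comp mp (measurable_updt j (harmonic N))).
  move=> u _.
  have [pdx <-] := pd (row_of_tuple u).
  have := @cvgr_dnbhsP R (fun h : R => h^-1 *: ((p \o shift (row_of_tuple u))
      (h *: delta_mx 0 j) - p (row_of_tuple u))) 0 ('D_(delta_mx 0 j) p (row_of_tuple u)).
  move=> [/(_ pdx) + _] => /(_ (fun N => harmonic N)) /=.
  have E N : (N.+1%:R)^-1^-1 *: (p ((N.+1%:R)^-1 *: delta_mx 0 j + row_of_tuple u) -
       p (row_of_tuple u)) = q N u.
    rewrite /q row_updt; congr (_ * (p _ - _)).
    by rewrite scalerDl addrA subrK addrC.
  rewrite -(funext E); apply; split; last exact: cvg_harmonic.
  by move=> N; rewrite invr_eq0 pnatr_eq0.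
split.
- apply: (key (fun x => complex.Re (g x)) (fun x => complex.Re (dg x)) _ m1) => x.
  by have [] := gd x.
- apply: (key (fun x => complex.Im (g x)) (fun x => complex.Im (dg x)) _ m2) => x.
  by have [] := gd x.
Qed.

Lemma is_cderive_partials g v j x : has_partials dirs g ->
  is_cderive (partials dirs v g) x (delta_mx 0 j) (partials dirs (j :: v) g x).
Proof. by move=> gp; apply: cderivable_is_cderive; exact: gp. Qed.

Lemma rmeasurable_partials g v : has_partials dirs g -> rmeasurable g ->
  rmeasurable (partials dirs v g).
Proof.
move=> gp mg; elim: v => // j v IH.
apply: rmeasurable_partial IH => x; exact: is_cderive_partials.
Qed.

Lemma rmeasurable_monomial beta :
  rmeasurable (fun x : 'rV[R]_n => (monomial x beta)%:C : R[i]).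
Proof.
apply: cmeasurable_real; rewrite /monomial.
apply: measurable_prod => i _.
under eq_fun do rewrite mxE.
apply: (measurable_funX (beta i)); exact: (measurable_coord i).
Qed.

Variables (mu C : R).
Hypotheses (mu_ge : 1 / 2 <= mu) (C_ge1 : 1 <= C).
Local Notation npow := (npow mu).

(** The size K is a parameter next to the rate C because both enter the
    argument differently: the rate may worsen at each step, whereas the size
    carries the dependence on the frequency k and must come out linearly. *)
Definition rapid (K : R) g :=
  forall alpha beta x,
    normc ((monomial x alpha)%:C * partials dirs (mi_word beta) g x) <=
    K * C ^+ mi_size (mi_add alpha beta) * npow (mi_fact alpha * mi_fact beta).

Definition mono_partial g beta v (x : 'rV[R]_n) : R[i] :=
  (monomial x beta)%:C * partials dirs v g x.

(** Together with decay_rate, the loss incurred when the uniform bounds of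
    rapid are turned into integrable decay. *)
Definition decay_const := 2 ^+ n * C ^+ n.*2 * npow (2 ^ n).
Definition decay_rate := C * npow 4.

Lemma C_le_rate : C <= decay_rate.
Proof. by rewrite ler_peMr ?(le_trans ler01)// npow_ge1. Qed.

Lemma rate_ge1 : 1 <= decay_rate.
Proof. exact: le_trans C_ge1 C_le_rate. Qed.

(** Multiplying by x_i^2 wherever |x_i| >= 1 turns a uniform bound on all the
    products (monomial * derivative) into integrable decay. *)
Lemma decays_mono_partial K g beta v : 0 <= K -> rapid K g -> sorted (@ord_leq n) v ->
  decays (K * decay_const * decay_rate ^+ (mi_size beta + size v) *
    npow (mi_fact beta * mi_fact (mi_count v))) (mono_partial g beta v).
Proof.
move=> K0 gK sv x.
pose gamma : multi_index n := [ffun i => if 1 <= `|x 0 i| then 2%N else 0%N].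
have C0 : 0 <= C by exact: le_trans C_ge1.
have w0 := weight_gt0 x.
have gam2 i : (gamma i <= 2)%N by rewrite ffunE; case: ifP.
have mg0 : 0 <= monomial x gamma.
  by apply: prodr_ge0 => i _; rewrite ffunE; case: ifP => // _; exact: sqr_ge0.
have wV : (weight x)^-1 <= 2 ^+ n * monomial x gamma.
  rewrite /weight -prodfV /monomial -[n in 2 ^+ n]card_ord -prodr_const -big_split /=.
  apply: ler_prod => i _; rewrite invr_ge0 (ltW (cauchy_weight_gt0 _))//= invrK /oneDsqr.
  rewrite ffunE; case: ifP => [x1|/negbT].
    rewrite mulr2n mulrDl mul1r lerD2r -real_normK ?num_real//.
    by rewrite expr2 mulr_ege1.
  rewrite -ltNge expr0 mulr1 => /ltW x1; rewrite mulr2n lerD2l.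
  by rewrite -real_normK ?num_real// expr_le1.
rewrite -ler_pdivrMr//.
apply: (@le_trans _ _ (2 ^+ n * normc ((monomial x (mi_add gamma beta))%:C *
    partials dirs v g x))).
  have -> : normc ((monomial x (mi_add gamma beta))%:C * partials dirs v g x) =
      monomial x gamma * normc (mono_partial g beta v x).
    by rewrite /mono_partial monomialD rmorphM -mulrA normcM normc_real (ger0_norm mg0).
  by rewrite mulrA mulrC ler_wpM2r// normc_ge0.
have := gK (mi_add gamma beta) (mi_count v) x; rewrite sorted_mi_wordK// => h.
apply: (le_trans (ler_wpM2l _ h)); first exact: exprn_ge0.
rewrite !mi_size_add mi_size_count /decay_const !mulrA.
have sg : (mi_size gamma <= n.*2)%N.
  rewrite -muln2 -{2}(card_ord n) -sum_nat_const; exact: leq_sum.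
have f1 : (mi_fact (mi_add gamma beta) <= mi_fact beta * (2 ^ n * 4 ^ mi_size beta))%N.
  have -> : (2 ^ n = \prod_(i < n) 2)%N by rewrite prod_nat_const card_ord.
  rewrite /mi_fact /mi_size expn_sum -!big_split /=.
  apply: leq_prod => i _; rewrite ffunE.
  apply: leq_trans (fact_add2_le (beta i)).
  by apply: leq_fact; rewrite -addn2 addnC leq_add2l.
have f2 : npow (mi_fact (mi_add gamma beta) * mi_fact (mi_count v)) <=
    npow (mi_fact beta * mi_fact (mi_count v)) * (npow (2 ^ n) * npow 4 ^+ mi_size beta).
  rewrite -npowX -!npowM; apply: npow_le => //.
  by rewrite mulnAC leq_mul2r f1 orbT.
have f3 : C ^+ (mi_size gamma + mi_size beta + size v) <=
    C ^+ n.*2 * C ^+ (mi_size beta + size v).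
  by rewrite -exprD ler_weXn2l// -addnA leq_add2r.
have f4 : npow 4 ^+ mi_size beta <= npow 4 ^+ (mi_size beta + size v).
  by rewrite ler_weXn2l ?leq_addr// npow_ge1.
rewrite exprMn.
have -> : K * 2 ^+ n * C ^+ n.*2 * npow (2 ^ n) *
   (C ^+ (mi_size beta + size v) * npow 4 ^+ (mi_size beta + size v)) *
   npow (mi_fact beta * mi_fact (mi_count v)) =
   2 ^+ n * K * (C ^+ n.*2 * C ^+ (mi_size beta + size v)) *
   (npow (mi_fact beta * mi_fact (mi_count v)) *
    (npow (2 ^ n) * npow 4 ^+ (mi_size beta + size v))) by ring.
apply: ler_pM.
- by rewrite mulr_ge0 ?exprn_ge0// mulr_ge0// exprn_ge0.
- exact: npow_ge0.
- by rewrite ler_wpM2l// mulr_ge0// exprn_ge0.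
- rewrite (le_trans f2)// ler_wpM2l ?npow_ge0// ler_wpM2l ?npow_ge0//.
Qed.

Lemma rmeasurable_mono_partial g beta v : has_partials dirs g -> rmeasurable g ->
  rmeasurable (mono_partial g beta v).
Proof.
move=> gp mg; apply: cmeasurableM; first exact: rmeasurable_monomial.
exact: rmeasurable_partials.
Qed.

Lemma is_cderive_mono_partial g beta v j x : has_partials dirs g ->
  is_cderive (mono_partial g beta v) x (delta_mx 0 j)
    (mono_partial g beta (j :: v) x +
     (beta j)%:R%:C * mono_partial g (mi_pred beta j) v x).
Proof.
move=> gp.
have := is_cderiveM (is_cderive_real (is_derive_monomial x j beta))
  (is_cderive_partials v j x gp).
by rewrite rmorphM /= addrC mulrA.
Qed.

Lemma ccontinuous_mono_partial_line g beta v j x : has_partials dirs g ->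
  ccontinuous (fun h : R => mono_partial g beta v (x + h *: delta_mx 0 j)).
Proof.
move=> gp; apply: ccontinuous_derivable => t.
apply: (is_cderive_line _ _ _ _ _).1; exact: is_cderive_mono_partial.
Qed.

End RapidFunctions.

(** * Fourier integrals of such functions *)

Section FourierOfRapid.
Local Open Scope classical_set_scope.
Local Open Scope complex_scope.
Variables (R : realType) (n : nat).
Local Notation dirs := (@xi_direction R n).
Implicit Types (v u w : seq 'I_n) (alpha beta : multi_index n).

(** The combinatorial weight of the induction in fourier_mono_bound: it grows
    fast enough to absorb the factors beta_j produced by the Leibniz rule and
    is still at most exponential in the size of u and beta. *)
Definition bin_prod u beta : nat :=
  (\prod_i 'C(count_mem i u + beta i, count_mem i u))%N.

Definition bin_prod_off j u beta : nat :=
  (\prod_(i | i != j) 'C(count_mem i u + beta i, count_mem i u))%N.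

Lemma bin_prodE j u beta : bin_prod u beta =
  ('C(count_mem j u + beta j, count_mem j u) * bin_prod_off j u beta)%N.
Proof. by rewrite /bin_prod (bigD1 j). Qed.

Lemma bin_prod_rcons j u beta : bin_prod (rcons u j) beta =
  ('C((count_mem j u).+1 + beta j, (count_mem j u).+1) * bin_prod_off j u beta)%N.
Proof.
have cr i : count_mem i (rcons u j) = (count_mem i u + (j == i))%N.
  by rewrite -cats1 count_cat /= addn0.
rewrite (bin_prodE j) cr eqxx addn1; congr (_ * _)%N.
by apply: eq_bigr => i /negbTE ij; rewrite cr eq_sym ij addn0.
Qed.

Lemma bin_prod_off_pred j u beta :
  bin_prod_off j u (mi_pred beta j) = bin_prod_off j u beta.
Proof. by apply: eq_bigr => i /negbTE ij; rewrite ffunE ij subn0. Qed.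

Lemma bin_prod_le j u beta : (bin_prod u beta <= bin_prod (rcons u j) beta)%N.
Proof.
rewrite (bin_prodE j) bin_prod_rcons leq_mul2r addSn binS leq_addl orbT //.
Qed.

Lemma bin_prod_word u beta : (bin_prod u beta <= 2 ^ (size u + mi_size beta))%N.
Proof.
rewrite -mi_size_count -mi_size_add /mi_size expn_sum /bin_prod.
apply: leq_prod => i _; rewrite !ffunE.
set a := count_mem i u; set N := (a + beta i)%N.
have -> : (2 ^ N = \sum_(k < N.+1) 'C(N, k) * (1 ^ (N - k) * 1 ^ k))%N.
  by rewrite -expnDn.
have aN : (a < N.+1)%N by rewrite ltnS leq_addr.
by rewrite (bigD1 (Ordinal aN))//= !exp1n !muln1 leq_addr.
Qed.

Variables (mu C : R).
Hypotheses (mu_ge : 1 / 2 <= mu) (C_ge1 : 1 <= C).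
Local Notation npow := (npow mu).
Local Notation rate := (decay_rate mu C).

(** The case of an integration by parts whose derivative falls on the
    monomial and lowers its degree. *)
Lemma bin_prod_absorb j u v beta : (0 < beta j)%N ->
  (beta j)%:R * (bin_prod u (mi_pred beta j))%:R *
    npow (mi_fact (mi_pred beta j) * mi_fact (mi_count (u ++ v))) <=
  (bin_prod (rcons u j) beta)%:R *
    npow (mi_fact beta * mi_fact (mi_count (u ++ j :: v))).
Proof.
move=> bj.
have -> : mi_count (u ++ j :: v) = mi_count (j :: u ++ v).
  by apply/ffunP => i; rewrite !ffunE /= !count_cat /= addnCA.
rewrite mi_fact_count_cons (mi_fact_pred bj) bin_prod_rcons (bin_prodE j).
rewrite bin_prod_off_pred count_cat -addSn ffunE eqxx subn1.
set a := count_mem j u; set c := count_mem j v; set b := beta j in bj *.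
set X := bin_prod_off _ _ _; set F := mi_fact (mi_pred _ _).
set G := mi_fact (mi_count _).
have -> : (b * F * ((a.+1 + c) * G) = b * (a.+1 + c) * (F * G))%N by ring.
rewrite [npow (b * (a.+1 + c) * (F * G))]npowM// !natrM.
have := binomial_absorb mu_ge a c bj.
have X0 : 0 <= X%:R * npow (F * G) :> R by rewrite mulr_ge0 ?npow_ge0.
move=> /(ler_wpM2r X0) h; move: h; congr (_ <= _); ring.
Qed.

Variables (g : 'rV[R]_n -> R[i]) (K s : R) (xi : 'rV[R]_n).
Hypotheses (K0 : 0 <= K) (gp : has_partials dirs g) (mg : rmeasurable g)
  (gK : rapid mu C K g) (s1 : `|s| = 1).

Local Notation G := (mono_partial g).

Let C0 : 0 <= C. Proof. exact: le_trans C_ge1. Qed.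
Let dcst0 : 0 <= decay_const n mu C.
Proof. by rewrite !mulr_ge0 ?exprn_ge0 ?npow_ge0. Qed.
Let r1 : 1 <= rate. Proof. exact: rate_ge1. Qed.
Let r0 : 0 <= rate. Proof. exact: le_trans r1. Qed.

(** Multiplication by xi_j is integration by parts in x_j; the derivative
    falls either on the derivative of g or on the monomial. *)
Lemma normc_fourier_step beta v j : sorted (@ord_leq n) (j :: v) -> forall c : R[i],
  normc (c * ((xi 0 j)%:C * fourier_int s (G beta v) xi)) <=
  normc (c * fourier_int s (G beta (j :: v)) xi) +
  (beta j)%:R * normc (c * fourier_int s (G (mi_pred beta j) v) xi).
Proof.
move=> sjv c.
have sv : sorted (@ord_leq n) v by exact: path_sorted sjv.
have dG b w := decays_mono_partial mu_ge C_ge1 b K0 gK (v := w).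
have mG b w := rmeasurable_mono_partial b w gp mg.
have mG2 : rmeasurable (fun x => (beta j)%:R%:C * G (mi_pred beta j) v x).
  exact: (cmeasurableM (cmeasurable_cst _ _) (mG _ _)).
have bn (x : 'rV[R]_n) : normc ((beta j)%:R%:C : R[i]) <= (beta j)%:R.
  by rewrite normc_real normr_nat.
have dG2 := decaysM (ler0n R (beta j)) (dG (mi_pred beta j) v sv) bn.
have cdG x : ccontinuous (fun h : R => G beta (j :: v) (x + h *: delta_mx 0 j) +
    (beta j)%:R%:C * G (mi_pred beta j) v (x + h *: delta_mx 0 j)).
  apply: ccontinuousD; first exact: ccontinuous_mono_partial_line.
  apply: ccontinuousM; first exact: ccontinuous_cst.
  exact: ccontinuous_mono_partial_line.
have := fourier_partial s xi (fun x => is_cderive_mono_partial beta v j x gp) cdG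
  (mG beta v) (cmeasurableD (mG beta (j :: v)) mG2) (dG beta v sv)
  (decaysD (dG beta _ sjv) dG2).
rewrite (fourierD _ _ (mG _ _) (dG beta _ sjv) mG2 dG2).
rewrite (fourierZ _ _ _ (mG _ _) (dG _ _ sv)) => E.
have -> : normc (c * ((xi 0 j)%:C * fourier_int s (G beta v) xi)) =
   normc (c * (- ('i * (s * xi 0 j)%:C) * fourier_int s (G beta v) xi)).
  by rewrite !normcM normcN !normcM normc_i mul1r !normc_real normrM s1 mul1r.
rewrite -E mulrDr (le_trans (le_normcD _ _))// lerD2l mulrCA normcM normc_real.
by rewrite normr_nat.
Qed.

Definition fourier_const := 2 * (K * decay_const n mu C * pi ^+ n).

(** By induction on the number of frequency factors, the last of which is
    moved into the integrand. The word u ++ v stays sorted because the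
    derivative is inserted exactly between u and v. *)
Lemma fourier_mono_bound u v beta : sorted (@ord_leq n) (u ++ v) ->
  normc ((\prod_(j <- u) xi 0 j)%:C * fourier_int s (G beta v) xi) <=
  fourier_const * (bin_prod u beta)%:R * (2 * rate) ^+ size u *
    rate ^+ (mi_size beta + size v) *
    npow (mi_fact beta * mi_fact (mi_count (u ++ v))).
Proof.
have fc0 : 0 <= fourier_const by rewrite /fourier_const mulr_ge0// mulr_ge0 ?exprn_ge0 ?pi_ge0// mulr_ge0.
elim/last_ind: u v beta => [|u j IH] v beta suv.
  rewrite big_nil rmorph1 mul1r expr0 mulr1.
  have -> : bin_prod [::] beta = 1%N.
    by rewrite /bin_prod big1// => i _; rewrite bin0.
  rewrite mulr1; apply: (le_trans (normc_fourier_le _ _ _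
     (decays_mono_partial mu_ge C_ge1 beta K0 gK suv))).
    exact: rmeasurable_mono_partial.
  by rewrite /fourier_const le_eqVlt; apply/orP; left; apply/eqP; ring.
rewrite cat_rcons in suv.
have sjv : sorted (@ord_leq n) (j :: v) by have := cat_sorted2 suv; case.
have sv : sorted (@ord_leq n) (u ++ v).
  apply: (subseq_sorted (@ord_leq_trans n)) suv.
  by apply: cat_subseq => //; exact: subseq_cons.
have -> : (\prod_(i <- rcons u j) xi 0 i)%:C * fourier_int s (G beta v) xi =
    (\prod_(i <- u) xi 0 i)%:C * ((xi 0 j)%:C * fourier_int s (G beta v) xi).
  by rewrite -cats1 big_cat big_seq1 mulrA -rmorphM.
rewrite cat_rcons.
apply: (le_trans (normc_fourier_step beta sjv _)).
set P := npow _; set A := fourier_const in fc0 *.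
set B := (bin_prod (rcons u j) beta)%:R.
have P0 : 0 <= P := npow_ge0 _ _.
have q0 : 0 <= (2 * rate) ^+ size u by apply: exprn_ge0; exact: mulr_ge0.
have e0 : 0 <= A * (2 * rate) ^+ size u by exact: mulr_ge0.
have rk0 k : 0 <= rate ^+ k by exact: exprn_ge0.
have t1 : normc ((\prod_(j <- u) xi 0 j)%:C * fourier_int s (G beta (j :: v)) xi) <=
    A * (2 * rate) ^+ size u * (B * P * rate ^+ (mi_size beta + size v).+1).
  apply: (le_trans (IH _ beta suv)).
  rewrite /= addnS -/P.
  have -> : A * (bin_prod u beta)%:R * (2 * rate) ^+ size u *
     rate ^+ (mi_size beta + size v).+1 * P = A * (2 * rate) ^+ size u *
     ((bin_prod u beta)%:R * P * rate ^+ (mi_size beta + size v).+1) by ring.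
  by rewrite ler_wpM2l// ler_wpM2r// ler_wpM2r// ler_nat bin_prod_le.
have t2 : (beta j)%:R * normc ((\prod_(j <- u) xi 0 j)%:C *
     fourier_int s (G (mi_pred beta j) v) xi) <=
    A * (2 * rate) ^+ size u * (B * P * rate ^+ (mi_size beta + size v).+1).
  have [bj|bj] := posnP (beta j).
    rewrite bj mulr0n mul0r; apply: mulr_ge0 => //; apply: mulr_ge0 => //.
    exact: mulr_ge0.
  apply: (le_trans (ler_wpM2l _ (IH v (mi_pred beta j) sv))) => //.
  have ab := bin_prod_absorb u v bj; rewrite -/B -/P in ab.
  have rr : rate ^+ (mi_size (mi_pred beta j) + size v) <=
      rate ^+ (mi_size beta + size v).+1.
    rewrite ler_weXn2l// (mi_size_pred bj) addSn.
    exact: leq_trans (leqnSn _) (leqnSn _).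
  set Q := npow _ in ab *; set r' := rate ^+ _ in rr *.
  have -> : (beta j)%:R * (A * (bin_prod u (mi_pred beta j))%:R *
      (2 * rate) ^+ size u * r' * Q) =
    A * (2 * rate) ^+ size u * ((beta j)%:R * (bin_prod u (mi_pred beta j))%:R * Q * r').
    by ring.
  by rewrite ler_wpM2l// ler_pM// ?mulr_ge0 ?npow_ge0//; exact: exprn_ge0.
apply: (le_trans (lerD t1 t2)).
rewrite size_rcons !exprS le_eqVlt; apply/orP; left; apply/eqP; ring.
Qed.

End FourierOfRapid.

Section FourierRapid.
Local Open Scope classical_set_scope.
Local Open Scope complex_scope.
Variables (R : realType) (n : nat).
Local Notation dirs := (@xi_direction R n).
Implicit Types (v u w : seq 'I_n) (alpha beta : multi_index n).

Lemma decays_le K L (g : 'rV[R]_n -> R[i]) : K <= L -> decays K g -> decays L g.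
Proof.
by move=> KL gK x; rewrite (le_trans (gK x))// ler_wpM2r// ltW// weight_gt0.
Qed.

Variables (mu C : R).
Hypotheses (mu_ge : 1 / 2 <= mu) (C_ge1 : 1 <= C).
Variables (g : 'rV[R]_n -> R[i]) (K s : R).
Hypotheses (K0 : 0 <= K) (gp : has_partials dirs g) (mg : rmeasurable g)
  (gK : rapid mu C K g) (s1 : `|s| = 1).

Definition word_factor w (x : 'rV[R]_n) : R[i] :=
  \prod_(j <- w) ('i * s%:C * (x 0 j)%:C).

Lemma word_factorE w x :
  word_factor w x * g x = ('i * s%:C) ^+ size w * mono_partial g (mi_count w) [::] x.
Proof.
rewrite /mono_partial mulrA -monomial_count; congr (_ * _).
rewrite /word_factor; elim: w => [|j w IH]; first by rewrite !big_nil expr0 mulr1.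
by rewrite !big_cons IH /= exprS rmorphM; ring.
Qed.

Lemma normc_word_unit w : normc (('i * s%:C) ^+ size w) = 1.
Proof. by rewrite normcX normcM normc_i normc_real s1 mul1r expr1n. Qed.

Lemma word_factor_decays w : exists L, decays L (fun x => word_factor w x * g x).
Proof.
have := decays_mono_partial mu_ge C_ge1 (mi_count w) K0 gK (v := [::]) isT.
set L := (X in decays X _) => h; exists L => x.
by rewrite word_factorE normcM normc_word_unit mul1r.
Qed.

Lemma rmeasurable_word_factor w : rmeasurable (fun x => word_factor w x * g x).
Proof.
rewrite /rmeasurable; under [X in cmeasurable _ X]eq_fun do rewrite word_factorE.
apply: cmeasurableM; first exact: cmeasurable_cst.
exact: rmeasurable_mono_partial.
Qed.

Lemma is_cderive_fourier_word w j xi :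
  is_cderive (fourier_int s (fun x => word_factor w x * g x)) xi (delta_mx 0 j)
    (fourier_int s (fun x => word_factor (j :: w) x * g x) xi).
Proof.
have [L1 d1] := word_factor_decays w.
have [L2 d2] := word_factor_decays (j :: w).
have L10 := decays_ge0 d1; have L20 := decays_ge0 d2.
have := @is_cderive_fourier R n s (L1 + L2) (fun x => word_factor w x * g x) xi j.
have -> : (fun x : 'rV[R]_n => 'i * s%:C * (x 0 j)%:C * (word_factor w x * g x)) =
   (fun x => word_factor (j :: w) x * g x).
  by apply/funext => x; rewrite /word_factor big_cons mulrA.
apply; first exact: rmeasurable_word_factor.
- by apply: decays_le d1; rewrite lerDl.
- apply: (@decays_le L2); first by rewrite lerDr.
  move=> x; apply: le_trans (d2 x).
  by rewrite /word_factor big_cons -!mulrA !normcM normc_i mul1r !normc_real s1 mul1r.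
Qed.

Lemma partials_fourier w : partials dirs w (fourier_int s g) =
  fourier_int s (fun x => word_factor w x * g x).
Proof.
elim: w => [|j w IH] /=.
  by congr (fourier_int s _); apply/funext => x; rewrite /word_factor big_nil mul1r.
apply/funext => xi; rewrite IH.
by have /is_cderiveP[] := is_cderive_fourier_word w j xi.
Qed.

Lemma has_partials_fourier : has_partials dirs (fourier_int s g).
Proof.
move=> w j xi; rewrite partials_fourier.
by have /is_cderiveP[] := is_cderive_fourier_word w j xi.
Qed.

(** The Fourier integral exchanges multiplication by monomials and
    differentiation, so a class defined by symmetric bounds on both is
    preserved. The loss in size is a factor independent of g. *)
Lemma rapid_fourier :
  rapid mu (4 * decay_rate mu C) (2 * decay_const n mu C * pi ^+ n * K)
    (fourier_int s g).
Proof.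
move=> alpha beta xi; rewrite partials_fourier.
have r1 : 1 <= decay_rate mu C by exact: rate_ge1.
have r0 : 0 <= decay_rate mu C by exact: le_trans r1.
have -> : fourier_int s (fun x => word_factor (mi_word beta) x * g x) xi =
    ('i * s%:C) ^+ size (mi_word beta) * fourier_int s (mono_partial g beta [::]) xi.
  have dG := decays_mono_partial mu_ge C_ge1 beta K0 gK (v := [::]) isT.
  rewrite -(fourierZ _ _ _ _ dG); last exact: rmeasurable_mono_partial.
  congr (fourier_int s _ xi); apply/funext => x.
  by rewrite word_factorE mi_count_word.
rewrite mulrCA normcM normc_word_unit mul1r.
have := @fourier_mono_bound _ _ _ _ mu_ge C_ge1 _ _ _ xi K0 gp mg gK s1
  (mi_word alpha) [::] beta.
rewrite cats0 => /(_ (sorted_mi_word alpha)).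
rewrite monomial_count mi_count_word => /le_trans; apply.
rewrite addn0 -mi_size_count mi_count_word mi_size_add [(mi_fact beta * _)%N]mulnC.
rewrite ler_wpM2r ?npow_ge0// /fourier_const.
have bl : (bin_prod (mi_word alpha) beta)%:R <= 2 ^+ (mi_size alpha + mi_size beta) :> R.
  rewrite -natrX ler_nat (leq_trans (bin_prod_word _ _))//.
  by rewrite -mi_size_count mi_count_word.
have D0 : 0 <= decay_const n mu C.
  rewrite /decay_const mulr_ge0 ?npow_ge0// mulr_ge0 ?exprn_ge0//.
  exact: le_trans C_ge1.
set A := 2 * (K * decay_const n mu C * pi ^+ n).
have -> : 2 * decay_const n mu C * pi ^+ n * K = A by rewrite /A; ring.
have A0 : 0 <= A.
  by rewrite /A mulr_ge0// mulr_ge0 ?exprn_ge0 ?pi_ge0// mulr_ge0.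
clearbody A; set r := decay_rate mu C in r0 *.
set a := mi_size alpha in bl *; set b := mi_size beta in bl *.
have -> : A * (bin_prod (mi_word alpha) beta)%:R * (2 * r) ^+ a * r ^+ b =
    A * ((bin_prod (mi_word alpha) beta)%:R * (2 * r) ^+ a * r ^+ b) by ring.
rewrite ler_wpM2l//.
have -> : (4 * r) ^+ (a + b) = 2 ^+ (a + b) * 2 ^+ (a + b) * r ^+ (a + b).
  by rewrite -!exprMn; congr (_ ^+ _); ring.
have -> : (bin_prod (mi_word alpha) beta)%:R * (2 * r) ^+ a * r ^+ b =
    (bin_prod (mi_word alpha) beta)%:R * 2 ^+ a * r ^+ (a + b).
  by rewrite exprMn exprD; ring.
rewrite ler_wpM2r ?exprn_ge0// ler_pM ?exprn_ge0//.
by rewrite ler_weXn2l ?leq_addr// ler1n.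
Qed.

End FourierRapid.

(** * Exponentials and factorials *)

Section ExponentialEstimates.
Variable R : realType.

Lemma pow_fact_le_expR (u : R) p : 0 <= u -> u ^+ p / p`!%:R <= expR u.
Proof.
move=> u0.
have nd : nondecreasing_seq (series (exp_coeff u)).
  by apply: nondecreasing_series => k _ _; rewrite /exp_coeff /= divr_ge0 ?exprn_ge0.
apply: le_trans (nondecreasing_cvgn_le nd (is_cvg_series_exp_coeff u) p.+1).
rewrite /series /= big_nat_recr //= lerDr sumr_ge0// => k _.
by rewrite divr_ge0 ?exprn_ge0.
Qed.

Lemma expRN_le_pow (u : R) p : 0 < u -> expR (- u) <= p`!%:R / u ^+ p.
Proof.
move=> u0; rewrite expRN -[leRHS]invf_div lef_pV2 ?posrE ?expR_gt0//.
  exact/pow_fact_le_expR/ltW.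
by rewrite divr_gt0 ?exprn_gt0// ltr0n fact_gt0.
Qed.

(** A converse to the previous bounds: summing the exponential series. *)
Lemma expR_half_le (Y u : R) : 0 <= Y -> 0 <= u ->
  (forall N, Y * u ^+ N <= N`!%:R) -> Y * expR (u / 2) <= 2.
Proof.
move=> Y0 u0 h.
have [->|Yn0] := eqVneq Y 0; first by rewrite mul0r.
have Yp : 0 < Y by rewrite lt_neqAle eq_sym Yn0.
rewrite -ler_pdivlMl//.
apply: limr_le; first exact: is_cvg_series_exp_coeff.
apply: nearW => N; rewrite ler_pdivlMl// /series /= mulr_sumr.
apply: (@le_trans _ _ (2 * (1 - 2^-1 ^+ N))); last first.
  by rewrite ler_piMr// gerBl exprn_ge0// invr_ge0.
elim: N => [|N IH]; first by rewrite big_nil expr0 subrr mulr0.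
rewrite big_nat_recr //=.
have -> : 2 * (1 - 2^-1 ^+ N.+1) = 2 * (1 - 2^-1 ^+ N) + 2^-1 ^+ N :> R.
  by rewrite exprS; field.
apply: lerD => //; rewrite /exp_coeff /= exprMn.
have F0 : 0 < N`!%:R :> R by rewrite ltr0n fact_gt0.
have -> : Y * (u ^+ N * 2^-1 ^+ N / N`!%:R) = Y * u ^+ N / N`!%:R * 2^-1 ^+ N.
  by ring.
by rewrite -[leRHS]mul1r ler_wpM2r ?exprn_ge0 ?invr_ge0// ler_pdivrMr// mul1r.
Qed.

End ExponentialEstimates.

(** * Gaussians *)

Section Gaussian.
Local Open Scope classical_set_scope.
Local Open Scope complex_scope.
Variables (R : realType) (n : nat).
Local Notation RB := (measurableTypeR R).
Local Notation leb := (lebesgue_tuple R n).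
Local Notation lam := (@lebesgue_measure R).
Local Notation wt := (@cauchy_weight R).
Implicit Types (x y xi : 'rV[R]_n) (c r : R).

Definition sqnorm x : R := \sum_j x 0 j ^+ 2.

(** Parametrized by the width r: the transform of the Gaussian of width r is
    the Gaussian of width r^-1. *)
Definition gauss r x : R := expR (- (r ^+ 2 *+ 2)^-1 * sqnorm x).

Definition gauss_mass r : R := Num.sqrt (r ^+ 2 * pi *+ 2) ^+ n.

Lemma sqnorm_ge0 x : 0 <= sqnorm x.
Proof. by apply: sumr_ge0 => i _; exact: sqr_ge0. Qed.

Lemma sqnorm_line x j (h : R) :
  sqnorm (x + h *: delta_mx 0 j) = sqnorm x + 2 * x 0 j * h + h ^+ 2.
Proof.
rewrite /sqnorm (bigD1 j)//= [in RHS](bigD1 j)//= !mxE !eqxx mulr1.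
under eq_bigr => i /negbTE ij do rewrite !mxE ij mulr0 addr0.
by rewrite /=; ring.
Qed.

Lemma is_derive_exp_sqnorm c x j :
  is_derive x (delta_mx 0 j) (fun y => expR (c * sqnorm y))
    (2 * c * x 0 j * expR (c * sqnorm x)).
Proof.
have -> : x = x + (0 : R) *: delta_mx 0 j by rewrite scale0r addr0.
apply: (is_derive_line (fun y => expR (c * sqnorm y)) x (delta_mx 0 j) 0 _).2.
have d : is_derive (0 : R) (1 : R)
    (fun h : R => c * sqnorm (x + h *: delta_mx 0 j)) (2 * c * x 0 j).
  rewrite (_ : (fun h : R => _) =
      (fun h : R => c * sqnorm x + 2 * c * x 0 j * h) + (fun h : R => c * (h * h))).
    have e := is_derive_affine (c * sqnorm x) (2 * c * x 0 j) 0.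
    have q := is_deriveZ c (is_deriveM (is_derive_id (0 : R) 1) (is_derive_id (0 : R) 1)).
    apply: (is_derive_eq (is_deriveD e q)).
    by rewrite /GRing.scale /=; ring.
  by apply/funext => h; rewrite sqnorm_line /= !fctE; ring.
have := @is_derive1_comp _ expR _ 0 _ _ (is_derive_expR _) d.
move=> /(@is_derive_eq _ _ _ _ _ _ _ _); apply.
by rewrite /= scale0r addr0; ring.
Qed.

Lemma gaussE r m (u : n.-tuple RB) : gauss r (row_of_tuple u - m) =
  tprod (fun j => normal_fun (m 0 j) r) u.
Proof.
rewrite /gauss /sqnorm mulr_sumr expR_sum; apply: eq_bigr => j _.
by rewrite /normal_fun !mxE; congr expR; rewrite mulrC !mulNr mulrN.
Qed.

Lemma integral_normal_fun m r : 0 < r ->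
  (\int[lam]_x (normal_fun m r x)%:E = (Num.sqrt (r ^+ 2 * pi *+ 2))%:E)%E.
Proof.
move=> r0; have rn0 : r != 0 by rewrite gt_eqF.
have p0 := normal_peak_gt0 rn0.
have := integral_normal_pdf m r; rewrite normal_pdfE//.
under eq_integral do rewrite EFinM.
rewrite ge0_integralZl_EFin//; last 3 first.
- by move=> x _; rewrite lee_fin normal_fun_ge0.
- by apply/measurable_EFinP; exact: measurable_normal_fun.
- exact: normal_peak_ge0.
have e : (1 = ((normal_peak r)^-1)%:E * (normal_peak r)%:E)%E.
  by rewrite -EFinM mulVf// gt_eqF.
by move=> h; rewrite -[LHS]mul1e e -muleA h mule1 invrK.
Qed.

Lemma integrable_normal_fun m r : 0 < r ->
  lam.-integrable setT (EFin \o normal_fun m r).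
Proof.
move=> r0; apply/integrableP; split.
  by apply/measurable_EFinP; exact: measurable_normal_fun.
under eq_integral => x _ do rewrite /= ger0_norm ?normal_fun_ge0//.
by rewrite integral_normal_fun// ltry.
Qed.

Lemma integrable_gauss m r : 0 < r ->
  leb.-integrable setT (EFin \o (fun u => gauss r (row_of_tuple u - m))).
Proof.
move=> r0; under eq_fun do rewrite /= gaussE.
apply: integrable_tprod => j.
- exact: measurable_normal_fun.
- by move=> x; exact: normal_fun_ge0.
- exact: integrable_normal_fun.
Qed.

Lemma Rintegral_gauss m r : 0 < r ->
  \int[leb]_u gauss r (row_of_tuple u - m) = gauss_mass r.
Proof.
move=> r0; rewrite /Rintegral; under eq_integral do rewrite gaussE.
rewrite (integral_tprod (W := fun=> Num.sqrt (r ^+ 2 * pi *+ 2))) /=.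
- by rewrite prodr_const card_ord.
- by move=> j; exact: measurable_normal_fun.
- by move=> j x; exact: normal_fun_ge0.
- by move=> j; exact: integral_normal_fun.
Qed.

Lemma gauss_le1 r x : gauss r x <= 1.
Proof.
rewrite -expR0 ler_expR mulNr oppr_le0 mulr_ge0 ?sqnorm_ge0// invr_ge0.
by rewrite mulrn_wge0// sqr_ge0.
Qed.

Lemma gauss_gt0 r x : 0 < gauss r x. Proof. exact: expR_gt0. Qed.

Definition gauss_bound r : R := ((1 + r ^+ 2 *+ 4) ^+ 2).

(** The square leaves room for a factor x_j next to the decay weight. *)
Lemma normal_fun_bound r (t : R) : 0 < r ->
  (1 + t ^+ 2) ^+ 2 * normal_fun 0 r t <= gauss_bound r.
Proof.
move=> r0.
have -> : normal_fun 0 r t = expR (- (t ^+ 2 / (r ^+ 2 *+ 4))) ^+ 2.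
  rewrite -expRM_natl /normal_fun subr0; congr expR.
  by field; rewrite gt_eqF.
have q0 : 0 < r ^+ 2 *+ 4 by rewrite mulrn_wgt0// exprn_gt0.
have t0 : 0 <= 1 + t ^+ 2 by rewrite addr_ge0 ?sqr_ge0.
have l0 : 0 <= 1 + r ^+ 2 *+ 4 by rewrite addr_ge0// ltW.
rewrite -exprMn /gauss_bound ler_pXn2r ?nnegrE ?mulr_ge0 ?expR_ge0//.
rewrite expRN ler_pdivrMr ?expR_gt0//.
apply: (@le_trans _ _ ((1 + r ^+ 2 *+ 4) * (1 + t ^+ 2 / (r ^+ 2 *+ 4)))).
  rewrite mulrDl mul1r mulrDr mulr1 mulrCA mulfV ?gt_eqF// mulr1.
  have a0 : 0 <= t ^+ 2 / (r ^+ 2 *+ 4) by rewrite divr_ge0 ?sqr_ge0// ltW.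
  lra.
by rewrite ler_wpM2l ?expR_ge1Dx// addr_ge0// ltW.
Qed.

Lemma gauss_decay_bound r x : 0 < r ->
  gauss r x * \prod_j (1 + x 0 j ^+ 2) ^+ 2 <= gauss_bound r ^+ n.
Proof.
move=> r0; rewrite /gauss /sqnorm mulr_sumr expR_sum -big_split /=.
have -> : gauss_bound r ^+ n = \prod_(j < n) gauss_bound r.
  by rewrite prodr_const card_ord.
apply: ler_prod => j _; rewrite mulr_ge0 ?expR_ge0 ?sqr_ge0//=.
rewrite mulrC; apply: le_trans (normal_fun_bound (x 0 j) r0).
rewrite le_eqVlt; apply/orP; left; apply/eqP; congr (_ * expR _).
by rewrite subr0 mulNr mulrC mulNr.
Qed.

Lemma decays_gauss r : 0 < r ->
  decays (gauss_bound r ^+ n) (fun x => (gauss r x)%:C : R[i]).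
Proof.
move=> r0 x; rewrite normc_real ger0_norm ?expR_ge0//.
rewrite /weight prodfV ler_pdivlMr; last first.
  by apply: prodr_gt0 => j _; exact: lt_le_trans (oneDsqr_ge1 _).
apply: le_trans (gauss_decay_bound x r0); rewrite ler_wpM2l ?expR_ge0//.
apply: ler_prod => j _; rewrite (le_trans ler01 (oneDsqr_ge1 _))/=.
by rewrite ler_eXnr// oneDsqr_ge1.
Qed.

Lemma decays_gauss_coord r j : 0 < r ->
  decays (gauss_bound r ^+ n) (fun x => (x 0 j)%:C * (gauss r x)%:C : R[i]).
Proof.
move=> r0 x; rewrite normcM !normc_real (ger0_norm (expR_ge0 _)).
rewrite /weight prodfV ler_pdivlMr; last first.
  by apply: prodr_gt0 => i _; exact: lt_le_trans (oneDsqr_ge1 _).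
apply: le_trans (gauss_decay_bound x r0).
rewrite mulrAC mulrC ler_wpM2l ?expR_ge0//.
rewrite (bigD1 j)//= [leRHS](bigD1 j)//= mulrA.
have o1 i : 1 <= 1 + x 0 i ^+ 2 := oneDsqr_ge1 _.
have o0 i : 0 <= 1 + x 0 i ^+ 2 by exact: le_trans (o1 i).
apply: ler_pM.
- by rewrite mulr_ge0.
- by apply: prodr_ge0 => i _; exact: o0.
- rewrite [leRHS]expr2 ler_wpM2r//.
  rewrite -[x 0 j ^+ 2]real_normK ?num_real//.
  have := sqr_ge0 (`|x 0 j| - 2^-1); nra.
- by apply: ler_prod => i _; rewrite o0/= ler_eXnr.
Qed.

Lemma measurable_sqnorm :
  measurable_fun setT (fun u : n.-tuple RB => sqnorm (row_of_tuple u)).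
Proof.
rewrite /sqnorm; apply: measurable_sum => j.
under eq_fun do rewrite mxE.
by apply: (measurable_funX 2); exact: (measurable_coord j).
Qed.

Lemma rmeasurable_exp_sqnorm c :
  rmeasurable (fun x => (expR (c * sqnorm x))%:C : R[i]).
Proof.
apply: cmeasurable_real; apply: measurableT_comp; first exact: measurable_expR.
by apply: measurable_funM; [exact: measurable_cst|exact: measurable_sqnorm].
Qed.

(** Move along the coordinate axes one at a time. *)
Lemma constant_of_partials (f : 'rV[R]_n -> R[i]) :
  (forall x j, is_cderive f x (delta_mx 0 j) 0) -> forall x, f x = f 0.
Proof.
move=> df.
have step x j (h : R) : f (x + h *: delta_mx 0 j) = f x.
  have d t : is_cderive (fun h : R => f (x + h *: delta_mx 0 j)) t 1 0.
    exact: (is_cderive_line _ _ _ _ _).1.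
  have -> : f x = f (x + 0 *: delta_mx 0 j) by rewrite scale0r addr0.
  apply: complex_ext.
  - apply: (@is_derive_0_is_cst _ (fun h : R => complex.Re (f (x + h *: delta_mx 0 j)))).
    by move=> t; have [] := d t.
  - apply: (@is_derive_0_is_cst _ (fun h : R => complex.Im (f (x + h *: delta_mx 0 j)))).
    by move=> t; have [] := d t.
move=> x; have -> : x = \sum_j x 0 j *: delta_mx 0 j by rewrite -row_sum_delta.
elim: (index_enum _) => [|j s IH]; first by rewrite big_nil.
by rewrite big_cons addrC step.
Qed.

(** The Fourier integral of a Gaussian solves the same differential equation
    as a Gaussian. *)
Lemma fourier_gauss s r xi : `|s| = 1 -> 0 < r ->
  fourier_int s (fun x => (gauss r x)%:C) xi =
  (gauss_mass r)%:C * (gauss r^-1 xi)%:C.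
Proof.
move=> s1 r0.
have rn0 : r != 0 by rewrite gt_eqF.
have s2 : s * s = 1 by rewrite -expr2 -real_normK ?num_real// s1 expr1n.
pose g x : R[i] := (gauss r x)%:C.
pose T := fourier_int s g.
have mg : rmeasurable g by exact: rmeasurable_exp_sqnorm.
have g1 := decays_gauss r0.
have mxg j : rmeasurable (fun x => (x 0 j)%:C * g x).
  apply: cmeasurableM mg; apply: cmeasurable_real.
  by under eq_fun do rewrite mxE; exact: (measurable_coord j).
have xg j := decays_gauss_coord j r0.
pose a : R := - (r ^+ 2)^-1.
pose dg j x : R[i] := a%:C * ((x 0 j)%:C * g x).
have gd j x : is_cderive g x (delta_mx 0 j) (dg j x).
  have := is_cderive_real (is_derive_exp_sqnorm (- (r ^+ 2 *+ 2)^-1) x j).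
  congr is_cderive; rewrite /dg /g -!rmorphM /=; congr (_%:C).
  by rewrite /gauss mulrA; congr (_ * _ * _); rewrite /a; field.
have dgd j : decays (`|a| * gauss_bound r ^+ n) (dg j).
  apply: (decaysM (a := fun=> a%:C) _ (xg j)) => //.
  by move=> x; rewrite normc_real.
have mdg j : rmeasurable (dg j).
  exact: (cmeasurableM (cmeasurable_cst _ _) (mxg j)).
have cdg j x : ccontinuous (fun h : R => dg j (x + h *: delta_mx 0 j)).
  apply: ccontinuousM; first exact: ccontinuous_cst.
  apply: ccontinuousM.
  - have -> : (fun h : R => ((x + h *: delta_mx 0 j : 'rV_n) 0 j)%:C) =
      (fun h : R => (x 0 j + 1 * h)%:C : R[i]).
      by apply/funext => h; rewrite !mxE !eqxx mulr1 mul1r.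
    apply: (ccontinuous_derivable (df := fun=> 1%:C)) => t.
    by apply: is_cderive_real; exact: is_derive_affine.
  - apply: ccontinuous_derivable => t.
    by apply: (is_cderive_line _ _ _ _ _).1; exact: gd.
have parts j y : fourier_int s (fun x => (x 0 j)%:C * g x) y =
    (r ^+ 2)%:C * ('i * (s * y 0 j)%:C) * T y.
  have := fourier_partial s y (gd j) (cdg j) mg (mdg j) g1 (dgd j).
  rewrite (fourierZ _ _ _ (mxg j) (xg j)) => E.
  apply: (mulfI (x := a%:C)).
    by rewrite fmorph_eq0 oppr_eq0 invr_eq0 sqrf_eq0.
  have ar : a%:C * (r ^+ 2)%:C = -1 :> R[i].
    by rewrite -rmorphM /a mulNr mulVf ?sqrf_eq0// rmorphN rmorph1.
  rewrite E -/(T y); transitivity ((a%:C * (r ^+ 2)%:C) * ('i * (s * y 0 j)%:C * T y)).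
    by rewrite ar mulN1r mulNr.
  by rewrite !mulrA.
have Td j y : is_cderive T y (delta_mx 0 j) ((- (r ^+ 2 * y 0 j))%:C * T y).
  have := is_cderive_fourier s y mg g1 (xg j).
  congr is_cderive.
  have -> : (fun x => 'i * s%:C * (x 0 j)%:C * g x) =
      (fun x => ('i * s%:C) * ((x 0 j)%:C * g x)).
    by apply/funext => x; rewrite !mulrA.
  rewrite (fourierZ _ _ _ (mxg j) (xg j)) parts.
  have -> : (- (r ^+ 2 * y 0 j))%:C = - ((r ^+ 2)%:C * (y 0 j)%:C) :> R[i].
    by rewrite rmorphN rmorphM.
  have -> : (s * y 0 j)%:C = s%:C * (y 0 j)%:C :> R[i] by rewrite rmorphM.
  have i2 : 'i * 'i = -1 :> R[i] by rewrite -expr2 sqr_i.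
  have s2C : s%:C * s%:C = 1 :> R[i] by rewrite -rmorphM s2.
  transitivity (('i * 'i) * (s%:C * s%:C) * ((r ^+ 2)%:C * (y 0 j)%:C) * T y).
    by ring.
  by rewrite i2 s2C mulr1 mulN1r.
pose q : R := r ^+ 2 / 2.
(* By Td this product has zero partial derivatives. *)
pose u y := T y * (expR (q * sqnorm y))%:C.
have ud y j : is_cderive u y (delta_mx 0 j) 0.
  have := is_cderiveM (Td j y) (is_cderive_real (is_derive_exp_sqnorm q y j)).
  congr is_cderive.
  have -> : 2 * q * y 0 j = r ^+ 2 * y 0 j by rewrite /q; field.
  by rewrite rmorphN (rmorphM _ (r ^+ 2 * y 0 j) (expR _)); ring.
have T0 : T 0 = (gauss_mass r)%:C.
  rewrite -(Rintegral_gauss 0 r0) /T /fourier_int.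
  have E (v : n.-tuple RB) : g (row_of_tuple v) *
      expi (s * (\sum_j (0 : 'rV[R]_n) 0 j * tnth v j)) = (gauss r (row_of_tuple v - 0))%:C.
    rewrite big1 ?mulr0 ?expi0 ?mulr1 ?subr0// => j _; by rewrite mxE mul0r.
  under [X in cintegral _ _ X]eq_fun do rewrite E.
  apply: complex_ext => //=.
  by rewrite -[RHS](mul0r (fine (leb setT))) -Rintegral_cst.
have := constant_of_partials ud xi; rewrite /u T0 -/T.
have sq0 : sqnorm 0 = 0 by rewrite /sqnorm big1// => j _; rewrite mxE expr0n.
rewrite sq0 mulr0 expR0 mulr1 => <-.
rewrite -mulrA -rmorphM -expRD.
have -> : q * sqnorm xi + - (r^-1 ^+ 2 *+ 2)^-1 * sqnorm xi = 0.
  by rewrite /q; field.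
by rewrite expR0 mulr1.
Qed.

End Gaussian.

(** * Fubini and Fourier inversion *)

Section ComplexFubini.
Local Open Scope classical_set_scope.
Local Open Scope complex_scope.
Context d1 d2 (T1 : measurableType d1) (T2 : measurableType d2) (R : realType).

(** Taking fine changes an integrable function only on the null set where it
    is infinite; inner integrals of real functions are of this form. *)
Lemma integral_fine d (T : measurableType d) (mu : {measure set T -> \bar R})
    (g : T -> \bar R) : mu.-integrable setT g ->
  (\int[mu]_x (fine (g x))%:E = \int[mu]_x g x)%E.
Proof.
move=> ig; have mg := measurable_int _ ig.
apply: ae_eq_integral => //.
  by apply/measurable_EFinP; apply: measurableT_comp => //; exact: fine_measurable.
have := integrable_ae measurableT ig.
apply: filterS => x /(_ I) gx _ /=; by rewrite fineK.
Qed.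

Lemma integrableDR d (T : measurableType d) (mu : {measure set T -> \bar R})
    (D : set T) (f g : T -> R) : measurable D ->
  mu.-integrable D (EFin \o f) -> mu.-integrable D (EFin \o g) ->
  mu.-integrable D (EFin \o (fun x => f x + g x)).
Proof.
move=> mD fi gi; rewrite (_ : _ \o _ = ((EFin \o f) \+ (EFin \o g))%E)//.
exact: integrableD.
Qed.

Lemma integrable_fine d (T : measurableType d) (mu : {measure set T -> \bar R})
    (g : T -> \bar R) : mu.-integrable setT g ->
  mu.-integrable setT (fun x => (fine (g x))%:E).
Proof.
move=> ig; have mg := measurable_int _ ig.
apply: (le_integrable measurableT _ _ ig).
  apply/measurable_EFinP; apply: measurableT_comp => //; exact: fine_measurable.
by move=> x _; case: (g x) => [r| |] /=; rewrite ?normr0 ?leey.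
Qed.

Variables (m1 : {sigma_finite_measure set T1 -> \bar R}).
Variables (m2 : {sigma_finite_measure set T2 -> \bar R}).

Lemma RintegralFubini12 (f : T1 * T2 -> R) :
  (m1 \x m2)%E.-integrable setT (EFin \o f) ->
  \int[m1]_x \int[m2]_y f (x, y) = \int[(m1 \x m2)%E]_p f p.
Proof.
move=> fi; rewrite /Rintegral; congr fine.
rewrite -integral12_prod_meas1//.
rewrite (integral_fine (g := fun x => (\int[m2]_y (f (x, y))%:E)%E))//.
exact: integrable_fubini_F fi.
Qed.

Lemma integrable_partial_integral (f : T1 * T2 -> R) :
  (m1 \x m2)%E.-integrable setT (EFin \o f) ->
  m2.-integrable setT (fun y => (\int[m1]_x (f (x, y))%:E)%E).
Proof.
move=> fi; have mf := measurable_int _ fi.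
apply/integrableP; split; first exact: measurable_fubini_G fi.
apply: le_lt_trans ((integrable21ltyP m1 m2 mf).1 fi).
apply: ge0_le_integral => //.
- by apply: measurableT_comp => //; exact: measurable_fubini_G fi.
- apply: (measurable_fun_fubini_tonelli_G (abse \o (EFin \o f))) => //=.
  exact: measurableT_comp.
- move=> y _; apply: le_abse_integral => //.
  exact: (measurableT_comp mf (pair2_measurable y)).
Qed.

Lemma RintegralFubini21 (f : T1 * T2 -> R) :
  (m1 \x m2)%E.-integrable setT (EFin \o f) ->
  \int[m2]_y \int[m1]_x f (x, y) = \int[(m1 \x m2)%E]_p f p.
Proof.
move=> fi; rewrite /Rintegral; congr fine.
rewrite -integral21_prod_meas1//.
rewrite (integral_fine (g := fun y => (\int[m1]_x (f (x, y))%:E)%E))//.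
exact: integrable_partial_integral.
Qed.

Lemma cFubini12 (f : T1 * T2 -> R[i]) : cintegrable (m1 \x m2)%E setT f ->
  cintegral m1 setT (fun x => cintegral m2 setT (fun y => f (x, y))) =
  cintegral (m1 \x m2)%E setT f.
Proof.
move=> [f1 f2]; apply: complex_ext => /=.
- exact: (RintegralFubini12 (f := fun p => complex.Re (f p))).
- exact: (RintegralFubini12 (f := fun p => complex.Im (f p))).
Qed.

Lemma cFubini21 (f : T1 * T2 -> R[i]) : cintegrable (m1 \x m2)%E setT f ->
  cintegral m2 setT (fun y => cintegral m1 setT (fun x => f (x, y))) =
  cintegral (m1 \x m2)%E setT f.
Proof.
move=> [f1 f2]; apply: complex_ext => /=.
- exact: (RintegralFubini21 (f := fun p => complex.Re (f p))).
- exact: (RintegralFubini21 (f := fun p => complex.Im (f p))).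
Qed.

Lemma cintegrable_partial_integral (f : T1 * T2 -> R[i]) :
  cintegrable (m1 \x m2)%E setT f ->
  cintegrable m2 setT (fun y => cintegral m1 setT (fun x => f (x, y))).
Proof.
by move=> [f1 f2]; split=> /=; apply: integrable_fine;
  [exact: (integrable_partial_integral f1)|exact: (integrable_partial_integral f2)].
Qed.

Lemma integrable_tensor (a : T1 -> R) (b : T2 -> R) :
  m1.-integrable setT (EFin \o a) -> m2.-integrable setT (EFin \o b) ->
  (m1 \x m2)%E.-integrable setT (EFin \o (fun p => a p.1 * b p.2)).
Proof.
move=> ia ib.
have ma : measurable_fun setT a by have /measurable_int/measurable_EFinP := ia.
have mb : measurable_fun setT b by have /measurable_int/measurable_EFinP := ib.
have mab : measurable_fun setT (fun p : T1 * T2 => a p.1 * b p.2).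
  by apply: measurable_funM; apply: measurableT_comp.
apply: (integrable12ltyP _ _ _).2; first exact/measurable_EFinP.
have /integrableP[_ fa] := ia; have /integrableP[_ fb] := ib.
under eq_integral => x _.
  under eq_integral => y _ do rewrite /= normrM EFinM.
  rewrite ge0_integralZl_EFin//; last exact: measurable_normE.
  over.
rewrite ge0_integralZr//.
- by rewrite lte_mul_pinfty//; [exact: integral_ge0|
    rewrite ge0_fin_numE//; exact: integral_ge0].
- exact: measurable_normE.
- exact: integral_ge0.
Qed.

End ComplexFubini.

Section Restriction.
Local Open Scope classical_set_scope.
Local Open Scope complex_scope.
Context d (T : measurableType d) (R : realType) (mu : {measure set T -> \bar R}).
Variable D : set T.
Hypothesis mD : measurable D.

Lemma cintegrable_mkcond (g : T -> R[i]) : cintegrable mu D g ->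
  cintegrable mu setT (fun p => (\1_D p)%:C * g p).
Proof.
move=> [g1 g2]; split.
- have := (integrable_mkcond _ mD).1 g1; congr (_.-integrable _ _).
  apply/funext => p; rewrite Re_mul /= mul0r subr0 patchE indicE.
  by case: ifP => _; rewrite ?mul1r ?mul0r.
- have := (integrable_mkcond _ mD).1 g2; congr (_.-integrable _ _).
  apply/funext => p; rewrite Im_mul /= mul0r addr0 patchE indicE.
  by case: ifP => _; rewrite ?mul1r ?mul0r.
Qed.

Lemma cintegral_mkcond (g : T -> R[i]) :
  cintegral mu D g = cintegral mu setT (fun p => (\1_D p)%:C * g p).
Proof.
apply: complex_ext => /=; rewrite /Rintegral integral_mkcond; congr fine;
  apply: eq_integral => p _; rewrite patchE indicE ?Re_mul ?Im_mul /=.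
- by case: ifP => _; rewrite ?mul1r ?mul0r ?subr0.
- by case: ifP => _; rewrite ?mul1r ?mul0r ?addr0.
Qed.

End Restriction.

Section Inversion.
Local Open Scope classical_set_scope.
Local Open Scope complex_scope.
Variables (R : realType) (n : nat).
Local Notation RB := (measurableTypeR R).
Local Notation leb := (lebesgue_tuple R n).
Implicit Types (x y xi : 'rV[R]_n) (r : R).

Lemma sqnormN x : sqnorm (- x) = sqnorm x.
Proof. by apply: eq_bigr => j _; rewrite mxE sqrrN. Qed.

Lemma gaussN r x : gauss r (- x) = gauss r x.
Proof. by rewrite /gauss sqnormN. Qed.

Lemma gauss_mass_gt0 r : 0 < r -> 0 < gauss_mass n r.
Proof.
move=> r0; rewrite exprn_gt0// sqrtr_gt0 mulrn_wgt0// mulr_gt0 ?pi_gt0//.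
by rewrite exprn_gt0.
Qed.

Variable f : 'rV[R]_n -> R[i].
Hypotheses (cf : ccontinuous f)
  (fi : cintegrable leb setT (fun u => f (row_of_tuple u))).

Let mf : rmeasurable f. Proof. exact: cintegrable_cmeasurable fi. Qed.

Let absf u : R := `|complex.Re (f (row_of_tuple u))| + `|complex.Im (f (row_of_tuple u))|.

Let iabsf : leb.-integrable setT (EFin \o absf).
Proof. exact: cintegrable_normc fi. Qed.

Local Notation F := (fourier_int (-1) f).

(** Multiplication formula: Fubini's theorem moves the Fourier transform from
    the Gaussian to the function. *)
Lemma gauss_multiplication r x : 0 < r ->
  (gauss_mass n r^-1)%:C *
    cintegral leb setT (fun u => f (row_of_tuple u) * (gauss r (row_of_tuple u - x))%:C) =
  cintegral leb setT (fun v => F (row_of_tuple v) * (gauss r^-1 (row_of_tuple v))%:C *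
    expi (1 * \sum_j x 0 j * tnth v j)).
Proof.
move=> r0; have r1 : 0 < r^-1 by rewrite invr_gt0.
pose e (u v : n.-tuple RB) : R[i] := expi (1 * \sum_j (x - row_of_tuple u) 0 j * tnth v j).
pose G (p : n.-tuple RB * n.-tuple RB) : R[i] :=
  f (row_of_tuple p.1) * (gauss r^-1 (row_of_tuple p.2))%:C * e p.1 p.2.
have eE u v : e u v = expi (-1 * \sum_j (row_of_tuple v : 'rV[R]_n) 0 j * tnth u j) *
    expi (1 * \sum_j x 0 j * tnth v j).
  rewrite -expiD /e; congr expi; rewrite mulN1r !mul1r -sumrN -big_split /=.
  by apply: eq_bigr => j _; rewrite !mxE; ring.
have mG : cmeasurable setT G.
  apply: cmeasurableM; first apply: cmeasurableM.
  - have [m1 m2] := mf; split; first exact: (measurableT_comp m1 measurable_fst).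
    exact: (measurableT_comp m2 measurable_fst).
  - have [m1 m2] := rmeasurable_exp_sqnorm n (- (r^-1 ^+ 2 *+ 2)^-1).
    split; first exact: (measurableT_comp m1 measurable_snd).
    exact: (measurableT_comp m2 measurable_snd).
  - apply: (cmeasurable_expi (f := fun p : n.-tuple RB * n.-tuple RB =>
      1 * \sum_j (x - row_of_tuple p.1) 0 j * tnth p.2 j)).
    apply: measurable_funM; first exact: measurable_cst.
    apply: measurable_sum => j; apply: measurable_funM.
      under eq_fun do rewrite !mxE.
      apply: measurable_funB; first exact: measurable_cst.
      exact: (measurableT_comp (measurable_coord j) measurable_fst).
    exact: (measurableT_comp (measurable_coord j) measurable_snd).
have ig := integrable_gauss (0 : 'rV[R]_n) r1.
have iG : cintegrable (leb \x leb)%E setT G.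
  apply: (cintegrable_le measurableT mG (integrable_tensor iabsf ig)) => -[u v] _.
  rewrite /G /= !normcM normc_expi mulr1 normc_real ger0_norm ?expR_ge0// subr0.
  by rewrite ler_wpM2r ?expR_ge0// normc_le_ReIm.
have := cFubini12 iG; rewrite -(cFubini21 iG).
have -> : cintegral leb setT (fun v => cintegral leb setT (fun u => G (u, v))) =
  cintegral leb setT (fun v => F (row_of_tuple v) * (gauss r^-1 (row_of_tuple v))%:C *
    expi (1 * \sum_j x 0 j * tnth v j)).
  apply: eq_cintegral => v _.
  have -> : (fun u => G (u, v)) = (fun u =>
     ((gauss r^-1 (row_of_tuple v))%:C * expi (1 * \sum_j x 0 j * tnth v j)) *
     (f (row_of_tuple u) * expi (-1 * \sum_j (row_of_tuple v : 'rV[R]_n) 0 j * tnth u j))).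
    by apply/funext => u; rewrite /G /= eE; ring.
  rewrite cintegralZ//; last exact: integrable_fourier_L1.
  by rewrite -/(fourier_int _ _ _); ring.
move=> <-.
rewrite -cintegralZ//; last first.
  apply: (cintegrable_le measurableT _ iabsf).
    apply: cmeasurableM => //; apply: cmeasurable_real.
    by have /measurable_int/measurable_EFinP := integrable_gauss x r0.
  move=> u _; rewrite normcM normc_real ger0_norm ?expR_ge0//.
  rewrite (le_trans _ (normc_le_ReIm _))// ler_piMr ?normc_ge0//.
  exact: gauss_le1.
apply: eq_cintegral => u _.
have -> : (fun v => G (u, v)) = (fun v => f (row_of_tuple u) *
   ((gauss r^-1 (row_of_tuple v))%:C * e u v)).
  by apply/funext => v; rewrite /G /=; ring.
rewrite cintegralZ//; last first.
  apply: (integrable_fourier 1 (x - row_of_tuple u)) (decays_gauss r1).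
  exact: rmeasurable_exp_sqnorm.
have := fourier_gauss (x - row_of_tuple u) (normr1 R) r1.
rewrite /fourier_int invrK -[x - _]opprB gaussN opprB => ->.
by ring.
Qed.

Lemma gauss_mass_inv r : 0 < r ->
  gauss_mass n r * gauss_mass n r^-1 = (2 * pi) ^+ n.
Proof.
move=> r0; rewrite /gauss_mass -exprMn -sqrtrM; last first.
  by rewrite mulrn_wge0// mulr_ge0 ?sqr_ge0 ?pi_ge0.
have -> : (r ^+ 2 * pi *+ 2) * (r^-1 ^+ 2 * pi *+ 2) = (2 * pi) ^+ 2.
  by field; rewrite gt_eqF.
by rewrite sqrtr_sqr ger0_norm// mulr_ge0// pi_ge0.
Qed.

Lemma gauss_mass_ge r : 0 < r -> r ^+ n <= gauss_mass n r.
Proof.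
move=> r0; rewrite /gauss_mass lerXn2r ?nnegrE ?sqrtr_ge0 ?(ltW r0)//.
rewrite -[leLHS](ger0_norm (ltW r0)) -sqrtr_sqr ler_wsqrtr//.
rewrite -mulrnAr ler_peMr ?sqr_ge0//.
have := pi_ge2 R; rewrite mulr2n; lra.
Qed.

Lemma gauss_mass_sqrt2 r : gauss_mass n (Num.sqrt 2 * r) = Num.sqrt 2 ^+ n * gauss_mass n r.
Proof.
rewrite /gauss_mass -exprMn -sqrtrM//; congr (Num.sqrt _ ^+ _).
by rewrite exprMn sqr_sqrtr//; ring.
Qed.

Lemma gauss_sqr r x : 0 < r ->
  gauss r x = gauss (Num.sqrt 2 * r) x * gauss (Num.sqrt 2 * r) x.
Proof.
move=> r0; rewrite /gauss -expRD exprMn sqr_sqrtr//; congr expR.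
by field; rewrite gt_eqF.
Qed.

Lemma norm_le_sqnorm x : `|x| <= Num.sqrt (sqnorm x).
Proof.
apply: row_norm_le => [|i]; first exact: sqrtr_ge0.
rewrite -sqrtr_sqr ler_wsqrtr// /sqnorm (bigD1 i)//= lerDl.
by apply: sumr_ge0 => j _; exact: sqr_ge0.
Qed.

Lemma ccontinuous_near x eta : 0 < eta ->
  exists2 delta, 0 < delta & forall y, `|y - x| < delta -> normc (f y - f x) <= eta.
Proof.
move=> eta0; have [c1 c2] := cf.
have e2 : 0 < eta / 2 by rewrite divr_gt0.
have /cvgrPdist_lt/(_ _ e2)/nbhs_normP[d1 /= d10 h1] := c1 x.
have /cvgrPdist_lt/(_ _ e2)/nbhs_normP[d2 /= d20 h2] := c2 x.
exists (Num.min d1 d2); first by rewrite lt_min d10.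
move=> y; rewrite lt_min => /andP[y1 y2].
rewrite (le_trans (normc_le_ReIm _))// !Re_add !Im_add !Re_opp !Im_opp.
rewrite [leRHS](splitr eta) lerD// ltW// distrC.
- by apply: h1; rewrite /= distrC.
- by apply: h2; rewrite /= distrC.
Qed.

(** Within distance d of x the oscillation of f is at most eta. Further away,
    writing the Gaussian of width r as the square of the one of width
    sqrt 2 r gains a factor exp (- d^2 / (4 r^2)), which is negligible compared
    with the mass, of order r^n. *)
Lemma gauss_approximation x eta : 0 < eta -> exists2 D, 0 <= D &
  forall r, 0 < r -> r <= 1 ->
    normc (f x - (gauss_mass n r)^-1%:C * cintegral leb setT
      (fun u => f (row_of_tuple u) * (gauss r (row_of_tuple u - x))%:C)) <=
    2 * eta + D * r.
Proof.
move=> eta0; have [d d0 hd] := ccontinuous_near x eta0.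
pose A := \int[leb]_u absf u.
have A0 : 0 <= A by apply: Rintegral_ge0 => u _; exact: addr_ge0.
(* The bound of exp (- u) by (n + 1)! / u^(n + 1) gives
   E <= c (r^(n + 1))^2, which is of smaller order than the mass. *)
pose c : R := n.+1`!%:R * (4 / d ^+ 2) ^+ n.+1.
have c0 : 0 <= c.
  by rewrite mulr_ge0// exprn_ge0// divr_ge0// exprn_ge0// ltW.
exists (2 * (c * (A + normc (f x) * Num.sqrt 2 ^+ n))).
  by rewrite mulr_ge0// mulr_ge0// addr_ge0// mulr_ge0 ?normc_ge0.
move=> r r0 r1.
pose r2 := Num.sqrt 2 * r; have r20 : 0 < r2 by rewrite mulr_gt0// sqrtr_gt0.
pose E := expR (- (d ^+ 2 / (4 * r ^+ 2))).
have M0 := gauss_mass_gt0 r0.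
have ig := integrable_gauss x r0; have ig2 := integrable_gauss x r20.
have mgau : measurable_fun setT (fun u : n.-tuple RB => gauss r (row_of_tuple u - x)).
  by have /measurable_int/measurable_EFinP := ig.
pose B u := eta * gauss r (row_of_tuple u - x) +
   E * (absf u + normc (f x) * gauss r2 (row_of_tuple u - x)).
have i3 := integrableZlR measurableT (normc (f x)) ig2.
have i4 := integrableDR measurableT iabsf i3.
have i5 := integrableZlR measurableT eta ig.
have i6 := integrableZlR measurableT E i4.
have iB : leb.-integrable setT (EFin \o B) := integrableDR measurableT i5 i6.
have BE : \int[leb]_u B u = eta * gauss_mass n r +
    E * (A + normc (f x) * gauss_mass n r2).
  rewrite /B RintegralD//.
  rewrite !RintegralZl// RintegralD// RintegralZl//.
  by rewrite (Rintegral_gauss x r0) (Rintegral_gauss x r20).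
pose h u := (f x - f (row_of_tuple u)) * (gauss r (row_of_tuple u - x))%:C.
have mh : cmeasurable setT h.
  apply: cmeasurableM; last exact: cmeasurable_real.
  have [q1 q2] := mf; split.
  - under eq_fun do rewrite Re_add Re_opp.
    by apply: measurable_funB => //; exact: measurable_cst.
  - under eq_fun do rewrite Im_add Im_opp.
    by apply: measurable_funB => //; exact: measurable_cst.
have hB u : normc (h u) <= B u.
  have g0 : 0 <= gauss r (row_of_tuple u - x) := ltW (gauss_gt0 _ _).
  have g20 : 0 <= gauss r2 (row_of_tuple u - x) := ltW (gauss_gt0 _ _).
  rewrite /h normcM normc_real (ger0_norm g0) /B.
  set y := row_of_tuple u in g0 g20 *.
  have q0 : 0 <= E * (absf u + normc (f x) * gauss r2 (y - x)).
    by rewrite mulr_ge0 ?expR_ge0// addr_ge0 ?addr_ge0// mulr_ge0 ?normc_ge0.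
  have [yx|yx] := ltP `|y - x| d.
    rewrite (le_trans _ (_ : eta * gauss r (y - x) <= _)) ?lerDl//.
    by rewrite ler_wpM2r// -opprB normcN hd.
  apply: (le_trans (y := E * (absf u + normc (f x) * gauss r2 (y - x)))); last first.
    by rewrite lerDr mulr_ge0// ltW.
  rewrite (gauss_sqr (y - x) r0) -/r2 mulrA mulrC ler_pM ?mulr_ge0 ?normc_ge0//.
    rewrite /gauss /E ler_expR mulNr lerN2 /r2 exprMn sqr_sqrtr//.
    have -> : (2 * r ^+ 2 *+ 2)^-1 * sqnorm (y - x) = sqnorm (y - x) / (4 * r ^+ 2).
      by field; rewrite gt_eqF.
    rewrite ler_wpM2r//; first by rewrite invr_ge0 mulr_ge0// exprn_ge0// ltW.
    have := le_trans yx (norm_le_sqnorm (y - x)).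
    move=> dy; rewrite -(sqr_sqrtr (sqnorm_ge0 (y - x))).
    by rewrite lerXn2r// nnegrE ?sqrtr_ge0// ltW.
  apply: (@le_trans _ _ ((normc (f x) + absf u) * gauss r2 (y - x))).
    rewrite ler_wpM2r// (le_trans (le_normcD _ _))// normcN lerD2l.
    exact: normc_le_ReIm.
  rewrite mulrDl addrC lerD2r ler_piMr ?addr_ge0//; exact: gauss_le1.
have key : f x - (gauss_mass n r)^-1%:C * cintegral leb setT
      (fun u => f (row_of_tuple u) * (gauss r (row_of_tuple u - x))%:C) =
   (gauss_mass n r)^-1%:C * cintegral leb setT h.
  have if1 : cintegrable leb setT (fun u => f x * (gauss r (row_of_tuple u - x))%:C).
    apply: cintegrableZ => //; split => //=; exact: integrable0.
  have if2 : cintegrable leb setT (fun u =>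
      f (row_of_tuple u) * (gauss r (row_of_tuple u - x))%:C).
    apply: (cintegrable_le measurableT _ iabsf).
      by apply: cmeasurableM => //; exact: cmeasurable_real.
    move=> u _; rewrite normcM normc_real ger0_norm ?expR_ge0//.
    rewrite (le_trans _ (normc_le_ReIm _))// ler_piMr ?normc_ge0//.
    exact: gauss_le1.
  have -> : cintegral leb setT h = f x * (gauss_mass n r)%:C - cintegral leb setT
      (fun u => f (row_of_tuple u) * (gauss r (row_of_tuple u - x))%:C).
    rewrite -[- cintegral _ _ _]mulN1r -cintegralZ//.
    have -> : f x * (gauss_mass n r)%:C = cintegral leb setT
        (fun u => f x * (gauss r (row_of_tuple u - x))%:C).
      rewrite cintegralZ//; last by split => //=; exact: integrable0.
      congr (_ * _); apply: complex_ext => /=; first by rewrite Rintegral_gauss.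
      by rewrite -[LHS](mul0r (fine (leb setT))) -Rintegral_cst.
    rewrite -cintegralD//; last exact: cintegrableZ.
    by apply: eq_cintegral => u _; rewrite /h; ring.
  rewrite mulrBr mulrCA -rmorphM mulVf ?gt_eqF// rmorph1 mulr1 //.
rewrite key normcM normc_real ger0_norm ?invr_ge0 ?(ltW M0)//.
have hle : normc (cintegral leb setT h) <= 2 * \int[leb]_u B u.
  by apply: normc_cintegral_le => // u _; exact: hB.
rewrite BE in hle.
rewrite mulrC ler_pdivrMr//; apply: (le_trans hle).
have r2n : gauss_mass n r2 = Num.sqrt 2 ^+ n * gauss_mass n r by exact: gauss_mass_sqrt2.
have Ec : E <= c * (r ^+ n.+1) ^+ 2.
  have u0 : 0 < d ^+ 2 / (4 * r ^+ 2).
    by rewrite divr_gt0 ?mulr_gt0 ?exprn_gt0.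
  apply: (le_trans (expRN_le_pow n.+1 u0)).
  have e3 : (d ^+ 2 / (4 * r ^+ 2))^-1 = (4 / d ^+ 2) * r ^+ 2.
    by field; rewrite !gt_eqF.
  by rewrite -exprVn e3 exprMn mulrA -!exprM [(2 * _)%N]mulnC.
have rn0 k : 0 <= r ^+ k by rewrite exprn_ge0// ltW.
have rk1 k : r ^+ k <= 1 by rewrite exprn_ile1// ltW.
have E0 : 0 <= E by exact: expR_ge0.
have rr : r ^+ n.+1 ^+ 2 = r * ((r * r ^+ n) * r ^+ n) by rewrite (exprS r n) expr2; ring.
have EM : E <= c * r * gauss_mass n r.
  apply: (le_trans Ec); rewrite -[leRHS]mulrA; apply: ler_wpM2l => //; rewrite rr.
  apply: ler_wpM2l; first exact: ltW.
  apply: le_trans (gauss_mass_ge r0); apply: ler_piMl => //.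
  by apply: mulr_ile1 => //; exact: ltW.
have E1 : E <= c * r.
  apply: (le_trans Ec); apply: ler_wpM2l => //; rewrite rr.
  apply: ler_piMr; first exact: ltW.
  have rl : r * r ^+ n <= 1 by apply: mulr_ile1 => //; exact: ltW.
  by apply: mulr_ile1 => //; apply: mulr_ge0 => //; exact: ltW.
rewrite r2n [leRHS](_ : _ = 2 * (eta * gauss_mass n r +
    (c * r * gauss_mass n r * A +
     c * r * (normc (f x) * (Num.sqrt 2 ^+ n * gauss_mass n r))))); last by ring.
apply: ler_wpM2l => //; rewrite lerD2l mulrDr; apply: lerD; apply: ler_wpM2r => //.
apply: mulr_ge0; first exact: normc_ge0.
by apply: mulr_ge0; [rewrite exprn_ge0// sqrtr_ge0|exact: ltW].
Qed.

Variable K : R.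
Hypotheses (mF : rmeasurable F) (FK : decays K F)
  (FK2 : decays K (fun xi => (sqnorm xi)%:C * F xi)).

(** Regularize by Gaussians and let their width tend to zero. On the transform
    side the error is controlled by the squared norm times the transform. *)
Theorem fourier_inversion x : f x = ((2 * pi) ^- n)%:C * fourier_int 1 F x.
Proof.
have K0 := decays_ge0 FK.
apply/eqP; rewrite -subr_eq0; apply/eqP/eq0_normc; apply/eqP.
rewrite eq_le normc_ge0 andbT.
have P0 : 0 < (2 * pi) ^+ n :> R by rewrite exprn_gt0// mulr_gt0// pi_gt0.
apply/ler_addgt0Pr => eta' eta'0; rewrite add0r.
pose eta := eta' / 3; have eta0 : 0 < eta by rewrite divr_gt0.
have [D D0 hD] := gauss_approximation x eta0.
pose L := D + ((2 * pi) ^- n) * (2 * (K * pi ^+ n)).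
have L0 : 0 <= L.
  rewrite addr_ge0// mulr_ge0 ?invr_ge0 ?(ltW P0)// mulr_ge0// mulr_ge0//.
  by rewrite exprn_ge0// pi_ge0.
have L1 : 0 < 1 + L by rewrite ltr_pwDl.
have [N _ /(_ N (leqnn _)) /= hN] := near_infty_natSinv_lt (PosNum (divr_gt0 eta0 L1)).
pose r : R := N.+1%:R^-1.
have r0 : 0 < r by rewrite invr_gt0.
have r1 : r <= 1 by rewrite invf_le1// ler1n.
have Lr : L * r <= eta.
  move: hN; rewrite ltr_pdivlMr// => /ltW; apply: le_trans.
  by rewrite mulrC ler_wpM2l ?(ltW r0)// lerDr.
have M0 := gauss_mass_gt0 r0.
have MV0 : 0 < gauss_mass n r^-1 by rewrite gauss_mass_gt0// invr_gt0.
set J := cintegral leb setT (fun u => f (row_of_tuple u) *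
   (gauss r (row_of_tuple u - x))%:C) in hD.
have := hD r r0 r1; rewrite -/J => hDr.
have := gauss_multiplication x r0.
rewrite -/J; set Q := (X in _ = X) => JE.
rewrite -[X in X - _](subrK ((gauss_mass n r)^-1%:C *
  cintegral leb setT (fun u => f (row_of_tuple u) *
   (gauss r (row_of_tuple u - x))%:C))) -/J -addrA.
apply: (le_trans (le_normcD _ _)).
have e1 : (gauss_mass n r)^-1%:C * J = ((2 * pi) ^- n)%:C * Q.
  rewrite -JE mulrA -rmorphM; congr (_ * _); congr (_%:C).
  by rewrite -(gauss_mass_inv r0) invfM -mulrA mulVf ?mulr1// gt_eqF.
have d1 : normc (Q - fourier_int 1 F x) <= 2 * (K * pi ^+ n) * r.
  have iF : cintegrable leb setT (fun v => F (row_of_tuple v) *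
    expi (1 * \sum_j x 0 j * tnth v j)) by exact: integrable_fourier FK.
  have mgau := rmeasurable_exp_sqnorm n (- (r^-1 ^+ 2 *+ 2)^-1).
  have mI : cmeasurable setT (fun v => F (row_of_tuple v) * (gauss r^-1 (row_of_tuple v))%:C *
    expi (1 * \sum_j x 0 j * tnth v j)).
    apply: cmeasurableM; first exact: cmeasurableM.
    by apply: cmeasurable_expi; exact: measurable_dot.
  have iFg : cintegrable leb setT (fun v => F (row_of_tuple v) * (gauss r^-1 (row_of_tuple v))%:C *
    expi (1 * \sum_j x 0 j * tnth v j)).
    apply: (cintegrable_le _ _ (integrable_weight n K)) => // v _.
    rewrite !normcM normc_expi mulr1 normc_real ger0_norm ?expR_ge0// -weight_row.
    apply: le_trans (FK _); rewrite ler_piMr ?normc_ge0//; exact: gauss_le1.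
  rewrite -[- fourier_int 1 F x]mulN1r /Q /fourier_int -cintegralZ// -cintegralD//; last exact: cintegrableZ.
  rewrite -mulrA -[K * _ * r]mulrAC -Rintegral_weight.
  apply: normc_cintegral_le => //.
  - apply: cmeasurableD => //; apply: cmeasurableM; first exact: cmeasurable_cst.
    exact: (cintegrable_cmeasurable iF).
  - exact: integrable_weight.
  - move=> v _; set y := row_of_tuple v.
    have -> : F y * (gauss r^-1 y)%:C * expi (1 * \sum_j x 0 j * tnth v j) +
       -1 * (F y * expi (1 * \sum_j x 0 j * tnth v j)) =
       (gauss r^-1 y - 1)%:C * F y * expi (1 * \sum_j x 0 j * tnth v j).
      by rewrite rmorphB rmorph1; ring.
    rewrite !normcM normc_expi mulr1 normc_real -weight_row -/y.
    rewrite distrC ger0_norm ?subr_ge0 ?gauss_le1//.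
    apply: (@le_trans _ _ (r * (sqnorm y * normc (F y)))).
      rewrite mulrA ler_wpM2r ?normc_ge0// lerBlDr -lerBlDl.
      rewrite /gauss; apply: le_trans (expR_ge1Dx _); rewrite lerD2l mulNr lerN2.
      rewrite ler_wpM2r ?sqnorm_ge0//.
      have -> : (r^-1 ^+ 2 *+ 2)^-1 = r * (r / 2).
        by field; rewrite gt_eqF.
      by rewrite ler_piMr ?(ltW r0)//; lra.
    rewrite [K * r]mulrC -mulrA ler_wpM2l ?(ltW r0)//.
    by have := FK2 y; rewrite normcM normc_real ger0_norm ?sqnorm_ge0.
rewrite e1 -mulrBr normcM normc_real ger0_norm ?invr_ge0 ?(ltW P0)//.
apply: (@le_trans _ _ (2 * eta + D * r + (2 * pi) ^- n * (2 * (K * pi ^+ n) * r))).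
  apply: lerD; last by rewrite ler_wpM2l// invr_ge0 ltW.
  by rewrite -e1.
have -> : eta' = 2 * eta + eta by rewrite /eta; field.
rewrite -addrA lerD2l; apply: le_trans Lr.
by rewrite /L [leRHS]mulrDl -[in leRHS]mulrA.
Qed.

End Inversion.

(** * Fourier coefficients over the period cell *)

Section TorusCoefficients.
Local Open Scope classical_set_scope.
Local Open Scope complex_scope.
Variables (R : realType) (m : nat).
Local Notation RB := (measurableTypeR R).
Local Notation leb := (lebesgue_tuple R m).

Definition cell : set (m.-tuple RB) :=
  [set u | forall i, 0 <= (tnth u i : R) <= 2 * pi].

Definition torus_character (k : 'rV[int]_m) (t : 'rV[R]_m) : R[i] :=
  expi (- \sum_i (k 0 i)%:~R * t 0 i).

Definition torus_coef (k : 'rV[int]_m) (h : 'rV[R]_m -> R[i]) : R[i] :=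
  ((2 * pi) ^- m)%:C * cintegral leb cell
    (fun u => h (row_of_tuple u) * torus_character k (row_of_tuple u)).

Definition cell_weight (x : R) : R := \1_(`[0, 2 * pi]%classic) x.

Lemma measurable_cell : measurable cell.
Proof.
have -> : cell = \bigcap_(i in [set: 'I_m])
    (fun u : m.-tuple RB => tnth u i : R) @^-1` `[0, 2 * pi].
  apply/seteqP; split => [u h i _|u h i]; first by rewrite /= in_itv/= h.
  by have := h i I; rewrite /= in_itv/=.
apply: fin_bigcap_measurable => // i _.
rewrite -[X in measurable X]setTI.
exact: (measurable_coord i).
Qed.

Lemma cell_indic u : \1_cell u = tprod (fun=> cell_weight) u :> R.
Proof.
rewrite indicE; have [/set_mem h|/negP h] := boolP (u \in cell).
  rewrite /tprod big1// => i _; rewrite /cell_weight indicE mem_set//.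
  by rewrite /= in_itv/= h.
have [i hi] : exists i, ~~ (0 <= (tnth u i : R) <= 2 * pi).
  by apply: contrapT => /forallNP H; apply: h; rewrite mem_set//= => i; apply/negPn/negP.
by rewrite /tprod (bigD1 i)//= /cell_weight indicE memNset ?mul0r//= in_itv/=; exact/negP.
Qed.

Lemma integral_cell_weight : (\int[lebesgue_measure]_x (cell_weight x)%:E)%E = (2 * pi : R)%:E.
Proof.
rewrite integral_indic//= setIT lebesgue_measure_itv/= lte_fin mulr_gt0 ?pi_gt0//.
by rewrite oppr0 adde0.
Qed.

Lemma cell_weight_ge0 x : 0 <= cell_weight x.
Proof. by rewrite /cell_weight indicE ler0n. Qed.

Lemma measurable_cell_weight : measurable_fun setT cell_weight.
Proof. exact: measurable_indic. Qed.

Lemma integrable_cell_weight :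
  (@lebesgue_measure R).-integrable setT (EFin \o cell_weight).
Proof.
apply/integrableP; split; first by apply/measurable_EFinP; exact: measurable_cell_weight.
under eq_integral => x _ do rewrite /= ger0_norm ?cell_weight_ge0//.
by rewrite integral_cell_weight ltry.
Qed.

Lemma cell_measure : leb cell = ((2 * pi) ^+ m)%:E.
Proof.
rewrite -[in LHS](setIT cell) -(integral_indic leb measurableT measurable_cell).
under eq_integral => u _ do rewrite cell_indic.
rewrite (integral_tprod (W := fun=> 2 * pi)).
- by rewrite prodr_const card_ord.
- by move=> i; exact: measurable_cell_weight.
- by move=> i x; exact: cell_weight_ge0.
- by move=> i; exact: integral_cell_weight.
Qed.

Lemma integrable_cell_cst (c : R) : leb.-integrable cell (EFin \o (fun=> c)).
Proof.
apply/integrableP; split; first by apply/measurable_EFinP; exact: measurable_cst.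
rewrite /comp integral_cst//=; last exact: measurable_cell.
by rewrite cell_measure ltry.
Qed.

Lemma Rintegral_cell_cst (c : R) : \int[leb]_(u in cell) c = c * (2 * pi) ^+ m.
Proof.
have e : fine (leb cell) = (2 * pi) ^+ m by rewrite cell_measure.
rewrite -e; apply: Rintegral_cst; exact: measurable_cell.
Qed.

Lemma cell_size_gt0 : 0 < (2 * pi) ^+ m :> R.
Proof. by rewrite exprn_gt0// mulr_gt0// pi_gt0. Qed.

(** The factor 2 is that of normc_cintegral_le. *)
Lemma normc_average_le g (B : m.-tuple RB -> R) : cmeasurable cell g ->
  leb.-integrable cell (EFin \o B) -> (forall u, cell u -> normc (g u) <= B u) ->
  normc (((2 * pi) ^- m)%:C * cintegral leb cell g) <=
    2 * ((2 * pi) ^- m * \int[leb]_(u in cell) B u).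
Proof.
move=> mg iB gB; rewrite normcM normc_real ger0_norm ?invr_ge0 ?(ltW cell_size_gt0)//.
rewrite mulrCA ler_wpM2l ?invr_ge0 ?(ltW cell_size_gt0)//.
by apply: normc_cintegral_le => //; exact: measurable_cell.
Qed.

Lemma average_cst (c : R) : (2 * pi) ^- m * \int[leb]_(u in cell) c = c.
Proof. by rewrite Rintegral_cell_cst mulrC mulfK// gt_eqF// cell_size_gt0. Qed.

Lemma normc_torus_character k t : normc (torus_character k t) = 1.
Proof. exact: normc_expi. Qed.

Lemma measurable_torus_character k :
  cmeasurable cell (fun u => torus_character k (row_of_tuple u)).
Proof.
apply: cmeasurable_expi.
apply: (measurable_funTS (f := fun u : m.-tuple RB => - \sum_i (k 0 i)%:~R * row_of_tuple u 0 i)).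
have := measurable_dot (\row_i (k 0 i)%:~R : 'rV[R]_m) (-1).
congr (measurable_fun _ _); apply/funext => u; rewrite mulN1r; congr (- _).
by apply: eq_bigr => i _; rewrite !mxE.
Qed.

Lemma cell_row (u : m.-tuple RB) : cell u -> forall i, 0 <= row_of_tuple u 0 i <= 2 * pi.
Proof. by move=> cu i; rewrite mxE. Qed.

Lemma ccontinuous_rmeasurable n (h : 'rV[R]_n -> R[i]) : ccontinuous h -> rmeasurable h.
Proof.
by move=> [h1 h2]; split; [exact: (measurable_continuous_row h1)|
  exact: (measurable_continuous_row h2)].
Qed.

Lemma rmeasurable_cell (h : 'rV[R]_m -> R[i]) : rmeasurable h ->
  cmeasurable cell (fun u => h (row_of_tuple u)).
Proof.
by move=> [h1 h2]; split; apply: measurable_funTS.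
Qed.

Lemma normc_torus_coef_le k h B : rmeasurable h ->
  (forall t, normc (h t) <= B) -> normc (torus_coef k h) <= 2 * B.
Proof.
move=> mh hB; rewrite -[in leRHS](average_cst B); apply: normc_average_le.
- by apply: cmeasurableM; [exact: rmeasurable_cell|exact: measurable_torus_character].
- exact: integrable_cell_cst.
- by move=> u _; rewrite normcM normc_torus_character mulr1.
Qed.

End TorusCoefficients.

(** * Coefficients of slices *)

Section Slices.
Local Open Scope classical_set_scope.
Local Open Scope complex_scope.
Variables (R : realType) (m n : nat).
Local Notation space := ('rV[R]_m * 'rV[R]_n)%type.
Implicit Types (f : space -> R[i]) (t : 'rV[R]_m) (x : 'rV[R]_n).

Definition in_cell t := forall i, 0 <= t 0 i <= 2 * pi.

Lemma compact_cell : compact [set t | in_cell t].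
Proof.
have := @rV_compact R m (fun=> `[0, 2 * pi]%classic) (fun=> @segment_compact R _ _).
by congr compact; apply/seteqP; split => t h i; have := h i; rewrite /= in_itv/=.
Qed.

Lemma compact_unit_box x0 : compact [set x : 'rV[R]_n | forall j, `|x 0 j - x0 0 j| <= 1].
Proof.
have := @rV_compact R n (fun j => `[x0 0 j - 1, x0 0 j + 1]%classic)
  (fun=> @segment_compact R _ _).
by congr compact; apply/seteqP; split => x h i; have := h i;
  rewrite /= in_itv/= ler_distl.
Qed.

Lemma continuous_bounded_on (T : topologicalType) (g : T -> R) (A : set T) :
  continuous g -> compact A -> exists B : R, forall p, A p -> `|g p| <= B.
Proof.
move=> cg cA.
have : compact (g @` A).
  by apply: continuous_compact => //; exact: continuous_subspaceT.
move=> /compact_bounded[M [_ hM]]; exists (M + 1) => p Ap.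
by apply: (hM _ (ltr_pwDr ltr01 (lexx _))); exists p.
Qed.

Lemma bounded_on_boxes f x0 : ccontinuous f -> exists B : R, forall t x,
  in_cell t -> (forall j, `|x 0 j - x0 0 j| <= 1) -> normc (f (t, x)) <= B.
Proof.
move=> [c1 c2].
have cA := compact_setX compact_cell (@compact_unit_box x0).
have [B1 h1] := continuous_bounded_on c1 cA.
have [B2 h2] := continuous_bounded_on c2 cA.
exists (B1 + B2) => t x ct cx; rewrite (le_trans (normc_le_ReIm _))// lerD//.
- exact: (h1 (t, x)).
- exact: (h2 (t, x)).
Qed.

(** Tube lemma: slices over the compact cell vary uniformly. *)
Lemma slices_equicontinuous (g : space -> R) x0 eta : continuous g -> 0 < eta ->
  \forall x \near x0, forall t, in_cell t -> `|g (t, x) - g (t, x0)| <= eta.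
Proof.
move=> cg eta0.
have := (compact_near_coveringP _).1 compact_cell _ (nbhs x0)
  (fun x t => `|g (t, x) - g (t, x0)| <= eta) _.
apply => t _.
have e2 : 0 < eta / 2 by rewrite divr_gt0.
have /cvgrPdist_le/(_ _ e2)[[U V] /= [nU nV] UV] := cg (t, x0).
exists (U, V) => //= -[t' x] /= [Ut Vx].
have := UV (t', x) (conj Ut Vx) => /= h1.
have := UV (t', x0) (conj Ut (nbhs_singleton nV)) => /= h2.
rewrite [leRHS](splitr eta) -[g (t', x) - _](subrKA (g (t, x0))).
rewrite (le_trans (ler_normD _ _))// lerD// distrC//.
Qed.


Local Notation leb := (lebesgue_tuple R m).

Lemma continuous_slice (g : space -> R) x : continuous g ->
  continuous (fun t => g (t, x)).
Proof.
move=> cg t; apply: (@continuous_comp _ _ _ (fun t' => (t', x)) g t); last exact: cg.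
exact: (@cvg_pair _ _ _ (nbhs t) (nbhs t) (nbhs x) _ _ _ id (fun=> x) cvg_id (cvg_cst x)).
Qed.

Lemma ccontinuous_slice f x : ccontinuous f -> ccontinuous (fun t => f (t, x)).
Proof. by move=> [c1 c2]; split; [exact: (continuous_slice c1)|exact: (continuous_slice c2)]. Qed.

Lemma integrable_coef k (h : 'rV[R]_m -> R[i]) : ccontinuous h ->
  cintegrable leb (@cell R m) (fun u => h (row_of_tuple u) * torus_character k (row_of_tuple u)).
Proof.
move=> ch; have [c1 c2] := ch.
have [B1 h1] := continuous_bounded_on c1 compact_cell.
have [B2 h2] := continuous_bounded_on c2 compact_cell.
apply: (cintegrable_le _ _ (integrable_cell_cst m (B1 + B2))).
- exact: measurable_cell.
- by apply: cmeasurableM; [exact/rmeasurable_cell/ccontinuous_rmeasurable|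
    exact: measurable_torus_character].
- move=> u cu; rewrite normcM normc_torus_character mulr1.
  rewrite (le_trans (normc_le_ReIm _))// lerD//.
    by apply: h1; exact: cell_row.
  by apply: h2; exact: cell_row.
Qed.

Lemma torus_coefD k (g h : 'rV[R]_m -> R[i]) : ccontinuous g -> ccontinuous h ->
  torus_coef k (fun t => g t + h t) = torus_coef k g + torus_coef k h.
Proof.
move=> cg ch; rewrite /torus_coef -mulrDr; congr (_ * _).
rewrite -cintegralD; [|exact: measurable_cell|exact: integrable_coef|exact: integrable_coef].
by apply: eq_cintegral => u _; rewrite mulrDl.
Qed.

Lemma torus_coefZ k c (h : 'rV[R]_m -> R[i]) : ccontinuous h ->
  torus_coef k (fun t => c * h t) = c * torus_coef k h.
Proof.
move=> ch; rewrite /torus_coef mulrCA; congr (_ * _).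
rewrite -cintegralZ; [|exact: measurable_cell|exact: integrable_coef].
by apply: eq_cintegral => u _; rewrite mulrA.
Qed.

Lemma normc_torus_coef_le_cell k (h : 'rV[R]_m -> R[i]) B : ccontinuous h ->
  (forall t, in_cell t -> normc (h t) <= B) -> normc (torus_coef k h) <= 2 * B.
Proof.
move=> ch hB; rewrite -[in leRHS](average_cst m B); apply: normc_average_le.
- by apply: cmeasurableM; [exact/rmeasurable_cell/ccontinuous_rmeasurable|
    exact: measurable_torus_character].
- exact: integrable_cell_cst.
- move=> u cu; rewrite normcM normc_torus_character mulr1.
  by apply: hB; exact: cell_row.
Qed.

Definition slice_coef k f x := torus_coef k (fun t => f (t, x)).

Lemma continuous_normc_near (V : normedModType R) (F : V -> R[i]) (c : R) : 0 < c ->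
  (forall (x0 : V) (eta : R), 0 < eta ->
     \forall x \near x0, normc (F x - F x0) <= c * eta) ->
  ccontinuous F.
Proof.
move=> c0 H; split=> x0; apply/cvgrPdist_le => e e0;
  have ec : 0 < e / c by rewrite divr_gt0.
- apply: filterS (H x0 _ ec) => x; rewrite mulrC mulfVK ?gt_eqF// distrC.
  by apply: le_trans; rewrite -Re_opp -Re_add; exact: Re_le_normc.
- apply: filterS (H x0 _ ec) => x; rewrite mulrC mulfVK ?gt_eqF// distrC.
  by apply: le_trans; rewrite -Im_opp -Im_add; exact: Im_le_normc.
Qed.

Lemma ccontinuous_slice_coef k f : ccontinuous f -> ccontinuous (slice_coef k f).
Proof.
move=> cf; apply: (@continuous_normc_near _ _ 4) => // x0 eta eta0; have [c1 c2] := cf.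
have n1 := slices_equicontinuous x0 c1 eta0.
have n2 := slices_equicontinuous x0 c2 eta0.
near=> x.
have m1 : forall t, in_cell t -> `|complex.Re (f (t, x)) - complex.Re (f (t, x0))| <= eta.
  by near: x.
have m2 : forall t, in_cell t -> `|complex.Im (f (t, x)) - complex.Im (f (t, x0))| <= eta.
  by near: x.
have cx := ccontinuous_slice x cf; have cx0 := ccontinuous_slice x0 cf.
have cN : ccontinuous (fun t => -1 * f (t, x0)).
  by apply: ccontinuousM => //; exact: ccontinuous_cst.
rewrite /slice_coef -mulN1r -torus_coefZ// -torus_coefD//.
have -> : 4 * eta = 2 * (eta + eta) by ring.
apply: normc_torus_coef_le_cell; first exact: ccontinuousD.
move=> t ct; rewrite (le_trans (normc_le_ReIm _))// mulN1r Re_add Im_add Re_opp Im_opp.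
by rewrite lerD// ?m1// m2.
Unshelve. all: by end_near. Qed.

Lemma is_cderive_slice f t x j l :
  is_cderive f (t, x) (@direction R m n (inr j)) l <->
  is_cderive (fun x' => f (t, x')) x (delta_mx 0 j) l.
Proof.
have E : (fun h : R => f ((t, x) + h *: @direction R m n (inr j))) =
    (fun h : R => f (t, x + h *: delta_mx 0 j)).
  by apply/funext => h; congr (f (_, _)) => /=; rewrite scaler0 addr0.
split=> H.
- apply: (is_cderive_line0 (fun x' => f (t, x')) x _ l).2; rewrite -E.
  exact: (is_cderive_line0 f (t, x) _ l).1.
- apply: (is_cderive_line0 f (t, x) _ l).2; rewrite E.
  exact: (is_cderive_line0 (fun x' => f (t, x')) x _ l).1.
Qed.

(** Differentiation under the integral sign over the compact cell. *)
Lemma is_cderive_slice_coef k f df x j :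
  ccontinuous f -> ccontinuous df ->
  (forall p, is_cderive f p (@direction R m n (inr j)) (df p)) ->
  is_cderive (slice_coef k f) x (delta_mx 0 j) (slice_coef k df x).
Proof.
move=> cf cdf fd; apply: is_cderiveZ.
have [B hB] := bounded_on_boxes x cdf.
pose phi (h : R) (u : m.-tuple (measurableTypeR R)) :=
  f (row_of_tuple u, x + h *: delta_mx 0 j) * torus_character k (row_of_tuple u).
pose dphi (h : R) (u : m.-tuple (measurableTypeR R)) :=
  df (row_of_tuple u, x + h *: delta_mx 0 j) * torus_character k (row_of_tuple u).
have H : is_cderive (fun h : R => cintegral leb (@cell R m) (phi h)) 0 1
    (cintegral leb (@cell R m) (dphi 0)); last first.
  rewrite /dphi scale0r addr0 in H.
  exact: (is_cderive_line0 _ x (delta_mx 0 j) _).2 H.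
apply: (is_cderive_under_integral (G := fun=> `|B|)).
- exact: measurable_cell.
- move=> h _; exact: (integrable_coef k (ccontinuous_slice (x + h *: delta_mx 0 j) cf)).
- move=> h u _ _; rewrite -[X in is_cderive _ _ _ X]addr0 -(mulr0 (f (row_of_tuple u, x + h *: delta_mx 0 j))).
  apply: is_cderiveM; last exact: is_cderive_cst.
  apply: (is_cderive_line (fun x' => f (row_of_tuple u, x')) x (delta_mx 0 j) h _).1.
  exact/is_cderive_slice.
- exact: integrable_cell_cst.
- by [].
- move=> h u h1 cu; rewrite normcM normc_torus_character mulr1.
  apply: (le_trans _ (ler_norm B)); apply: hB; first exact: cell_row.
  move=> i; rewrite !mxE [X in `|X|]addrC addKr normrM.
  by rewrite eqxx /=; case: (i == j); rewrite ?normr1 ?mulr1 ?normr0 ?mulr0// ltW.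
Qed.

End Slices.

(** * Integration by parts on the torus *)

Section TorusByParts.
Local Open Scope classical_set_scope.
Local Open Scope complex_scope.
Variables (R : realType) (m : nat).
Local Notation RB := (measurableTypeR R).
Local Notation leb := (lebesgue_tuple R m).
Implicit Types (P dP h dh : 'rV[R]_m -> R[i]) (t : 'rV[R]_m).

Definition periodic_in (i : 'I_m) h :=
  forall t, h (t + (2 * pi) *: delta_mx 0 i) = h t.

(** The primitive takes the same value at both ends of a period. *)
Lemma integral_cell_derivative_real (g dg : 'rV[R]_m -> R) j B :
  (forall t (a : R), is_derive a 1 (fun a : R => g (t + a *: delta_mx 0 j))
     (dg (t + a *: delta_mx 0 j))) ->
  (forall t, continuous (fun a : R => dg (t + a *: delta_mx 0 j))) ->
  (forall t, g (t + (2 * pi) *: delta_mx 0 j) = g t) ->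
  measurable_fun setT (fun u : m.-tuple RB => dg (row_of_tuple u)) ->
  (forall t, in_cell t -> `|dg t| <= B) ->
  \int[leb]_(u in @cell R m) dg (row_of_tuple u) = 0.
Proof.
move=> gd cdg gp mdg dgB; rewrite /Rintegral integral_mkcond.
pose h (u : m.-tuple RB) := tprod (fun=> @cell_weight R) u * dg (row_of_tuple u).
have hE u : ((fun u => (dg (row_of_tuple u))%:E) \_ (@cell R m)) u = (h u)%:E.
  by rewrite patchE /h -cell_indic indicE; case: ifPn => _; rewrite ?mul1r ?mul0r.
under eq_integral => u _ do rewrite hE.
rewrite (@integral_zero_line R m (@cell_weight R) h j B)//.
- exact: measurable_cell_weight.
- exact: integrable_cell_weight.
- by apply: measurable_funM => //; apply: measurable_tprod => i; exact: measurable_cell_weight.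
- move=> u; rewrite /h -cell_indic indicE normrM.
  have [/set_mem cu|_] := boolP (u \in _); last by rewrite normr0 mul0r mulr0.
  by rewrite normr1 mul1r mulr1 dgB//; exact: cell_row.
- move=> u.
  pose x0 := row_of_tuple u - (tnth u j : R) *: delta_mx 0 j.
  pose c := \prod_(i | i != j) cell_weight (tnth u i).
  have c01 : c = 0 \/ c = 1.
    rewrite /c; elim/big_ind: _ => [|x y [->|->] [->|->]|i _]; rewrite ?mulr0 ?mul0r ?mul1r; auto.
    by rewrite /cell_weight indicE; case: (_ \in _); auto.
  have hu s : h (updt u j s) = c * (cell_weight s * dg (x0 + s *: delta_mx 0 j)).
    rewrite /h row_updt -/x0 mulrA; congr (_ * _).
    rewrite /tprod (bigD1 j)//= mulrC; congr (_ * _).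
      by apply: eq_bigr => i /negbTE ij; rewrite tnth_mktuple ij.
    by rewrite tnth_mktuple eqxx.
  under eq_integral => s _ do rewrite hu.
  have [->|->] := c01.
    by under eq_integral => s _ do rewrite mul0r; rewrite integral0.
  under eq_integral => s _ do rewrite mul1r.
  have := integral_derive_segment (F := fun a : R => g (x0 + a *: delta_mx 0 j)) (a := 0)
    (b := 2 * pi) _ (cdg x0) (gd x0).
  rewrite gp scale0r addr0 subrr => H; apply: etrans (H _); last by rewrite mulr_gt0// pi_gt0.
  rewrite [RHS]integral_mkcond; apply: eq_integral => s _.
  by rewrite patchE /cell_weight indicE; case: ifPn => _; rewrite ?mul1r ?mul0r.
Qed.

Lemma integral_cell_derivative P dP j :
  (forall t, is_cderive P t (delta_mx 0 j) (dP t)) -> ccontinuous dP ->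
  periodic_in j P -> cintegral leb (@cell R m) (fun u => dP (row_of_tuple u)) = 0.
Proof.
move=> Pd cdP Pp; have [c1 c2] := cdP.
have [m1 m2] := ccontinuous_rmeasurable cdP.
have [B1 h1] := continuous_bounded_on c1 (@compact_cell R m).
have [B2 h2] := continuous_bounded_on c2 (@compact_cell R m).
have lc t : continuous (fun a : R => t + a *: delta_mx 0 j : 'rV[R]_m).
  by move=> a; apply: cvgD; [exact: cvg_cst|apply: cvgZr_tmp; exact: cvg_id].
have dl t (a : R) := (is_cderive_line P t (delta_mx 0 j) a _).1 (Pd _).
apply: complex_ext => /=.
- apply: (@integral_cell_derivative_real (fun t => complex.Re (P t))
    (fun t => complex.Re (dP t)) j B1) => //.
  + by move=> t a; have [] := dl t a.
  + move=> t a; apply: (@continuous_comp _ _ _ (fun a : R => t + a *: delta_mx 0 j)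
      (fun t => complex.Re (dP t)) a); [exact: lc|exact: c1].
  + by move=> t; rewrite Pp.
- apply: (@integral_cell_derivative_real (fun t => complex.Im (P t))
    (fun t => complex.Im (dP t)) j B2) => //.
  + by move=> t a; have [] := dl t a.
  + move=> t a; apply: (@continuous_comp _ _ _ (fun a : R => t + a *: delta_mx 0 j)
      (fun t => complex.Im (dP t)) a); [exact: lc|exact: c2].
  + by move=> t; rewrite Pp.
Qed.

Lemma torus_character_line k t j (a : R) : torus_character k (t + a *: delta_mx 0 j) =
  expi (- (\sum_i (k 0 i)%:~R * t 0 i) + - (k 0 j)%:~R * a).
Proof.
congr expi; have := dot_line t j a (fun i => (k 0 i)%:~R).
have c (s : 'rV[R]_m) : \sum_i (k 0 i)%:~R * s 0 i = \sum_i s 0 i * (k 0 i)%:~R :> R.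
  by apply: eq_bigr => i _; rewrite mulrC.
by rewrite !c => ->; rewrite opprD mulNr [a * _]mulrC.
Qed.

Lemma expi_period (z : int) : expi (z%:~R * (2 * pi) : R) = 1 :> R[i].
Proof.
suff per (l : nat) : expi (l%:R * (2 * pi) : R) = 1 :> R[i].
  case: z => l; first exact: per.
  rewrite NegzE mulrNz mulNr; have := expiD (l.+1%:R * (2 * pi)) (- (l.+1%:R * (2 * pi)) : R).
  by rewrite subrr expi0 per mul1r => <-.
elim: l => [|l IH]; first by rewrite mul0r expi0.
rewrite -addn1 natrD mulrDl mul1r expiD IH mul1r.
have -> : 2 * pi = pi + pi :> R by ring.
by rewrite /expi cosD sinD sinpi cospi; apply: complex_ext => /=; ring.
Qed.

Lemma periodic_torus_character k j : periodic_in j (torus_character k).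
Proof.
by move=> t; rewrite torus_character_line expiD -intrN expi_period mulr1.
Qed.

Lemma is_cderive_torus_character k t j :
  is_cderive (torus_character k) t (delta_mx 0 j)
    ('i * (- (k 0 j)%:~R)%:C * torus_character k t).
Proof.
apply: (is_cderive_line0 _ t (delta_mx 0 j) _).2.
have -> : (fun a : R => torus_character k (t + a *: delta_mx 0 j)) =
   (fun a : R => expi (- (\sum_i (k 0 i)%:~R * t 0 i) + - (k 0 j)%:~R * a)).
  by apply/funext => a; exact: torus_character_line.
have -> : torus_character k t =
   expi (- (\sum_i (k 0 i)%:~R * t 0 i) + - (k 0 j)%:~R * 0) by rewrite mulr0 addr0.
by apply: is_cderive_expi; exact: is_derive_affine.
Qed.

Lemma continuous_linear_form (c : 'I_m -> R) :
  continuous (fun t : 'rV[R]_m => \sum_i c i * t 0 i).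
Proof.
have cs (r : seq 'I_m) : continuous (fun t : 'rV[R]_m => \sum_(i <- r) c i * t 0 i).
  elim: r => [|i r IH] t.
    have -> : (fun t : 'rV[R]_m => \sum_(i <- [::]) c i * t 0 i) = fun=> 0 :> R.
      by apply/funext => t'; rewrite big_nil.
    exact: cst_continuous.
  have -> : (fun t : 'rV[R]_m => \sum_(i <- i :: r) c i * t 0 i) =
      fun t => c i * t 0 i + \sum_(i <- r) c i * t 0 i.
    by apply/funext => t'; rewrite big_cons.
  exact: (cvgD (cvgMl_tmp (@coord_continuous R 1 m 0 i t)) (IH t)).
exact: cs.
Qed.

Lemma ccontinuous_torus_character k : ccontinuous (@torus_character R m k).
Proof.
apply: ccontinuous_expi => t.
exact: (cvgN (@continuous_linear_form (fun i => (k 0 i)%:~R) t)).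
Qed.

(** Integration by parts over the period cell. *)
Lemma torus_coef_derive k h dh j :
  (forall t, is_cderive h t (delta_mx 0 j) (dh t)) ->
  ccontinuous h -> ccontinuous dh -> periodic_in j h ->
  torus_coef k dh = 'i * ((k 0 j)%:~R)%:C * torus_coef k h.
Proof.
move=> hd ch cdh hp.
pose dP t := dh t * torus_character k t +
  h t * ('i * (- (k 0 j)%:~R)%:C * torus_character k t).
have cchi := ccontinuous_torus_character k.
have H : cintegral leb (@cell R m) (fun u => dP (row_of_tuple u)) = 0.
  apply: (@integral_cell_derivative (fun t => h t * torus_character k t) _ j).
  - by move=> t; apply: is_cderiveM => //; exact: is_cderive_torus_character.
  - apply: ccontinuousD; apply: ccontinuousM => //.
    by apply: ccontinuousM => //; exact: ccontinuous_cst.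
  - by move=> t; rewrite hp periodic_torus_character.
have H2 : torus_coef k (fun t => dh t + ('i * (- (k 0 j)%:~R)%:C) * h t) = 0.
  rewrite /torus_coef (_ : cintegral _ _ _ = 0) ?mulr0// -[RHS]H.
  by apply: eq_cintegral => u _; rewrite /dP; ring.
rewrite torus_coefD// in H2; last by apply: ccontinuousM => //; exact: ccontinuous_cst.
rewrite torus_coefZ// rmorphN mulrN mulNr in H2.
by apply/eqP; rewrite -subr_eq0; apply/eqP.
Qed.

End TorusByParts.

(** * Coefficients of derivatives *)

Section SmoothTorus.
Local Open Scope classical_set_scope.
Local Open Scope complex_scope.
Variables (R : realType) (m n : nat).
Local Notation space := ('rV[R]_m * 'rV[R]_n)%type.
Local Notation dir := (@direction R m n).
Implicit Types (f : space -> R[i]) (t : 'rV[R]_m) (x : 'rV[R]_n).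

Lemma partials_cat (V : normedModType R) I (b : I -> V) s1 s2 (f : V -> R[i]) :
  partials b (s1 ++ s2) f = partials b s1 (partials b s2 f).
Proof. by elim: s1 => //= i s1 ->. Qed.

Lemma partialsZ (V : normedModType R) I (b : I -> V) c (g : V -> R[i]) s :
  has_partials b g ->
  partials b s (fun y : V => c * g y) = fun y : V => c * partials b s g y.
Proof.
move=> hp; elim: s => [//|j s IH] /=; apply/funext => x; rewrite IH.
apply: ((is_cderiveP _ _ _ _).1 _).2; apply: is_cderiveZ.
exact/cderivable_is_cderive/hp.
Qed.

Lemma derive_shift (V : normedModType R) (g : V -> R) (a p v : V) :
  (forall y, g (y + p) = g y) -> 'D_v g (a + p) = 'D_v g a.
Proof.
move=> gp; rewrite /derive.
suff -> : (fun h : R => h^-1 *: ((g \o shift (a + p)) (h *: v) - g (a + p))) =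
  (fun h : R => h^-1 *: ((g \o shift a) (h *: v) - g a)) by [].
by apply/funext => h /=; rewrite gp addrA gp.
Qed.

Lemma torus_periodic_cderive f v : torus_periodic f -> torus_periodic (fun p => cderive f p v).
Proof.
move=> fp i t x; have gp (y : space) : f (y + ((2 * pi) *: delta_mx 0 i, 0)) = f y.
  by case: y => t' x'; rewrite -[RHS](fp i); congr (f (_, _)) => /=; rewrite addr0.
have -> : (t + (2 * pi) *: delta_mx 0 i, x) =
    (t, x) + ((2 * pi) *: delta_mx 0 i, 0) :> space by congr (_, _); rewrite /= addr0.
by apply: complex_ext => /=; apply: derive_shift => y; rewrite gp.
Qed.

Lemma smooth_TR_partials s f : smooth_TR f -> smooth_TR (partials dir s f).
Proof.
move=> [fp [fd fc]]; split; last first.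
  split; last by move=> s'; rewrite -partials_cat; exact: fc.
  by move=> s' i p; rewrite -partials_cat; exact: fd.
elim: s => [//|i s IH] /=; exact: torus_periodic_cderive.
Qed.

Lemma smooth_TR_ccontinuous f : smooth_TR f -> ccontinuous f.
Proof. by move=> [_ [_ /(_ [::])]]. Qed.

Lemma smooth_TR_is_cderive f i p : smooth_TR f ->
  is_cderive f p (dir i) (partials dir [:: i] f p).
Proof. by move=> [_ [/(_ [::] i p) fd _]]; exact: cderivable_is_cderive. Qed.

Lemma partials_slice_coef k s f : smooth_TR f ->
  partials (@xi_direction R n) s (slice_coef k f) =
  slice_coef k (partials dir (map inr s) f).
Proof.
move=> sf; elim: s => [//|j s IH] /=; rewrite IH; apply/funext => x.
have sg := smooth_TR_partials (map inr s) sf.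
apply: ((is_cderiveP _ _ _ _).1 _).2.
apply: is_cderive_slice_coef.
- exact: smooth_TR_ccontinuous.
- exact: (smooth_TR_ccontinuous (smooth_TR_partials (inr j :: map inr s) sf)).
- by move=> p; exact: (smooth_TR_is_cderive (inr j) p sg).
Qed.

Lemma has_partials_slice_coef k f : smooth_TR f ->
  has_partials (@xi_direction R n) (slice_coef k f).
Proof.
move=> sf s j x; rewrite partials_slice_coef//.
have sg := smooth_TR_partials (map inr s) sf.
apply: ((is_cderiveP _ _ _ _).1 _).1.
apply: is_cderive_slice_coef.
- exact: smooth_TR_ccontinuous.
- exact: (smooth_TR_ccontinuous (smooth_TR_partials (inr j :: map inr s) sf)).
- by move=> p; exact: (smooth_TR_is_cderive (inr j) p sg).
Qed.

Lemma is_cderive_torus_slice f t x i l :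
  is_cderive f (t, x) (dir (inl i)) l ->
  is_cderive (fun t' => f (t', x)) t (delta_mx 0 i) l.
Proof.
have E : (fun h : R => f ((t, x) + h *: dir (inl i))) =
    (fun h : R => f (t + h *: delta_mx 0 i, x)).
  by apply/funext => h; congr (f (_, _)) => /=; rewrite scaler0 addr0.
move=> H; apply: (is_cderive_line0 (fun t' => f (t', x)) t _ l).2; rewrite -E.
exact: (is_cderive_line0 f (t, x) _ l).1.
Qed.

Lemma slice_coef_torus_derivative k i f x : smooth_TR f ->
  slice_coef k (partials dir [:: inl i] f) x =
  'i * ((k 0 i)%:~R)%:C * slice_coef k f x.
Proof.
move=> sf; apply: (@torus_coef_derive R m k (fun t => f (t, x))).
- by move=> t; apply: is_cderive_torus_slice; exact: smooth_TR_is_cderive.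
- exact/ccontinuous_slice/smooth_TR_ccontinuous.
- exact/ccontinuous_slice/smooth_TR_ccontinuous/(smooth_TR_partials [:: inl i]).
- by move=> t; have [fp _] := sf; exact: fp.
Qed.

Lemma slice_coef_torus_partials k w f x : smooth_TR f ->
  slice_coef k (partials dir (map inl w) f) x =
  (\prod_(i <- w) ('i * ((k 0 i)%:~R)%:C)) * slice_coef k f x.
Proof.
move=> sf; elim: w => [|i w IH]; first by rewrite big_nil mul1r.
rewrite big_cons -mulrA -IH.
exact: (slice_coef_torus_derivative k i x (smooth_TR_partials (map inl w) sf)).
Qed.

Lemma prod_mi_word (c : 'I_m -> R) (gamma : multi_index m) :
  \prod_(i <- mi_word gamma) c i = \prod_i c i ^+ gamma i.
Proof.
rewrite /mi_word big_flatten big_map big_enum; apply: eq_bigr => i _.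
by rewrite big_nseq iter_mulr_1.
Qed.

(** Euclidean derivatives pass through the integral over the cell and torus
    derivatives become multipliers. *)
Lemma slice_coef_partial_TR k beta gamma f x : smooth_TR f ->
  slice_coef k (partial_TR beta gamma f) x =
  (\prod_(i <- mi_word gamma) ('i * ((k 0 i)%:~R)%:C)) *
  partials (@xi_direction R n) (mi_word beta) (slice_coef k f) x.
Proof.
move=> sf; rewrite /partial_TR partials_cat -partials_slice_coef; last exact: smooth_TR_partials.
have -> : slice_coef k (partials dir (map inl (mi_word gamma)) f) = fun x' =>
    (\prod_(i <- mi_word gamma) ('i * ((k 0 i)%:~R)%:C)) * slice_coef k f x'.
  by apply/funext => x'; exact: slice_coef_torus_partials.
by rewrite partialsZ//; exact: has_partials_slice_coef.
Qed.

Lemma normc_torus_multiplier (k : 'rV[int]_m) (gamma : multi_index m) :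
  normc (\prod_(i <- mi_word gamma) ('i * ((k 0 i)%:~R)%:C)) =
  \prod_i `|(k 0 i)%:~R| ^+ gamma i :> R.
Proof.
rewrite normc_prod -prod_mi_word; apply: eq_bigr => i _.
by rewrite normcM normc_i mul1r normc_real.
Qed.

End SmoothTorus.

(** * Powers of the cosine as a summability kernel *)

Section Kernel.
Local Open Scope complex_scope.
Variables (R : realType) (m : nat).

Lemma bin_central_max N j : ('C(2 * N, j) <= 'C(2 * N, N))%N.
Proof.
have up i : (i < N)%N -> ('C(2 * N, i) <= 'C(2 * N, i.+1))%N.
  move=> iN; rewrite -(leq_pmul2l (m := i.+1))// mul_bin_left leq_mul2r.
  by apply/orP; right; lia.
have below i : (i <= N)%N -> ('C(2 * N, i) <= 'C(2 * N, N))%N.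
  move=> iN; rewrite -(subKn iN); elim: (N - i)%N {iN} => [|d IH]; first by rewrite subn0.
  case: (ltnP d N) => dN; last by rewrite (_ : (N - d.+1 = N - d)%N)//; lia.
  by apply: leq_trans IH; have := up (N - d.+1)%N; rewrite -subSn// subSS; apply; lia.
case: (leqP j N) => [/below//|Nj].
case: (leqP j (2 * N)) => j2; last by rewrite bin_small.
by rewrite -bin_sub//; apply: below; lia.
Qed.

Lemma four_pow_le_bin N : (4 ^ N <= (2 * N).+1 * 'C(2 * N, N))%N.
Proof.
have -> : (4 ^ N = 2 ^ (2 * N))%N by rewrite expnM.
rewrite -[2%N]/((1 + 1)%N) expnDn.
apply: (@leq_trans (\sum_(i < (2 * N).+1) 'C(2 * N, N))%N); last first.
  by rewrite sum_nat_const card_ord.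
by apply: leq_sum => i _; rewrite !exp1n !muln1 bin_central_max.
Qed.

Definition kernel_coef N j : R := 'C(2 * N, j)%:R / 4 ^+ N.

Lemma kernel_coef_ge0 N j : 0 <= kernel_coef N j.
Proof. by rewrite divr_ge0// exprn_ge0. Qed.

Lemma kernel_coef_le N j : kernel_coef N j <= kernel_coef N N.
Proof.
by rewrite ler_wpM2r ?invr_ge0 ?exprn_ge0// ler_nat bin_central_max.
Qed.

(** The central binomial coefficient is the largest of 2 N + 1 numbers with
    sum 4^N. Hence the mass of the kernel decays only polynomially in N. *)
Lemma kernel_coef_ge N : (2 * N.+1)%:R^-1 <= kernel_coef N N.
Proof.
rewrite ler_pdivlMr ?exprn_gt0// ler_pdivrMl ?ltr0n//.
rewrite -natrX -natrM ler_nat (leq_trans (four_pow_le_bin N))// leq_mul2r.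
by apply/orP; right; lia.
Qed.

Lemma expiX (a : R) k : expi a ^+ k = expi (k%:R * a).
Proof.
elim: k => [|k IH]; first by rewrite mul0r expi0.
by rewrite exprS IH -expiD -natr1; congr expi; ring.
Qed.

Definition kernel1 N (theta : R) : R := ((1 + cos theta) / 2) ^+ N.

(** (1 + cos theta) / 2 is the square of cos (theta / 2), and
    (exp (i theta / 2) + exp (- i theta / 2))^(2 N) expands binomially. *)
Lemma kernel1_expand N theta : (kernel1 N theta)%:C =
  \sum_(j < (2 * N).+1) (kernel_coef N j)%:C * expi (((j%:Z - N%:Z)%:~R) * theta).
Proof.
have e1 : ((1 + cos theta) / 2)%:C = (4^-1)%:C * expi (- theta) * (1 + expi theta) ^+ 2.
  rewrite /expi cosN sinN; apply: complex_ext => /=.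
    rewrite !(mul0r, mulr0, subr0, addr0, add0r).
    have := cos2Dsin2 theta; set c := cos _; set s := sin _ => E.
    have -> : (4^-1 * c * ((1 + c) * (1 + c) - s * s) - 4^-1 * - s * ((1 + c) * s + s * (1 + c))) =
      4^-1 * (c + 2 * (c ^+ 2 + s ^+ 2) + c * (c ^+ 2 + s ^+ 2)) by ring.
    by rewrite E; field.
  rewrite !(mul0r, mulr0, subr0, addr0, add0r).
  have := cos2Dsin2 theta; set c := cos _; set s := sin _ => E.
  have -> : (4^-1 * c * ((1 + c) * s + s * (1 + c)) + 4^-1 * - s * ((1 + c) * (1 + c) - s * s)) =
     4^-1 * s * ((c ^+ 2 + s ^+ 2) - 1) by ring.
  by rewrite E subrr mulr0.
rewrite /kernel1 rmorphXn /= e1 exprMn -exprM exprDn mulr_sumr.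
apply: eq_bigr => j _; rewrite expr1n mul1r exprMn.
have -> : expi ((j%:Z - N%:Z)%:~R * theta) = expi (- theta) ^+ N * expi theta ^+ j.
  by rewrite !expiX -expiD; congr expi; rewrite intrB; ring.
have -> : (kernel_coef N j)%:C = 'C(2 * N, j)%:R * (4^-1)%:C ^+ N.
  by rewrite /kernel_coef -exprVn rmorphM rmorphXn rmorph_nat.
by rewrite -mulr_natl; ring.
Qed.

Definition kernel N (t s : 'rV[R]_m) : R := \prod_i kernel1 N (t 0 i - s 0 i).

Definition kernel_freq N (J : {ffun 'I_m -> 'I_(2 * N).+1}) : 'rV[int]_m :=
  \row_i ((J i)%:Z - N%:Z).

Lemma kernel_expand N t s : (kernel N t s)%:C =
  \sum_(J : {ffun 'I_m -> 'I_(2 * N).+1})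
    (\prod_i (kernel_coef N (J i))%:C) *
    expi (\sum_i (kernel_freq J 0 i)%:~R * t 0 i) * torus_character (kernel_freq J) s.
Proof.
rewrite /kernel rmorph_prod /=; under eq_bigr => i _ do rewrite kernel1_expand.
rewrite bigA_distr_bigA; apply: eq_bigr => J _.
rewrite /torus_character -sumrN !expi_sum -!big_split; apply: eq_bigr => i _ /=.
by rewrite -mulrA -expiD !mxE; congr (_ * expi _); ring.
Qed.

Lemma kernel1_ge0 N theta : 0 <= kernel1 N theta.
Proof. by rewrite exprn_ge0// divr_ge0// -lerBlDl sub0r cos_geN1. Qed.

Lemma kernel1_le1 N theta : kernel1 N theta <= 1.
Proof.
rewrite exprn_ile1// ?divr_ge0// -?lerBlDl ?sub0r ?cos_geN1//.
by rewrite ler_pdivrMr// mul1r; have := cos_le1 theta; lra.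
Qed.

Lemma kernel_ge0 N t s : 0 <= kernel N t s.
Proof. by apply: prodr_ge0 => i _; exact: kernel1_ge0. Qed.

Lemma lorentz_sum_le N :
  \sum_(j < (2 * N).+1) (1 + ((j%:Z - N%:Z)%:~R : R) ^+ 2)^-1 <= 6.
Proof.
(* Each term is at most the increment of this bounded increasing function. *)
pose phi (x : R) := 3 * x / (1 + `|x|).
have step (z : int) : (1 + (z%:~R : R) ^+ 2)^-1 <= phi (z + 1)%:~R - phi z%:~R.
  rewrite /phi intrD; set x : R := z%:~R.
  have [x0|x0] : 0 <= x \/ x <= -1.
    case: (leP 0 z) => z0; [left; by rewrite /x ler0z|right].
    by rewrite /x -(mulrN1z 1) ler_int; lia.
  - rewrite (ger0_norm x0) ger0_norm ?addr_ge0//.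
    have -> : 3 * (x + 1) / (1 + (x + 1)) - 3 * x / (1 + x) = 3 / ((2 + x) * (1 + x)).
      by field; rewrite !gt_eqF//; lra.
    rewrite ler_pdivlMr ?mulr_gt0//; [|lra|lra].
    rewrite ler_pdivrMl; last by nra.
    have [->|x1] : x = 0 \/ 1 <= x.
      move: x0; rewrite /x ler0z le_eqVlt => /orP[/eqP <-|z0]; first by left.
      by right; rewrite -[1]/(1%:~R) ler_int; lia.
      by lra.
    by nra.
  - rewrite ler0_norm; last by lra.
    rewrite ler0_norm; last by lra.
    have -> : 3 * (x + 1) / (1 - (x + 1)) - 3 * x / (1 - x) = 3 / (- x * (1 - x)).
      by field; apply/andP; split; lra.
    rewrite ler_pdivlMr; last by nra.
    by rewrite ler_pdivrMl; nra.
apply: (@le_trans _ _ (\sum_(0 <= j < (2 * N).+1)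
    (phi ((j.+1)%:Z - N%:Z)%:~R - phi (j%:Z - N%:Z)%:~R))).
  rewrite big_mkord; apply: ler_sum => j _.
  by rewrite (le_trans (step _))// -addrAC -(PoszD j 1) addn1.
rewrite (telescope_sumr (fun j => phi (j%:Z - N%:Z)%:~R))//.
have phi3 x : `|phi x| <= 3.
  have d0 : 0 < 1 + `|x| by rewrite ltr_pwDl.
  rewrite normrM normfV normrM (ger0_norm (ltW d0)) (ger0_norm (ler0n R 3)).
  by rewrite ler_pdivrMr// ler_wpM2l// lerDr.
rewrite (le_trans (ler_norm _))// (le_trans (ler_normB _ _))//.
have -> : 6 = 3 + 3 :> R by ring.
by rewrite lerD.
Qed.

End Kernel.

(** * Periodic functions bounded by their coefficients *)

Section TorusBound.
Local Open Scope classical_set_scope.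
Local Open Scope complex_scope.
Variables (R : realType) (m : nat).
Local Notation RB := (measurableTypeR R).
Local Notation leb := (lebesgue_tuple R m).
Implicit Types (h : 'rV[R]_m -> R[i]) (t : 'rV[R]_m).

(** The kernel is a trigonometric polynomial: averaging h against it involves
    finitely many Fourier coefficients of h. *)
Lemma average_kernel N t h : ccontinuous h ->
  ((2 * pi) ^- m)%:C * cintegral leb (@cell R m)
    (fun u => h (row_of_tuple u) * (kernel N t (row_of_tuple u))%:C) =
  \sum_(J : {ffun 'I_m -> 'I_(2 * N).+1})
    ((\prod_i (kernel_coef R N (J i))%:C) *
     expi (\sum_i (kernel_freq J 0 i)%:~R * t 0 i)) * torus_coef (kernel_freq J) h.
Proof.
move=> ch; have mc := @measurable_cell R m.
pose c (J : {ffun 'I_m -> 'I_(2 * N).+1}) := (\prod_i (kernel_coef R N (J i))%:C) *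
     expi (\sum_i (kernel_freq J 0 i)%:~R * t 0 i).
have -> : (fun u => h (row_of_tuple u) * (kernel N t (row_of_tuple u))%:C) =
  (fun u => \sum_(J : {ffun 'I_m -> 'I_(2 * N).+1}) c J *
    (h (row_of_tuple u) * torus_character (kernel_freq J) (row_of_tuple u))).
  apply/funext => u; rewrite kernel_expand mulr_sumr; apply: eq_bigr => J _.
  by rewrite /c mulrCA.
rewrite cintegral_sum//; last first.
  by move=> J; apply: cintegrableZ => //; exact: integrable_coef.
rewrite mulr_sumr; apply: eq_bigr => J _; rewrite cintegralZ//; last exact: integrable_coef.
by rewrite mulrCA.
Qed.

Lemma torus_coef_one_eq0 (k : 'rV[int]_m) : k != 0 -> torus_coef k (fun=> 1 : R[i]) = 0.
Proof.
move=> k0; have [j kj] : exists j, k 0 j != 0.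
  apply: contrapT => /forallNP H; case/negP: k0; apply/eqP/rowP => j.
  by rewrite mxE; apply/eqP/negPn/negP/H.
have c0 (z : R[i]) : ccontinuous (fun _ : 'rV[R]_m => z) by exact: ccontinuous_cst.
have := @torus_coef_derive R m k (fun=> 1) (fun=> 0) j (fun t => is_cderive_cst _ _ _)
  (c0 1) (c0 0) (fun=> erefl).
have -> : torus_coef k (fun=> 0 : R[i]) = 0.
  rewrite -[RHS](mul0r (torus_coef k (fun=> 1))) -(torus_coefZ k 0 (c0 1)).
  by congr torus_coef; apply/funext => t; rewrite mul0r.
move/esym/eqP; rewrite mulf_eq0 => /orP[|/eqP//]; rewrite mulf_eq0 => /orP[|].
  by rewrite eq_complex /= oner_eq0 andbF.
by rewrite fmorph_eq0 intr_eq0 (negbTE kj).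
Qed.

Lemma torus_coef0_one : torus_coef 0 (fun _ : 'rV[R]_m => 1 : R[i]) = 1.
Proof.
have -> : 1 = (1 : R)%:C by [].
rewrite -[in RHS](average_cst m 1) rmorphM /=; congr (_ * _).
have E (u : m.-tuple RB) : torus_character 0 (row_of_tuple u) = 1 :> R[i].
  rewrite /torus_character big1 ?oppr0 ?expi0// => i _.
  by rewrite mxE mul0r.
transitivity (cintegral leb (@cell R m) (fun=> 1)).
  by apply: eq_cintegral => u _; rewrite E mulr1.
apply: complex_ext => //=; rewrite -[RHS](mul0r (fine (leb (@cell R m)))).
by apply: Rintegral_cst; exact: measurable_cell.
Qed.

(** The previous identity for the constant function 1, all of whose
    coefficients but one vanish. *)
Lemma kernel_mass N t :
  (2 * pi) ^- m * \int[leb]_(u in @cell R m) kernel N t (row_of_tuple u) =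
  kernel_coef R N N ^+ m.
Proof.
have := @average_kernel N t (fun=> 1) (ccontinuous_cst _ _).
pose J0 : {ffun 'I_m -> 'I_(2 * N).+1} := [ffun=> inord N].
have J0N i : J0 i = N :> nat by rewrite ffunE inordK//; lia.
rewrite (bigD1 J0)//= [X in _ = _ + X]big1 ?addr0; last first.
  move=> J JJ0; rewrite torus_coef_one_eq0 ?mulr0//.
  apply: contra JJ0 => /eqP/rowP H; apply/eqP/ffunP => i; apply/val_inj => /=.
  by rewrite J0N; have := H i; rewrite !mxE => /eqP; rewrite subr_eq0 => /eqP[].
have -> : kernel_freq J0 = 0.
  by apply/rowP => i; rewrite !mxE J0N subrr.
rewrite torus_coef0_one mulr1 [X in expi X]big1 ?expi0 ?mulr1; last by move=> i _; rewrite mxE mul0r.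
under eq_bigr do rewrite J0N.
rewrite prodr_const card_ord -rmorphXn => /(congr1 (@complex.Re R)) /= <-.
rewrite [0 * Rintegral _ _ _]mul0r [RHS]subr0; congr (_ * _); apply: eq_Rintegral => u _ /=.
by rewrite mul1r mul0r subr0.
Qed.

(** All coefficients of the kernel are dominated by the central one, whose m-th
    power is the mass; so the bound is proportional to the mass. *)
Lemma normc_average_kernel_le N t h A : ccontinuous h -> 0 <= A ->
  (forall k, normc (torus_coef k h) <= A * \prod_i (1 + ((k 0 i)%:~R : R) ^+ 2)^-1) ->
  normc (((2 * pi) ^- m)%:C * cintegral leb (@cell R m)
    (fun u => h (row_of_tuple u) * (kernel N t (row_of_tuple u))%:C)) <=
  A * (6 * kernel_coef R N N) ^+ m.
Proof.
move=> ch A0 hA; rewrite average_kernel//.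
apply: (le_trans (normc_sum _ _ _)).
apply: (@le_trans _ _ (\sum_(J : {ffun 'I_m -> 'I_(2 * N).+1})
   A * \prod_i (kernel_coef R N N * (1 + (((J i)%:Z - N%:Z)%:~R : R) ^+ 2)^-1))).
  apply: ler_sum => J _; rewrite 2!normcM normc_expi mulr1 normc_prod.
  rewrite big_split mulrCA; apply: ler_pM.
  - by apply: prodr_ge0 => i _; exact: normc_ge0.
  - exact: normc_ge0.
  - apply: ler_prod => i _; rewrite normc_ge0 normc_real ger0_norm ?kernel_coef_ge0//.
    exact: kernel_coef_le.
  - apply: (le_trans (hA _)); rewrite le_eqVlt; apply/orP; left; apply/eqP.
    by congr (_ * _); apply: eq_bigr => i _; rewrite mxE.
rewrite -mulr_sumr ler_wpM2l// -(bigA_distr_bigA (fun (i : 'I_m) (j : 'I_(2 * N).+1) =>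
  kernel_coef R N N * (1 + ((j%:Z - N%:Z)%:~R : R) ^+ 2)^-1)).
rewrite -[leRHS](_ : \prod_(i < m) (6 * kernel_coef R N N) = _); last first.
  by rewrite prodr_const card_ord.
apply: ler_prod => i _; apply/andP; split.
  by apply: sumr_ge0 => j _; rewrite mulr_ge0 ?kernel_coef_ge0// invr_ge0 addr_ge0// sqr_ge0.
by rewrite -mulr_sumr mulrC ler_wpM2r ?kernel_coef_ge0// lorentz_sum_le.
Qed.

End TorusBound.

Section TorusEstimate.
Local Open Scope classical_set_scope.
Local Open Scope complex_scope.
Variables (R : realType) (m : nat).
Local Notation RB := (measurableTypeR R).
Local Notation leb := (lebesgue_tuple R m).
Implicit Types (h : 'rV[R]_m -> R[i]) (t s : 'rV[R]_m).

Lemma periodic_int_shift h i (z : int) t : periodic_in i h ->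
  h (t + (z%:~R * (2 * pi)) *: delta_mx 0 i) = h t.
Proof.
move=> hp; suff per (l : nat) t' : h (t' + (l%:R * (2 * pi)) *: delta_mx 0 i) = h t'.
  case: z => l; first exact: per.
  by rewrite NegzE mulrNz mulNr scaleNr -[LHS](per l.+1) subrK.
elim: l t' => [|l IH] t'; first by rewrite mul0r scale0r addr0.
by rewrite -(natr1 l) mulrDl mul1r scalerDl addrA hp IH.
Qed.

Lemma periodic_lattice_shift h (l : 'rV[int]_m) t : (forall i, periodic_in i h) ->
  h (t + \sum_i ((l 0 i)%:~R * (2 * pi)) *: delta_mx 0 i) = h t.
Proof.
move=> hp; elim: (index_enum _) t => [|i r IH] t; first by rewrite big_nil addr0.
by rewrite big_cons addrA IH periodic_int_shift.
Qed.

Lemma cos_int_shift (theta : R) (z : int) : cos (theta + z%:~R * (2 * pi)) = cos theta.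
Proof.
have := congr1 (@complex.Re R) (expiD theta (z%:~R * (2 * pi))).
by rewrite expi_period mulr1.
Qed.

Lemma reduce_angle (theta : R) : exists z : int, `|theta + z%:~R * (2 * pi)| <= pi.
Proof.
have p0 : 0 < 2 * pi :> R by rewrite mulr_gt0// pi_gt0.
exists (- Num.floor ((theta + pi) / (2 * pi))).
have /andP[] := floor_itv ((theta + pi) / (2 * pi)).
move: (Num.floor _) => f; rewrite ler_pdivlMr// ltr_pdivrMr// intrD rmorphN /= => f1 f2.
rewrite ler_norml; apply/andP; split; lra.
Qed.

Lemma cos_le_away (theta delta : R) : 0 <= delta -> delta <= `|theta| -> `|theta| <= pi ->
  cos theta <= cos delta.
Proof.
move=> d0 dt tp; have -> : cos theta = cos `|theta|.
  by case: (ler0P theta) => _; rewrite ?cosN.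
by rewrite leNgt ltr_cos -?leNgt// in_itv/= ?normr_ge0 ?d0//= (le_trans dt).
Qed.

Lemma kernel_le_away N t s (delta : R) i : 0 <= delta -> delta <= `|s 0 i - t 0 i| ->
  `|s 0 i - t 0 i| <= pi -> kernel N t s <= ((1 + cos delta) / 2) ^+ N.
Proof.
move=> d0 h1 h2; rewrite /kernel (bigD1 i)//=.
rewrite (@le_trans _ _ (kernel1 N (t 0 i - s 0 i)))//.
  rewrite ler_piMr ?kernel1_ge0// prodr_ile1// => j _.
  by rewrite kernel1_ge0 kernel1_le1.
rewrite /kernel1 lerXn2r ?nnegrE ?divr_ge0// -?lerBlDl ?sub0r ?cos_geN1//.
rewrite ler_pM2r// lerD2l; apply: cos_le_away => //; by rewrite distrC.
Qed.

Lemma kernel_lattice_shift N t s (l : 'rV[int]_m) :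
  kernel N t (s + \sum_i ((l 0 i)%:~R * (2 * pi)) *: delta_mx 0 i) = kernel N t s.
Proof.
apply: eq_bigr => i _; rewrite /kernel1; congr (((1 + _) / 2) ^+ N).
rewrite -[RHS](cos_int_shift _ (- l 0 i)); congr cos.
rewrite mxE summxE (bigD1 i)//= big1 ?addr0; last first.
  by move=> j ji; rewrite !mxE eq_sym (negbTE ji) mulr0.
by rewrite !mxE !eqxx mulr1 rmorphN; ring.
Qed.

Lemma lattice_shift_coord (l : 'rV[int]_m) i :
  (\sum_i ((l 0 i)%:~R * (2 * pi)) *: delta_mx 0 i : 'rV[R]_m) 0 i = (l 0 i)%:~R * (2 * pi).
Proof.
rewrite summxE (bigD1 i)//= big1 ?addr0; last first.
  by move=> j ji; rewrite !mxE eq_sym (negbTE ji) mulr0.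
by rewrite !mxE !eqxx mulr1.
Qed.

Lemma measurable_kernel N t :
  measurable_fun setT (fun u : m.-tuple RB => kernel N t (row_of_tuple u)).
Proof.
have := measurable_tprod (w := fun i x => kernel1 N (t 0 i - x)) (n := m) (R := R).
rewrite /tprod (_ : (fun u => _) = (fun u : m.-tuple RB => kernel N t (row_of_tuple u))).
  apply=> i; apply: measurable_funX; apply: measurable_funM; last exact: measurable_cst.
  apply: measurable_funD; first exact: measurable_cst.
  apply: (measurableT_comp (f := @cos R)).
    by apply: continuous_measurable_fun; exact: continuous_cos.
  by apply: measurable_funB => //; exact: measurable_cst.
by apply/funext => u; apply: eq_bigr => i _; rewrite mxE.
Qed.

Lemma kernel_le1 N t s : kernel N t s <= 1.
Proof. by apply: prodr_ile1 => i _; rewrite kernel1_ge0 kernel1_le1. Qed.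

(** If s is not within a small distance of t modulo the periods, then some
    coordinate of t - s reduces to an angle bounded away from 0, and the
    corresponding factor of the kernel is exponentially small in N. *)
Lemma kernel_concentration h t eta M : ccontinuous h -> (forall i, periodic_in i h) ->
  0 < eta -> (forall s, normc (h s - h t) <= M) -> exists2 c, 0 < c & forall N s,
  normc (h s - h t) * kernel N t s <= eta * kernel N t s + M * expR (- (c * N%:R)).
Proof.
move=> ch hp eta0 hM; have [d d0 hd] := ccontinuous_near ch t eta0.
have M0 : 0 <= M := le_trans (normc_ge0 _) (hM t).
(* Strictly below d, because smallness is only known as a non-strict inequality
   in each coordinate, and below pi. *)
pose delta := Num.min d 1 / 2.
have dd : 0 < delta by rewrite divr_gt0// lt_min d0 ltr01.
have dlt : delta < d.
  by have : Num.min d 1 <= d; [rewrite ge_min lexx|rewrite /delta; lra].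
have dpi : delta <= pi.
  have := pi_ge2 R; have : Num.min d 1 <= 1 by rewrite ge_min lexx orbT.
  rewrite /delta; lra.
have c0 : 0 < 1 - (1 + cos delta) / 2.
  have : cos delta < cos 0.
    by rewrite ltr_cos// in_itv/= ?lexx ?pi_ge0// (ltW dd).
  rewrite cos0; lra.
exists (1 - (1 + cos delta) / 2) => // N s.
have /choice[z hz] : forall i, exists z : int, `|s 0 i - t 0 i + z%:~R * (2 * pi)| <= pi.
  by move=> i; exact: reduce_angle.
pose l : 'rV[int]_m := \row_i z i.
pose s' := s + \sum_i ((l 0 i)%:~R * (2 * pi)) *: delta_mx 0 i.
have s'E i : s' 0 i - t 0 i = s 0 i - t 0 i + (z i)%:~R * (2 * pi).
  by rewrite mxE lattice_shift_coord mxE; ring.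
rewrite -(kernel_lattice_shift N t s l) -(periodic_lattice_shift l s hp) -/s'.
have E0 := expR_ge0 (- ((1 - (1 + cos delta) / 2) * N%:R)).
have [small|] := pselect (forall i, `|s' 0 i - t 0 i| <= delta).
  rewrite (@le_trans _ _ (eta * kernel N t s'))//; last by rewrite lerDl mulr_ge0.
  rewrite ler_wpM2r ?kernel_ge0// hd// (le_lt_trans _ dlt)//.
  by apply: row_norm_le => [|i]; [exact: ltW|have := small i; rewrite !mxE].
move=> /(existsNP _).2 [i /negP]; rewrite -ltNge => big.
rewrite (@le_trans _ _ (M * expR (- ((1 - (1 + cos delta) / 2) * N%:R))))//; last first.
  by rewrite lerDr mulr_ge0 ?kernel_ge0// ltW.
apply: ler_pM; [exact: normc_ge0|exact: kernel_ge0|exact: hM|].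
apply: (le_trans (@kernel_le_away N t s' delta i (ltW dd) (ltW big) _)).
  by rewrite s'E.
rewrite -mulNr [X in expR X]mulrC expRM_natl lerXn2r ?nnegrE ?expR_ge0//.
by apply: le_trans (expR_ge1Dx _); lra.
Qed.


Lemma inv_succ_le N : N.+1%:R^-1 <= 4 / (2 * N.+2)%:R :> R.
Proof.
by rewrite ler_pdivlMr ?ltr0n// ler_pdivrMl ?ltr0n// -natrM ler_nat; lia.
Qed.

(** Averaging against the kernel recovers h t up to an error that is
    exponentially small, while the mass of the kernel decays only
    polynomially; dividing by this mass and letting N tend to infinity leaves
    the bound coming from the coefficients. *)
Theorem torus_estimate h A t : ccontinuous h -> (forall i, periodic_in i h) -> 0 <= A ->
  (forall k, normc (torus_coef k h) <= A * \prod_i (1 + ((k 0 i)%:~R : R) ^+ 2)^-1) ->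
  normc (h t) <= 6 ^+ m * A.
Proof.
move=> ch hp A0 hA.
have [M hM] : exists M, forall s, normc (h s - h t) <= M.
  have [c1 c2] := ch.
  have [B1 h1] := continuous_bounded_on c1 (@compact_cell R m).
  have [B2 h2] := continuous_bounded_on c2 (@compact_cell R m).
  exists (B1 + B2 + normc (h t)) => s.
  have /choice[z hz] : forall i, exists z : int, `|s 0 i - pi + z%:~R * (2 * pi)| <= pi.
    by move=> i; exact: reduce_angle.
  rewrite -(periodic_lattice_shift (\row_i z i) s hp) (le_trans (le_normcD _ _))//.
  rewrite normcN lerD2r (le_trans (normc_le_ReIm _))//.
  have cs : in_cell (s + \sum_i (((\row_i z i) 0 i)%:~R * (2 * pi)) *: delta_mx 0 i).
    move=> i; rewrite mxE lattice_shift_coord mxE.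
    by have := hz i; rewrite ler_norml => /andP[? ?]; apply/andP; split; lra.
  by apply: lerD; [exact: h1|exact: h2].
have M0 : 0 <= M := le_trans (normc_ge0 _) (hM t).
apply/ler_addgt0Pr => e e0.
pose eta := e / 4; have eta0 : 0 < eta by rewrite divr_gt0.
have [c c0 conc] := kernel_concentration ch hp eta0 hM.
(* The error is divided by a mass of order at least N^(- m), so one power more
   than m is drawn from the exponential. *)
pose D : R := 2 * (M * (m.+1`!%:R * 4 ^+ m / c ^+ m.+1)).
have D0 : 0 <= D.
  by rewrite mulr_ge0// mulr_ge0// divr_ge0 ?mulr_ge0 ?exprn_ge0// ltW.
have D1 : 0 < 1 + D by rewrite ltr_pwDl.
have [N _ /(_ N (leqnn _)) /= hN] :=
  near_infty_natSinv_lt (PosNum (divr_gt0 (divr_gt0 e0 (ltr0n R 2)) D1)).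
pose W := kernel_coef R N.+1 N.+1.
have W0 : 0 < W by apply: lt_le_trans (kernel_coef_ge R N.+1); rewrite invr_gt0 ltr0n.
have Wm : 0 < W ^+ m by rewrite exprn_gt0.
pose K (u : m.-tuple RB) := kernel N.+1 t (row_of_tuple u).
have mK : cmeasurable (@cell R m) (fun u => (K u)%:C).
  by apply: cmeasurable_real; apply: measurable_funTS; exact: measurable_kernel.
have iK : cintegrable leb (@cell R m) (fun u => (K u)%:C).
  apply: (cintegrable_le _ _ (integrable_cell_cst m 1)) => //; first exact: measurable_cell.
  by move=> u _; rewrite normc_real ger0_norm ?kernel_ge0// kernel_le1.
have mh : cmeasurable (@cell R m) (fun u => h (row_of_tuple u)).
  exact/rmeasurable_cell/ccontinuous_rmeasurable.
have mhK : cmeasurable (@cell R m) (fun u => (h (row_of_tuple u) - h t) * (K u)%:C).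
  apply: cmeasurableM => //.
  by apply: cmeasurableD => //; exact: cmeasurable_cst.
pose B u := eta * K u + M * expR (- (c * N.+1%:R)).
have iKR : leb.-integrable (@cell R m) (EFin \o K) by have [] := iK.
have iB : leb.-integrable (@cell R m) (EFin \o B).
  apply: integrableDR; first exact: measurable_cell.
    by apply: integrableZlR => //; exact: measurable_cell.
  exact: integrable_cell_cst.
have hB u : normc ((h (row_of_tuple u) - h t) * (K u)%:C) <= B u.
  by rewrite normcM normc_real ger0_norm ?kernel_ge0//; exact: conc.
have BE : (2 * pi) ^- m * \int[leb]_(u in @cell R m) B u =
    eta * W ^+ m + M * expR (- (c * N.+1%:R)).
  rewrite RintegralD; last 3 first.
  - exact: measurable_cell.
  - by apply: integrableZlR => //; exact: measurable_cell.
  - exact: integrable_cell_cst.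
  rewrite mulrDr average_cst RintegralZl//; last exact: measurable_cell.
  by rewrite mulrCA kernel_mass.
have avg : (W ^+ m)%:C * h t = ((2 * pi) ^- m)%:C * cintegral leb (@cell R m)
      (fun u => h (row_of_tuple u) * (K u)%:C) -
    ((2 * pi) ^- m)%:C * cintegral leb (@cell R m)
      (fun u => (h (row_of_tuple u) - h t) * (K u)%:C).
  have mc := @measurable_cell R m.
  have i1 := cintegrable_le mc mhK iB (fun u _ => hB u).
  have i2 : cintegrable leb (@cell R m) (fun u => h t * (K u)%:C) by exact: cintegrableZ.
  have -> : (fun u => h (row_of_tuple u) * (K u)%:C) =
      (fun u => (h (row_of_tuple u) - h t) * (K u)%:C + h t * (K u)%:C).
    by apply/funext => u; ring.
  rewrite cintegralD// mulrDr addrC addKr cintegralZ// mulrCA mulrC; congr (_ * _).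
  rewrite -(kernel_mass N.+1 t) rmorphM /=; congr (_ * _).
  apply: complex_ext => //=; rewrite -[LHS](mul0r (fine (leb (@cell R m)))).
  by apply/esym/Rintegral_cst.
have up := normc_average_kernel_le N.+1 t ch A0 hA; rewrite -/W in up.
have mc := @measurable_cell R m.
have up2 := normc_average_le mhK iB (fun u _ => hB u); rewrite BE in up2.
have main : normc (h t) * W ^+ m <= A * (6 * W) ^+ m +
    2 * (eta * W ^+ m + M * expR (- (c * N.+1%:R))).
  rewrite mulrC -[W ^+ m in leLHS](ger0_norm (ltW Wm)) -normc_real -normcM avg.
  by rewrite (le_trans (le_normcD _ _))// normcN lerD.
rewrite -(ler_pM2r Wm) (le_trans main)//.
have -> : (6 ^+ m * A + e) * W ^+ m =
    A * (6 * W) ^+ m + (2 * (eta * W ^+ m) + e / 2 * W ^+ m).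
  by rewrite [(6 * W) ^+ m]exprMn /eta; field.
rewrite lerD2l mulrDr lerD2l.
have u0 : 0 < c * N.+1%:R by rewrite mulr_gt0.
have Eb := expRN_le_pow m.+1 u0.
apply: (@le_trans _ _ (D * N.+1%:R^-1 * W ^+ m)); last first.
  rewrite ler_wpM2r ?(ltW Wm)//.
  move: hN; rewrite ltr_pdivlMr// => /ltW; apply: le_trans.
  by rewrite mulrC ler_wpM2l// lerDr.
rewrite /D -!mulrA ler_wpM2l// ler_wpM2l// (le_trans Eb)//.
have WV : (2 * N.+2)%:R ^- m <= W ^+ m.
  by rewrite -exprVn lerXn2r ?nnegrE ?invr_ge0 ?(ltW W0)// kernel_coef_ge.
rewrite ler_wpM2l//.
apply: (@le_trans _ _ (4 ^+ m * (c ^- m.+1 * (N.+1%:R^-1 * (2 * N.+2)%:R ^- m)))); last first.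
  rewrite ler_wpM2l ?exprn_ge0// ler_wpM2l ?invr_ge0 ?exprn_ge0 ?(ltW c0)//.
  by rewrite ler_wpM2l// invr_ge0.
rewrite exprMn invfM mulrCA ler_wpM2l ?invr_ge0 ?exprn_ge0 ?(ltW c0)//.
rewrite exprS invfM mulrCA ler_wpM2l ?invr_ge0//.
rewrite -!exprVn -exprMn lerXn2r ?nnegrE ?mulr_ge0 ?invr_ge0//.
exact: inv_succ_le.
Qed.

End TorusEstimate.

(** * The mixed transform as an iterated transform *)

Section MixedTransform.
Local Open Scope classical_set_scope.
Local Open Scope complex_scope.
Variables (R : realType) (m n : nat).
Local Notation RB := (measurableTypeR R).
Local Notation space := ('rV[R]_m * 'rV[R]_n)%type.
Local Notation leb k := (lebesgue_tuple R k).
Local Notation fcell := (@fundamental_cell R m n).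
Implicit Types (f : space -> R[i]) (k : 'rV[int]_m).

Lemma measurable_fundamental_cell : measurable fcell.
Proof.
rewrite (_ : fcell = @cell R m `*` setT); last by apply/seteqP; split => p // [].
by apply: measurableX; [exact: measurable_cell|exact: measurableT].
Qed.

Lemma indic_fundamental_cell p : \1_fcell p = \1_(@cell R m) p.1 :> R.
Proof. by rewrite !indicE. Qed.

Definition modulated f k (p : m.-tuple RB * n.-tuple RB) : R[i] :=
  on_tuples f p * torus_character k (row_of_tuple p.1).

Lemma integrable_modulated f k : L1_TR f ->
  cintegrable (@lebesgue_TR R m n) fcell (modulated f k).
Proof.
move=> L1; have mD := measurable_fundamental_cell.
apply: (cintegrable_le mD _ (cintegrable_normc mD L1)) => [|p _].
  apply: cmeasurableM; first exact: cintegrable_cmeasurable L1.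
  apply: cmeasurable_expi; apply: measurable_funTS.
  have H := measurable_dot (\row_i (k 0 i)%:~R : 'rV[R]_m) (-1).
  have := measurableT_comp H (@measurable_fst _ _ (m.-tuple RB) (n.-tuple RB)).
  congr (measurable_fun _ _); apply/funext => p /=; rewrite mulN1r; congr (- _).
  by apply: eq_bigr => i _; rewrite !mxE.
by rewrite normcM normc_torus_character mulr1 normc_le_ReIm.
Qed.

Lemma modulated_partial_integral f k y :
  cintegral (leb m) setT (fun x => (\1_fcell (x, y))%:C * modulated f k (x, y)) =
  cintegral (leb m) (@cell R m) (fun x => modulated f k (x, y)).
Proof.
rewrite [RHS]cintegral_mkcond; apply: eq_cintegral => x _.
by rewrite indic_fundamental_cell.
Qed.

Lemma integrable_slice_coef f k : L1_TR f ->
  cintegrable (leb n) setT (fun v => slice_coef k f (row_of_tuple v)).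
Proof.
move=> L1; apply: cintegrableZ => //.
have mD := measurable_fundamental_cell.
have := cintegrable_partial_integral (cintegrable_mkcond mD (integrable_modulated k L1)).
by congr (cintegrable _ _ _); apply/funext => y; exact: modulated_partial_integral.
Qed.

(** Fubini on the product of the cell with Euclidean space. *)
Lemma mixed_fourierE f k xi : ccontinuous f -> L1_TR f ->
  mixed_fourier f k xi = fourier_int (-1) (slice_coef k f) xi.
Proof.
move=> cf L1; have mD := measurable_fundamental_cell.
pose e (v : n.-tuple RB) : R[i] := expi (-1 * \sum_j xi 0 j * tnth v j).
have me : cmeasurable setT e by apply: cmeasurable_expi; exact: measurable_dot.
have iM := integrable_modulated k L1.
have iE : cintegrable (@lebesgue_TR R m n) fcell (fun p => modulated f k p * e p.2).
  apply: (cintegrable_le mD _ (cintegrable_normc mD iM)) => [|p _].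
    apply: cmeasurableM; first exact: cintegrable_cmeasurable iM.
    have [me1 me2] := me; split; apply: measurable_funTS.
    - exact: (measurableT_comp me1 (@measurable_snd _ _ (m.-tuple RB) (n.-tuple RB))).
    - exact: (measurableT_comp me2 (@measurable_snd _ _ (m.-tuple RB) (n.-tuple RB))).
  by rewrite normcM normc_expi mulr1 normc_le_ReIm.
have iG := cintegrable_partial_integral (cintegrable_mkcond mD iE).
have GE y : cintegral (leb m) setT
    (fun x => (\1_fcell (x, y))%:C * (modulated f k (x, y) * e y)) =
    cintegral (leb m) (@cell R m) (fun x => modulated f k (x, y)) * e y.
  rewrite -modulated_partial_integral mulrC -cintegralZ//.
    by apply: eq_cintegral => x _; ring.
  apply: (cintegrable_mkcond _ (g := fun x => modulated f k (x, y))).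
    exact: measurable_cell.
  exact: (integrable_coef k (ccontinuous_slice (row_of_tuple y) cf)).
rewrite /mixed_fourier (_ : (fun p => _) = (fun p => modulated f k p * e p.2)); last first.
  apply/funext => p; rewrite /modulated -mulrA; congr (_ * _); rewrite -expiD; congr expi.
  rewrite mulN1r opprD; congr (- _ - _).
  by apply: eq_bigr => i _; rewrite mxE.
rewrite cintegral_mkcond -(cFubini21 (cintegrable_mkcond mD iE)) -cintegralZ//.
apply: eq_cintegral => y _; rewrite GE mulrA.
by congr (_ * _).
Qed.

End MixedTransform.

(** * Gevrey bounds and exponential decay *)

Section Gevrey.
Variables (R : realType) (m : nat).
Implicit Types (k : 'rV[int]_m) (sigma : R).

Lemma freq_norm_ge k i : `|(k 0 i)%:~R| <= freq_norm R k.
Proof.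
rewrite -sqrtr_sqr ler_wsqrtr// (bigD1 i)//= lerDl.
by apply: sumr_ge0 => j _; exact: sqr_ge0.
Qed.

Lemma freq_norm_le k (B : R) : 0 <= B -> (forall i, `|(k 0 i)%:~R| <= B) ->
  freq_norm R k <= m.+1%:R * B.
Proof.
move=> B0 kB; rewrite -[leRHS]ger0_norm ?mulr_ge0// -sqrtr_sqr ler_wsqrtr//.
apply: (@le_trans _ _ (\sum_(i < m) B ^+ 2)).
  by apply: ler_sum => i _; rewrite -real_normK ?num_real// lerXn2r ?nnegrE.
rewrite sumr_const card_ord exprMn -[leLHS]mulr_natl ler_wpM2r ?sqr_ge0//.
by rewrite -natrX ler_nat; lia.
Qed.

Lemma freq_norm_ge0 k : 0 <= freq_norm R k.
Proof. exact: sqrtr_ge0. Qed.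

Lemma powR_root (a sigma : R) : 0 <= a -> 0 < sigma -> (a `^ (1 / sigma)) `^ sigma = a.
Proof. by move=> a0 s0; rewrite -powRrM mulfVK ?gt_eqF// powRr1. Qed.

Lemma powR_exprn (a r : R) p : 0 <= a -> (a ^+ p) `^ r = (a `^ r) ^+ p.
Proof. by move=> a0; rewrite -powR_mulrn// -powRrM mulrC powRrM powR_mulrn ?powR_ge0. Qed.

(** After taking sigma-th roots, the bounds on all powers say that the terms
    of an exponential series are bounded, and half the exponent makes that
    series summable. *)
Lemma gevrey_exp_decay (Y Q C a sigma : R) : 0 <= Y -> 0 <= Q -> 0 < C -> 0 <= a ->
  0 < sigma ->
  (forall N, a ^+ N * Y <= Q * C ^+ N * N`!%:R `^ sigma) ->
  Y * expR (sigma / 2 * (a / C) `^ (1 / sigma)) <= Q * 2 `^ sigma.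
Proof.
move=> Y0 Q0 C0 a0 s0 H.
have [Qe|Qn] := eqVneq Q 0.
  have := H 0; rewrite !expr0 Qe !mul0r mul1r => Y00.
  by rewrite (_ : Y = 0) ?mul0r//; apply/eqP; rewrite eq_le Y0 Y00.
have Qp : 0 < Q by rewrite lt_neqAle eq_sym Qn.
pose tau := 1 / sigma; have tau0 : 0 <= tau by rewrite divr_ge0// ltW.
have YQ0 : 0 <= Y / Q by rewrite divr_ge0.
have aC0 : 0 <= a / C by rewrite divr_ge0// ltW.
have half := @expR_half_le R ((Y / Q) `^ tau) ((a / C) `^ tau) (powR_ge0 _ _) (powR_ge0 _ _).
have pows N : (Y / Q) `^ tau * ((a / C) `^ tau) ^+ N <= N`!%:R.
  rewrite -powR_exprn// -powRM ?exprn_ge0//.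
  rewrite -[leRHS](_ : (N`!%:R `^ sigma) `^ tau = _); last first.
    by rewrite -powRrM mulrC mulfVK ?gt_eqF// powRr1.
  apply: ge0_ler_powR; rewrite ?nnegrE//.
    by rewrite mulr_ge0 ?exprn_ge0.
  rewrite exprMn exprVn mulrA ler_pdivrMr ?exprn_gt0// mulrAC ler_pdivrMr//.
  by rewrite mulrC (le_trans (H N))// le_eqVlt; apply/orP; left; apply/eqP; ring.
have {half pows} h := half pows; rewrite -ler_pdivrMl// mulrA.
have -> : Q^-1 * Y = ((Y / Q) `^ tau) `^ sigma by rewrite powR_root// mulrC.
have -> : expR (sigma / 2 * (a / C) `^ tau) = expR ((a / C) `^ tau / 2) `^ sigma.
  by rewrite -expRM; congr expR; ring.
rewrite -powRM ?powR_ge0 ?expR_ge0//.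
by apply: ge0_ler_powR; rewrite ?nnegrE ?mulr_ge0 ?powR_ge0 ?expR_ge0// ltW.
Qed.

(** Conversely, the exponential dominates each term of its series. *)
Lemma pow_exp_decay (sigma delta a : R) p : 0 < sigma -> 0 < delta -> 0 <= a ->
  a ^+ p * expR (- (delta * a `^ (1 / sigma))) <=
    (sigma / delta) `^ sigma ^+ p * p`!%:R `^ sigma.
Proof.
move=> s0 d0 a0; pose tau := 1 / sigma.
have u0 : 0 <= delta / sigma * a `^ tau by rewrite mulr_ge0 ?powR_ge0// divr_ge0// ltW.
have := pow_fact_le_expR p u0.
rewrite ler_pdivrMr ?ltr0n ?fact_gt0// => h.
rewrite expRN ler_pdivrMr ?expR_gt0//.
have -> : a ^+ p = ((a `^ tau) ^+ p) `^ sigma.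
  by rewrite powR_exprn ?powR_ge0// powR_root.
have -> : expR (delta * a `^ tau) = expR (delta / sigma * a `^ tau) `^ sigma.
  by rewrite -expRM; congr expR; field; rewrite gt_eqF.
have sd0 : 0 <= sigma / delta by rewrite divr_ge0// ltW.
have P0 : 0 <= (sigma / delta) ^+ p * p`!%:R by rewrite mulr_ge0// exprn_ge0.
have E0 := expR_ge0 (delta / sigma * a `^ tau).
rewrite -(powR_exprn sigma p sd0) -powRM ?exprn_ge0// -powRM//.
apply: ge0_ler_powR; rewrite ?nnegrE; [exact: ltW|by rewrite exprn_ge0// powR_ge0|
  exact: mulr_ge0|].
move: h; rewrite exprMn => h.
rewrite -[sigma / delta]invf_div exprVn -mulrA ler_pdivlMl ?exprn_gt0 ?divr_gt0//.
by rewrite [leRHS]mulrC.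
Qed.

End Gevrey.

(** * From bounds on the function to decay of the transform *)

Section Characterization.
Local Open Scope classical_set_scope.
Local Open Scope complex_scope.
Variables (R : realType) (m n : nat) (sigma mu : R).
Hypotheses (sigma_ge1 : 1 <= sigma) (mu_ge : 1 / 2 <= mu).
Local Notation space := ('rV[R]_m * 'rV[R]_n)%type.
Implicit Types (f : space -> R[i]) (k : 'rV[int]_m) (t : 'rV[R]_m) (x : 'rV[R]_n).
Implicit Types (alpha beta : multi_index n) (gamma : multi_index m).

Local Notation dirs := (@xi_direction R n).

Lemma sigma_gt0 : 0 < sigma. Proof. exact: lt_le_trans sigma_ge1. Qed.

(** The condition in in_S_C with the weights moved to the right-hand side. *)
Definition gevrey_bound (C M : R) f := forall alpha beta gamma t x,
  normc ((monomial x alpha)%:C * partial_TR beta gamma f (t, x)) <=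
  M * C ^+ (mi_size (mi_add alpha beta) + mi_size gamma)
  * npow sigma (mi_fact gamma) * npow mu (mi_fact alpha * mi_fact beta).

Lemma npow_gt0 (r : R) a : (0 < a)%N -> 0 < npow r a.
Proof. by move=> a0; rewrite powR_gt0// ltr0n. Qed.

Lemma gevrey_boundP C M f : 0 < C ->
  gevrey_bound C M f <-> forall alpha beta gamma t x,
    C ^- (mi_size (mi_add alpha beta) + mi_size gamma)
    * (mi_fact gamma)%:R `^ (- sigma) * (mi_fact alpha * mi_fact beta)%:R `^ (- mu)
    * normc ((monomial x alpha)%:C * partial_TR beta gamma f (t, x)) <= M.
Proof.
move=> C0.
have E alpha beta gamma (y : R) :
    (C ^- (mi_size (mi_add alpha beta) + mi_size gamma)
      * (mi_fact gamma)%:R `^ (- sigma) * (mi_fact alpha * mi_fact beta)%:R `^ (- mu)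
      * y <= M) =
    (y <= M * C ^+ (mi_size (mi_add alpha beta) + mi_size gamma)
      * npow sigma (mi_fact gamma) * npow mu (mi_fact alpha * mi_fact beta)).
  have p1 : 0 < npow sigma (mi_fact gamma) by rewrite npow_gt0// mi_fact_gt0.
  have p2 : 0 < npow mu (mi_fact alpha * mi_fact beta).
    by rewrite npow_gt0// muln_gt0 !mi_fact_gt0.
  rewrite !powRN -/(npow sigma _) -/(npow mu _) -!invfM mulrC ler_pdivrMr; last first.
    by rewrite !mulr_gt0// exprn_gt0.
  by rewrite !mulrA.
split=> H alpha beta gamma t x; first by rewrite E; exact: H.
by rewrite -E; exact: H.
Qed.

Lemma gevrey_bound_ge0 C M f : 0 < C -> gevrey_bound C M f -> 0 <= M.
Proof.
move=> C0 /(gevrey_boundP _ _ C0) /(_ [ffun=> 0] [ffun=> 0] [ffun=> 0] 0 0).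
apply: le_trans; rewrite mulr_ge0 ?normc_ge0// mulr_ge0 ?powR_ge0// mulr_ge0 ?powR_ge0//.
by rewrite invr_ge0 exprn_ge0// ltW.
Qed.

Lemma gevrey_bound_le C C' M f : 0 < C -> C <= C' -> gevrey_bound C M f ->
  gevrey_bound C' M f.
Proof.
move=> C0 CC' H alpha beta gamma t x; apply: (le_trans (H _ _ _ _ _)).
have M0 := gevrey_bound_ge0 C0 H.
rewrite ler_wpM2r ?npow_ge0// ler_wpM2r ?npow_ge0// ler_wpM2l//.
by rewrite lerXn2r// nnegrE ltW// (lt_le_trans C0).
Qed.

Lemma torus_coef_weighted_partial k f alpha beta gamma x : smooth_TR f ->
  normc (torus_coef k (fun t => (monomial x alpha)%:C * partial_TR beta gamma f (t, x))) =
  \prod_i `|(k 0 i)%:~R| ^+ gamma i *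
  normc ((monomial x alpha)%:C * partials dirs (mi_word beta) (slice_coef k f) x).
Proof.
move=> sf; rewrite torus_coefZ; last first.
  exact/ccontinuous_slice/smooth_TR_ccontinuous/smooth_TR_partials.
rewrite -/(slice_coef k (partial_TR beta gamma f) x) slice_coef_partial_TR//.
by rewrite mulrCA normcM normc_torus_multiplier.
Qed.

(** Torus derivatives become powers of the frequency. *)
Lemma slice_coef_gevrey C M f k alpha beta gamma x : smooth_TR f ->
  gevrey_bound C M f ->
  \prod_i `|(k 0 i)%:~R| ^+ gamma i *
  normc ((monomial x alpha)%:C * partials dirs (mi_word beta) (slice_coef k f) x) <=
  2 * (M * C ^+ (mi_size (mi_add alpha beta) + mi_size gamma)
    * npow sigma (mi_fact gamma) * npow mu (mi_fact alpha * mi_fact beta)).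
Proof.
move=> sf H; rewrite -torus_coef_weighted_partial//.
apply: normc_torus_coef_le => [|t]; last exact: H.
apply: ccontinuous_rmeasurable; apply: ccontinuousM; first exact: ccontinuous_cst.
exact/ccontinuous_slice/smooth_TR_ccontinuous/smooth_TR_partials.
Qed.

Definition mi_single (i : 'I_m) (N : nat) : multi_index m :=
  [ffun j => if j == i then N else 0].

Lemma mi_size_single i N : mi_size (mi_single i N) = N.
Proof.
rewrite /mi_size (bigD1 i)//= ffunE eqxx big1 ?addn0// => j ji.
by rewrite ffunE (negbTE ji).
Qed.

Lemma mi_fact_single i N : mi_fact (mi_single i N) = N`!.
Proof.
rewrite /mi_fact (bigD1 i)//= ffunE eqxx big1 ?muln1// => j ji.
by rewrite ffunE (negbTE ji).
Qed.

Lemma prod_single (c : 'I_m -> R) i N : \prod_j c j ^+ mi_single i N j = c i ^+ N.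
Proof.
rewrite (bigD1 i)//= ffunE eqxx big1 ?mulr1// => j ji.
by rewrite ffunE (negbTE ji).
Qed.

(** The constant m + 1 accounts for freq_norm k being at most m + 1 times the
    largest coordinate of k. *)
Definition decay_exponent (C : R) : R := sigma / 2 * (m.+1%:R * C) `^ (- (1 / sigma)).

Lemma decay_exponent_gt0 C : 0 < C -> 0 < decay_exponent C.
Proof.
by move=> C0; rewrite mulr_gt0 ?divr_gt0 ?sigma_gt0// powR_gt0// mulr_gt0.
Qed.

(** The exponential decay is read off at the largest coordinate of k. *)
Lemma exp_freq_norm_le (Y Q C : R) k : 0 <= Y -> 0 <= Q -> 0 < C -> Y <= Q ->
  (forall i N, `|(k 0 i)%:~R| ^+ N * Y <= Q * C ^+ N * npow sigma N`!) ->
  expR (decay_exponent C * freq_norm R k `^ (1 / sigma)) * Y <= Q * 2 `^ sigma.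
Proof.
move=> Y0 Q0 C0 YQ H; have s0 := sigma_gt0.
have t1 : 0 < 1 / sigma by rewrite divr_gt0.
have t0 := ltW t1.
have [[i0 _]|no] := pselect (exists i : 'I_m, True); last first.
  have -> : freq_norm R k = 0.
    by rewrite /freq_norm big1 ?sqrtr0// => i; case: no; exists i.
  rewrite powR0 ?gt_eqF// mulr0 expR0 mul1r.
  rewrite (le_trans YQ)// ler_peMr// -[leLHS](powRr0 2).
  by apply: ler_powR; [rewrite ler1n|exact: ltW].
have [i _ imax] := @arg_maxnP _ i0 xpredT (fun i => absz (k 0 i)) isT.
have kN j : `|(k 0 j)%:~R| = (absz (k 0 j))%:R :> R.
  by rewrite -intr_norm -abszE.
have nle : freq_norm R k <= m.+1%:R * `|(k 0 i)%:~R|.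
  by apply: freq_norm_le => // j; rewrite !kN ler_nat; exact: imax.
have := @gevrey_exp_decay R Y Q C `|(k 0 i)%:~R| sigma Y0 Q0 C0 (normr_ge0 _) s0 (H i).
apply: le_trans; rewrite mulrC ler_wpM2l// ler_expR /decay_exponent -mulrA.
rewrite ler_wpM2l ?divr_ge0 ?(ltW s0)//.
rewrite powRN ler_pdivrMl ?powR_gt0 ?mulr_gt0// -powRM ?mulr_ge0 ?(ltW C0) ?invr_ge0 ?(ltW C0)//.
apply: ge0_ler_powR; rewrite ?nnegrE ?freq_norm_ge0//.
  by rewrite !mulr_ge0 ?invr_ge0 ?(ltW C0).
by rewrite -mulrA [C * _]mulrC mulfVK ?gt_eqF.
Qed.

End Characterization.

Section ForwardDirection.
Local Open Scope classical_set_scope.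
Local Open Scope complex_scope.
Variables (R : realType) (m n : nat) (sigma mu : R).
Hypotheses (sigma_ge1 : 1 <= sigma) (mu_ge : 1 / 2 <= mu).
Local Notation space := ('rV[R]_m * 'rV[R]_n)%type.
Local Notation dirs := (@xi_direction R n).

Definition spectral_decay (C0 C1 eps : R) (F : 'rV[int]_m -> 'rV[R]_n -> R[i]) :=
  forall (alpha beta : multi_index n) k xi,
    expR (eps * freq_norm R k `^ (1 / sigma)) *
      normc ((monomial xi alpha)%:C * partials dirs (mi_word beta) (F k) xi) <=
    C0 * C1 ^+ mi_size (mi_add alpha beta) * npow mu (mi_fact alpha * mi_fact beta).

Lemma spectral_decay_rapid C0 C1 eps F : spectral_decay C0 C1 eps F <->
  forall k, rapid mu C1 (C0 * expR (- (eps * freq_norm R k `^ (1 / sigma)))) (F k).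
Proof.
split=> H.
- move=> k alpha beta xi; have := H alpha beta k xi.
  rewrite mulrC -ler_pdivlMr ?expR_gt0// -expRN => /le_trans; apply.
  by rewrite le_eqVlt; apply/orP; left; apply/eqP; ring.
- move=> alpha beta k xi; rewrite mulrC -ler_pdivlMr ?expR_gt0// -expRN.
  apply: (le_trans (H k alpha beta xi)).
  by rewrite le_eqVlt; apply/orP; left; apply/eqP; ring.
Qed.

Lemma decay_const_ge0 C : 0 <= C -> 0 <= decay_const n mu C.
Proof. by move=> C0; rewrite mulr_ge0 ?npow_ge0// mulr_ge0 ?exprn_ge0. Qed.

(** Differentiate to all orders in a single torus direction. *)
Lemma slice_coef_spectral_decay C M (f : space -> R[i]) : smooth_TR f -> 1 <= C ->
  gevrey_bound sigma mu C M f ->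
  spectral_decay (2 * M * 2 `^ sigma) C (decay_exponent m sigma C) (fun k => slice_coef k f).
Proof.
move=> sf C1 H alpha beta k x; have C0 : 0 < C := lt_le_trans ltr01 C1.
have M0 := gevrey_bound_ge0 C0 H.
pose Q := 2 * (M * C ^+ mi_size (mi_add alpha beta) * npow mu (mi_fact alpha * mi_fact beta)).
have Q0 : 0 <= Q by rewrite mulr_ge0// mulr_ge0 ?npow_ge0// mulr_ge0// exprn_ge0// ltW.
have HQ gamma := @slice_coef_gevrey R m n sigma mu C M f k alpha beta gamma x sf H.
rewrite [leRHS](_ : _ = Q * 2 `^ sigma); last by rewrite /Q; ring.
apply: (@exp_freq_norm_le R m sigma sigma_ge1 _ Q C k) => //.
- exact: normc_ge0.
- have := HQ [ffun=> 0].
  rewrite big1 ?mul1r => [|i _]; last by rewrite ffunE expr0.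
  rewrite (_ : mi_size [ffun=> 0] = 0) ?addn0; last first.
    by rewrite /mi_size big1// => i _; rewrite ffunE.
  rewrite (_ : mi_fact [ffun=> 0] = 1); last by rewrite /mi_fact big1// => i _; rewrite ffunE.
  by rewrite /npow powR1 mulr1.
- move=> i N; have := HQ (mi_single i N).
  rewrite prod_single mi_size_single mi_fact_single => /le_trans; apply.
  by rewrite exprD le_eqVlt; apply/orP; left; apply/eqP; rewrite /Q; ring.
Qed.

(** The Euclidean transform acts on all the coefficients with one and the
    same loss, so the decay in k is kept. *)
Lemma gevrey_mixed_fourier C M (f : space -> R[i]) : smooth_TR f -> L1_TR f -> 1 <= C ->
  gevrey_bound sigma mu C M f ->
  (forall k, has_partials dirs (mixed_fourier f k)) /\
  spectral_decay (2 * decay_const n mu C * pi ^+ n * (2 * M * 2 `^ sigma))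
    (4 * decay_rate mu C) (decay_exponent m sigma C) (mixed_fourier f).
Proof.
move=> sf L1 C1 H.
have M0 := gevrey_bound_ge0 (lt_le_trans ltr01 C1) H.
have cf := smooth_TR_ccontinuous sf.
have FE k : mixed_fourier f k = fourier_int (-1) (slice_coef k f).
  by apply/funext => xi; exact: mixed_fourierE.
have D := (spectral_decay_rapid _ _ _ _).1 (slice_coef_spectral_decay sf C1 H).
have K0 (k : 'rV[int]_m) : 0 <= 2 * M * 2 `^ sigma *
    expR (- (decay_exponent m sigma C * freq_norm R k `^ (1 / sigma))).
  by rewrite mulr_ge0 ?expR_ge0// mulr_ge0 ?powR_ge0// mulr_ge0.
have mk k : rmeasurable (slice_coef k f).
  exact/ccontinuous_rmeasurable/ccontinuous_slice_coef.
have hk k := has_partials_slice_coef k sf.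
have n1 : `|-1 : R| = 1 by rewrite normrN1.
split=> [k|]; first by rewrite FE; exact: (has_partials_fourier mu_ge C1 (K0 k) (hk k) (mk k) (D k) n1).
apply: (spectral_decay_rapid _ _ _ _).2 => k; rewrite FE.
have := rapid_fourier mu_ge C1 (K0 k) (hk k) (mk k) (D k) n1.
by rewrite mulrA.
Qed.

End ForwardDirection.

Section TransformMeasurability.
Local Open Scope classical_set_scope.
Local Open Scope complex_scope.
Variables (R : realType) (n : nat).
Local Notation RB := (measurableTypeR R).
Local Notation leb := (lebesgue_tuple R n).

Lemma cvg_Rintegral d (T : measurableType d) (mu : {measure set T -> \bar R})
    (f_ : nat -> T -> R) (f B : T -> R) :
  (forall j, measurable_fun setT (f_ j)) -> measurable_fun setT f ->
  mu.-integrable setT (EFin \o B) -> (forall j u, `|f_ j u| <= B u) ->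
  (forall u, f_ j u @[j --> \oo] --> f u) ->
  \int[mu]_u f_ j u @[j --> \oo] --> \int[mu]_u f u.
Proof.
move=> mf_ mf iB fB fc.
have fc' : {ae mu, forall x, [set: T] x -> (EFin \o f_ ^~ x) j @[j --> \oo] --> (f x)%:E}.
  by apply/aeW => x _; apply: cvg_EFin; [exact: nearW|exact: fc].
have fB' : {ae mu, forall x j, [set: T] x -> (`|(f_ j x)%:E| <= (B x)%:E)%E}.
  by apply/aeW => x j _; rewrite lee_fin.
have [fi _ lim] := @dominated_convergence _ T R mu setT measurableT (fun j => EFin \o f_ j)
  (EFin \o f) (EFin \o B) (fun j => (measurable_EFinP _ _).2 (mf_ j))
  ((measurable_EFinP _ _).2 mf) fc' iB fB'.
apply: fine_cvg; rewrite fineK//; exact: integrable_fin_num.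
Qed.

(** By dominated convergence the transform is continuous. *)
Lemma rmeasurable_fourier_L1 s (g : 'rV[R]_n -> R[i]) :
  cintegrable leb setT (fun u => g (row_of_tuple u)) -> rmeasurable (fourier_int s g).
Proof.
move=> gi; have iB := cintegrable_normc measurableT gi.
pose phi (xi : 'rV[R]_n) (u : n.-tuple RB) :=
  g (row_of_tuple u) * expi (s * \sum_j xi 0 j * (tnth u j : R)).
have iphi xi : cintegrable leb setT (phi xi) by exact: integrable_fourier_L1.
have nphi xi u : normc (phi xi u) <=
    `|complex.Re (g (row_of_tuple u))| + `|complex.Im (g (row_of_tuple u))|.
  by rewrite normcM normc_expi mulr1 normc_le_ReIm.
have mphi xi := cintegrable_cmeasurable (iphi xi).
have th (x_ : nat -> 'rV[R]_n) (x : 'rV[R]_n) (u : n.-tuple RB) : x_ k @[k --> \oo] --> x ->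
    s * (\sum_j x_ k 0 j * (tnth u j : R)) @[k --> \oo] -->
    s * (\sum_j x 0 j * (tnth u j : R)).
  have E (y : 'rV[R]_n) : \sum_j y 0 j * (tnth u j : R) = \sum_j (tnth u j : R) * y 0 j.
    by apply: eq_bigr => j _; rewrite mulrC.
  move=> xx; apply: cvgMl_tmp; rewrite E; under eq_fun do rewrite E.
  exact: (cvg_comp _ _ xx (@continuous_linear_form R n (fun j => tnth u j : R) x)).
split.
- apply: (measurable_row (H := fun xi => complex.Re (fourier_int s g xi))) => x_ x xx.
  apply: (cvg_Rintegral (f_ := fun k u => complex.Re (phi (x_ k) u))
    (f := fun u => complex.Re (phi x u)) _ _ iB).
  + by move=> k; have [] := mphi (x_ k).
  + by have [] := mphi x.
  + by move=> k u; exact: le_trans (Re_le_normc _) (nphi _ _).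
  + move=> u; under eq_fun do rewrite Re_mul /=; rewrite Re_mul /=.
    by apply: cvgB; apply: cvgMl_tmp; apply: continuous_cvg; [exact: continuous_cos|exact: th|
      exact: continuous_sin|exact: th].
- apply: (measurable_row (H := fun xi => complex.Im (fourier_int s g xi))) => x_ x xx.
  apply: (cvg_Rintegral (f_ := fun k u => complex.Im (phi (x_ k) u))
    (f := fun u => complex.Im (phi x u)) _ _ iB).
  + by move=> k; have [] := mphi (x_ k).
  + by have [] := mphi x.
  + by move=> k u; exact: le_trans (Im_le_normc _) (nphi _ _).
  + move=> u; under eq_fun do rewrite Im_mul /=; rewrite Im_mul /=.
    by apply: cvgD; apply: cvgMl_tmp; apply: continuous_cvg; [exact: continuous_sin|exact: th|
      exact: continuous_cos|exact: th].
Qed.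

End TransformMeasurability.

(** * From decay of the transform to bounds on the function *)

Section FrequencyGrowth.
Variables (R : realType) (m : nat) (sigma eps : R).
Hypotheses (sigma_ge1 : 1 <= sigma) (eps0 : 0 < eps).
Local Notation tau := (1 / sigma).

Let delta := eps / m.+1%:R.
Let B := (sigma / delta) `^ sigma.

Lemma delta_gt0 : 0 < delta. Proof. by rewrite divr_gt0. Qed.

Definition growth_const := 1 + 2 * (npow sigma 2 * B ^+ 2).
Definition growth_rate := 1 + npow sigma 4 * B.

Lemma growth_rate_ge1 : 1 <= growth_rate.
Proof. by rewrite lerDl mulr_ge0 ?npow_ge0// powR_ge0. Qed.

Lemma growth_const_ge1 : 1 <= growth_const.
Proof. by rewrite lerDl mulr_ge0// mulr_ge0 ?npow_ge0// exprn_ge0// powR_ge0. Qed.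

(** Two more powers of z than p are available from the exponential, which
    pays for the factor 1 + z^2; at z = 0 powers are of no use, whence the
    summands 1 in the two constants. *)
Lemma coordinate_growth (z : int) p :
  `|z%:~R| ^+ p * expR (- (delta * `|z%:~R| `^ tau)) <=
  growth_const * growth_rate ^+ p * npow sigma p`! * (1 + (z%:~R : R) ^+ 2)^-1.
Proof.
have s0 : 0 < sigma := lt_le_trans ltr01 sigma_ge1; have s1 := sigma_ge1.
have B0 : 0 <= B by exact: powR_ge0.
have f1 : 1 <= npow sigma p`!.
  by apply: npow_ge1; [lra|exact: fact_gt0].
have G1 := exprn_ege1 p growth_rate_ge1; have A1 := growth_const_ge1.
rewrite ler_pdivlMr; last by rewrite ltr_pwDl// sqr_ge0.
rewrite -real_normK ?num_real//; set a : R := `|_|.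
have a0 : 0 <= a by exact: normr_ge0.
have [az|a1] : a = 0 \/ 1 <= a.
  rewrite /a -intr_norm; case: (eqVneq z 0) => [->|zn]; first by left; rewrite normr0.
  by right; rewrite -[1]/(1%:~R) ler_int; lia.
- have -> : 1 + a ^+ 2 = 1 by rewrite az expr0n addr0.
  rewrite mulr1 az.
  apply: (@le_trans _ _ 1); last first.
    by rewrite -[leLHS]mulr1 ler_pM// mulr_ege1.
  rewrite mulr_ile1 ?expR_ge0 ?exprn_ge0//; first by case: p {f1 G1} => [|p]; rewrite ?expr0 ?exprS ?mul0r.
  by rewrite -expR0 ler_expR oppr_le0 mulr_ge0 ?powR_ge0// ltW// delta_gt0.
- have := @pow_exp_decay R sigma delta a p.+2 s0 delta_gt0 a0; rewrite -/B => h.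
  apply: (@le_trans _ _ (2 * (a ^+ p.+2 * expR (- (delta * a `^ tau))))).
    have -> : a ^+ p * expR (- (delta * a `^ tau)) * (1 + a ^+ 2) =
      (1 + a ^+ 2) * (a ^+ p * expR (- (delta * a `^ tau))) by ring.
    have -> : 2 * (a ^+ p.+2 * expR (- (delta * a `^ tau))) =
      (2 * a ^+ 2) * (a ^+ p * expR (- (delta * a `^ tau))) by rewrite !exprS; ring.
    rewrite ler_wpM2r ?mulr_ge0 ?expR_ge0 ?exprn_ge0//.
    by have := exprn_ege1 2 a1; lra.
  have f2 : npow sigma p.+2`! <= npow sigma p`! * (npow sigma 2 * npow sigma 4 ^+ p).
    rewrite -npowX -!npowM; apply: ge0_ler_powR; rewrite ?nnegrE ?ler_nat ?fact_add2_le//.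
    exact: ltW.
  apply: (@le_trans _ _ (2 * (B ^+ p.+2 * (npow sigma p`! * (npow sigma 2 * npow sigma 4 ^+ p))))).
    rewrite ler_wpM2l// (le_trans h)// ler_wpM2l// exprn_ge0//.
  rewrite [leLHS](_ : _ = 2 * (npow sigma 2 * B ^+ 2) * (npow sigma 4 * B) ^+ p * npow sigma p`!); last first.
    by rewrite exprMn !exprS expr0; ring.
  rewrite ler_wpM2r ?npow_ge0// ler_pM ?exprn_ge0 ?mulr_ge0 ?npow_ge0 ?exprn_ge0//.
    by rewrite /growth_const lerDr.
  by rewrite lerXn2r ?nnegrE ?mulr_ge0 ?npow_ge0// /growth_rate ?lerDr// addr_ge0// mulr_ge0// npow_ge0.
Qed.

Lemma npow_prod (I : finType) (c : I -> nat) :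
  npow sigma (\prod_i c i) = \prod_i npow sigma (c i).
Proof. by apply: (big_morph (npow sigma) (npowM sigma)); rewrite /npow powR1. Qed.

(** The exponential weight is split evenly over the coordinates, leaving a
    summable product. *)
Lemma frequency_growth (k : 'rV[int]_m) (gamma : multi_index m) :
  \prod_i `|(k 0 i)%:~R| ^+ gamma i * expR (- (eps * freq_norm R k `^ tau)) <=
  growth_const ^+ m * growth_rate ^+ mi_size gamma * npow sigma (mi_fact gamma) *
  \prod_i (1 + ((k 0 i)%:~R : R) ^+ 2)^-1.
Proof.
have s0 : 0 < sigma := lt_le_trans ltr01 sigma_ge1; have s1 := sigma_ge1.
have t0 : 0 <= tau by rewrite divr_ge0// ltW.
apply: (@le_trans _ _ (\prod_i (`|(k 0 i)%:~R| ^+ gamma i *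
    expR (- (delta * `|(k 0 i)%:~R| `^ tau))))).
  rewrite big_split /=; apply: ler_wpM2l.
    by apply: prodr_ge0 => i _; rewrite exprn_ge0.
  rewrite -expR_sum ler_expR sumrN lerN2.
  apply: (@le_trans _ _ (\sum_(i < m) delta * freq_norm R k `^ tau)).
    apply: ler_sum => i _; rewrite ler_wpM2l ?(ltW delta_gt0)//.
    apply: ge0_ler_powR; rewrite ?nnegrE ?freq_norm_ge0//; exact: freq_norm_ge.
  rewrite sumr_const card_ord -mulrnAl ler_wpM2r ?powR_ge0// /delta -mulr_natr mulrAC.
  by rewrite ler_pdivrMr// ler_wpM2l ?(ltW eps0)// ler_nat.
have -> : growth_const ^+ m * growth_rate ^+ mi_size gamma * npow sigma (mi_fact gamma) *
    \prod_i (1 + ((k 0 i)%:~R : R) ^+ 2)^-1 =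
  \prod_i (growth_const * growth_rate ^+ gamma i * npow sigma (gamma i)`! *
    (1 + ((k 0 i)%:~R : R) ^+ 2)^-1).
  rewrite !big_split /= prodr_const card_ord /mi_fact npow_prod /mi_size; congr (_ * _ * _ * _).
  by rewrite expr_sum.
apply: ler_prod => i _; rewrite mulr_ge0 ?expR_ge0 ?exprn_ge0//=.
exact: coordinate_growth.
Qed.

End FrequencyGrowth.

Section BackwardDirection.
Local Open Scope classical_set_scope.
Local Open Scope complex_scope.
Variables (R : realType) (m n : nat) (sigma mu : R).
Hypotheses (sigma_ge1 : 1 <= sigma) (mu_ge : 1 / 2 <= mu).
Local Notation space := ('rV[R]_m * 'rV[R]_n)%type.
Local Notation dirs := (@xi_direction R n).

Lemma spectral_decay_le C0 C1 C eps (F : 'rV[int]_m -> 'rV[R]_n -> R[i]) :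
  0 <= C0 -> 0 <= C1 -> C1 <= C ->
  spectral_decay sigma mu C0 C1 eps F -> spectral_decay sigma mu C0 C eps F.
Proof.
move=> C00 C10 C1C H alpha beta k xi; apply: (le_trans (H _ _ _ _)).
rewrite ler_wpM2r ?npow_ge0// ler_wpM2l// lerXn2r ?nnegrE//.
exact: le_trans C1C.
Qed.

(** Decay of g and of its product with the squared norm is what Fourier
    inversion asks for. *)
Lemma rapid_decays C K (g : 'rV[R]_n -> R[i]) : 1 <= C -> 0 <= K -> rapid mu C K g ->
  exists L, decays L g /\ decays L (fun xi => (sqnorm xi)%:C * g xi).
Proof.
move=> C1 K0 H.
have /choice[L dec] : forall beta, exists L, decays L (mono_partial g beta [::]).
  move=> beta; eexists.
  exact: (decays_mono_partial mu_ge C1 beta K0 H (isT : sorted (@ord_leq n) [::])).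
have d0 : decays (L [ffun=> 0]) g.
  move=> x; have := dec [ffun=> 0] x; rewrite /mono_partial /monomial big1 ?mul1r// => i _.
  by rewrite ffunE expr0.
have dj j : decays (L (mi_single j 2)) (fun x => (x 0 j ^+ 2)%:C * g x).
  by move=> x; have := dec (mi_single j 2) x; rewrite /mono_partial /monomial prod_single.
exists (L [ffun=> 0] + \sum_j L (mi_single j 2)); split=> x.
  apply: (le_trans (d0 x)); rewrite ler_wpM2r ?(ltW (weight_gt0 _))// lerDl.
  by apply: sumr_ge0 => j _; exact: decays_ge0 (dj j).
apply: (@le_trans _ _ ((\sum_j L (mi_single j 2)) * weight x)); last first.
  by rewrite ler_wpM2r ?(ltW (weight_gt0 _))// lerDr (decays_ge0 d0).
rewrite /sqnorm rmorph_sum /= mulr_suml mulr_suml (le_trans (normc_sum _ _ _))//.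
by apply: ler_sum => j _; exact: dj.
Qed.

Variables (f : space -> R[i]) (C0 C eps : R).
Hypotheses (sf : smooth_TR f) (L1 : L1_TR f) (C00 : 0 < C0) (C1 : 1 <= C) (eps0 : 0 < eps).
Hypothesis hp : forall k, has_partials dirs (mixed_fourier f k).
Hypothesis hD : spectral_decay sigma mu C0 C eps (mixed_fourier f).

Let K (k : 'rV[int]_m) := C0 * expR (- (eps * freq_norm R k `^ (1 / sigma))).

Let K_ge0 (k : 'rV[int]_m) : 0 <= K k.
Proof. by rewrite mulr_ge0 ?expR_ge0// ltW. Qed.

Let cf := smooth_TR_ccontinuous sf.

Let FE k : mixed_fourier f k = fourier_int (-1) (slice_coef k f).
Proof. by apply/funext => xi; exact: mixed_fourierE. Qed.

Let rF k : rapid mu C (K k) (mixed_fourier f k).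
Proof. exact: (spectral_decay_rapid _ _ _ _ _ _).1. Qed.

Let mF k : rmeasurable (mixed_fourier f k).
Proof. by rewrite FE; apply: rmeasurable_fourier_L1; exact: integrable_slice_coef. Qed.

Lemma slice_coef_inversion k : slice_coef k f =
  fun x => ((2 * pi) ^- n)%:C * fourier_int 1 (mixed_fourier f k) x.
Proof.
have [L [d1 d2]] := rapid_decays C1 (K_ge0 k) (rF k).
apply/funext => x; rewrite FE; apply: (@fourier_inversion R n _ _ _ L); rewrite -?FE//.
- exact: ccontinuous_slice_coef.
- exact: integrable_slice_coef.
Qed.

Let A := (2 * pi) ^- n * (2 * decay_const n mu C * pi ^+ n).

Let A_ge0 : 0 <= A.
Proof.
have dc : 0 <= decay_const n mu C by apply: decay_const_ge0; exact: le_trans C1.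
apply: mulr_ge0; first by rewrite invr_ge0 exprn_ge0// mulr_ge0// pi_ge0.
apply: mulr_ge0; last by rewrite exprn_ge0// pi_ge0.
exact: mulr_ge0.
Qed.

Lemma rapid_slice_coef k : rapid mu (4 * decay_rate mu C) (A * K k) (slice_coef k f).
Proof.
move=> alpha beta x; rewrite slice_coef_inversion.
have n1 : `|1 : R| = 1 by rewrite normr1.
rewrite partialsZ; last exact: (has_partials_fourier mu_ge C1 (K_ge0 k) (hp k) (mF k) (rF k) n1).
have h := rapid_fourier mu_ge C1 (K_ge0 k) (hp k) (mF k) (rF k) n1 alpha beta x.
have c0 : 0 <= (2 * pi) ^- n :> R by rewrite invr_ge0 exprn_ge0// mulr_ge0// pi_ge0.
rewrite mulrCA normcM normc_real (ger0_norm c0) /A -4!mulrA ler_wpM2l//.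
by apply: (le_trans h); rewrite -!mulrA.
Qed.

Let Gc := growth_const m sigma eps.
Let Gr := growth_rate m sigma eps.

(** The torus estimate applied to t |-> x^alpha d_x^beta d_t^gamma f (t, x),
    whose coefficients are those of x^alpha d_x^beta f times a monomial in k. *)
Lemma gevrey_of_spectral_decay :
  gevrey_bound sigma mu (Num.max (4 * decay_rate mu C) Gr) (6 ^+ m * (A * C0 * Gc ^+ m)) f.
Proof.
move=> alpha beta gamma t x.
set D := 4 * decay_rate mu C.
have D1 : 0 <= D by rewrite mulr_ge0// (le_trans ler01)// rate_ge1.
have G1 : 1 <= Gr  := growth_rate_ge1 m sigma eps.
have Gc0 : 0 <= Gc by apply: le_trans ler01 _; exact: growth_const_ge1.
pose Q := D ^+ mi_size (mi_add alpha beta) * npow mu (mi_fact alpha * mi_fact beta).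
have Q0 : 0 <= Q by rewrite mulr_ge0 ?npow_ge0// exprn_ge0.
pose S := Gr ^+ mi_size gamma * npow sigma (mi_fact gamma).
have S0 : 0 <= S by rewrite mulr_ge0 ?npow_ge0// exprn_ge0// (le_trans ler01).
have AC0 : 0 <= A * C0 := mulr_ge0 A_ge0 (ltW C00).
have GcM : 0 <= Gc ^+ m by exact: exprn_ge0.
have sp := smooth_TR_partials (map inr (mi_word beta) ++ map inl (mi_word gamma)) sf.
have cp : ccontinuous (fun t => partial_TR beta gamma f (t, x)).
  exact/ccontinuous_slice/smooth_TR_ccontinuous.
have := @torus_estimate R m (fun t => (monomial x alpha)%:C * partial_TR beta gamma f (t, x))
  (A * C0 * Gc ^+ m * (Q * S)) t.
have -> : 6 ^+ m * (A * C0 * Gc ^+ m * (Q * S)) = 6 ^+ m * (A * C0 * Gc ^+ m) * (Q * S).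
  by ring.
move=> H; apply: le_trans (H _ _ _ _) _.
- by apply: ccontinuousM => //; exact: ccontinuous_cst.
- by move=> i t'; have [pp _] := sp; rewrite [partial_TR _ _ _ _]pp.
- exact: mulr_ge0 (mulr_ge0 AC0 GcM) (mulr_ge0 Q0 S0).
- move=> k; rewrite torus_coef_weighted_partial//.
  apply: (@le_trans _ _ (\prod_i `|(k 0 i)%:~R| ^+ gamma i * (A * K k * Q))).
    rewrite ler_wpM2l//; first by apply: prodr_ge0 => i _; rewrite exprn_ge0.
    by rewrite /Q mulrA; exact: rapid_slice_coef.
  have g := frequency_growth sigma_ge1 eps0 k gamma.
  apply: (@le_trans _ _ (A * C0 * Q * (Gc ^+ m * Gr ^+ mi_size gamma *
      npow sigma (mi_fact gamma) * \prod_i (1 + ((k 0 i)%:~R : R) ^+ 2)^-1))).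
    rewrite [leLHS](_ : _ = A * C0 * Q * (\prod_i `|(k 0 i)%:~R| ^+ gamma i *
      expR (- (eps * freq_norm R k `^ (1 / sigma))))); last by rewrite /K; ring.
    by rewrite ler_wpM2l// (mulr_ge0 AC0 Q0).
  by rewrite /S le_eqVlt; apply/orP; left; apply/eqP; ring.
rewrite -[leRHS]mulrA -[leRHS]mulrA; apply: ler_wpM2l.
  exact: mulr_ge0 (exprn_ge0 m (ler0n R 6)) (mulr_ge0 AC0 GcM).
rewrite /Q /S exprD.
rewrite [leLHS](_ : _ = D ^+ mi_size (mi_add alpha beta) * Gr ^+ mi_size gamma *
  (npow sigma (mi_fact gamma) * npow mu (mi_fact alpha * mi_fact beta))); last by ring.
rewrite ler_wpM2r ?mulr_ge0 ?npow_ge0// ler_pM ?exprn_ge0 ?(le_trans ler01 G1)//.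
- by rewrite lerXn2r ?nnegrE ?le_max ?D1 ?lexx.
- by rewrite lerXn2r ?nnegrE ?le_max ?D1 ?lexx ?orbT// (le_trans ler01).
Qed.

End BackwardDirection.

(** * The characterization *)

Theorem proposition3p8 (R : realType) (m n : nat) (sigma mu : R)
    (f : 'rV[R]_m * 'rV[R]_n -> R[i]) :
  1 <= sigma -> 1 / 2 <= mu ->
  smooth_TR f -> L1_TR f ->
  in_S sigma mu f <->
  (forall k : 'rV[int]_m,
      has_partials (@xi_direction R n) (mixed_fourier f k)) /\
  exists C0 C1 eps : R, [/\ 0 < C0, 0 < C1, 0 < eps &
    forall (alpha beta : multi_index n) (k : 'rV[int]_m) (xi : 'rV[R]_n),
      expR (eps * freq_norm R k `^ (1 / sigma))
      * normc ((monomial xi alpha)%:C%C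
               * partials (@xi_direction R n) (mi_word beta)
                   (mixed_fourier f k) xi)
      <= C0 * C1 ^+ mi_size (mi_add alpha beta)
         * (mi_fact alpha * mi_fact beta)%:R `^ mu].
Proof.
move=> sigma_ge1 mu_ge sf L1; split.
- move=> [C C_gt0 [_ [M HM]]].
  have C1 : 1 <= Num.max C 1 by rewrite le_max lexx orbT.
  have gb : gevrey_bound sigma mu (Num.max C 1) M f.
    apply: (@gevrey_bound_le R m n sigma mu C) => //; first by rewrite le_max lexx.
    exact/gevrey_boundP.
  have [hp hD] := gevrey_mixed_fourier sigma_ge1 mu_ge sf L1 C1 gb.
  split=> //.
  set K := 2 * decay_const _ _ _ * _ * _ in hD; set D := 4 * _ in hD.
  exists (`|K| + 1), D, (decay_exponent m sigma (Num.max C 1)); split.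
  + by rewrite ltr_wpDl.
  + by rewrite mulr_gt0// (lt_le_trans ltr01)// rate_ge1.
  + by apply: decay_exponent_gt0 => //; exact: lt_le_trans C1.
  + move=> alpha beta k xi; apply: (le_trans (hD alpha beta k xi)).
    rewrite ler_wpM2r ?powR_ge0// ler_wpM2r ?exprn_ge0//.
      by rewrite mulr_ge0// (le_trans ler01)// rate_ge1.
    by rewrite (le_trans (ler_norm _))// lerDl.
- move=> [hp [C0 [C1 [eps [C0_gt0 C1_gt0 eps_gt0 H]]]]].
  have C1' : 1 <= Num.max C1 1 by rewrite le_max lexx orbT.
  have hD : spectral_decay sigma mu C0 (Num.max C1 1) eps (mixed_fourier f).
    by apply: (@spectral_decay_le R m n sigma mu C0 C1) H; rewrite ?le_max ?lexx// ltW.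
  have gb := gevrey_of_spectral_decay sigma_ge1 mu_ge sf L1 C0_gt0 C1' eps_gt0 hp hD.
  set C := Num.max (4 * _) _ in gb; set M := 6 ^+ m * _ in gb.
  have C_gt0 : 0 < C.
    by rewrite lt_max (lt_le_trans ltr01 (growth_rate_ge1 m sigma eps)) orbT.
  by exists C => //; split=> //; exists M; exact/gevrey_boundP.
Qed.
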